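(* Let $\Omega=P+\sqrt{-1}Q$ with $P,Q\in M_n(\mathbb{R})$ symmetric and $Q$ positive definite, and consider the translation invariant complex structure $J_\Omega$ on $X=(\mathbb{R}/\mathbb{Z})^n\times T^n$ associated with $\Omega$. Choose any open covering $\mathcal{U}$ of $(\mathbb{R}/\mathbb{Z})^n$ satisfying conditions (U1)–(U3) (stated in the context), and consider the associated strict deformation quantization $\{\phi^k_{H_P,\mathcal{U}}\}_k$. For all $f\in C_c^\infty(X)$, $$\lim_{k\to\infty}\|\phi^k_{H_P,\mathcal{U}}(f)-T^k(f)\|=0,$$ where $T^k$ is the Berezin–Toeplitz deformation quantization and the Hilbert spaces on which the two operators act are identified by the unitary isomorphism $\mathcal{H}_k\simeq H^0(X_{J_\Omega};L^k)$, $\vartheta_b^k\mapsto\Theta^k_{\Omega,b}$, $b\in B_k=(\frac1k\mathbb{Z}/\mathbb{Z})^n$.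
   Context: $T=\mathbb{R}/2\pi\mathbb{Z}$. $X=(\mathbb{R}/\mathbb{Z})^n\times T^n$ is the quotient of $\mathbb{R}^n\times T^n$ by the $\mathbb{Z}^n$-action $(x,\theta)\mapsto(x+m,\theta)$, with symplectic form $\omega=\sum_idx_i\wedge d\theta_i$ and Lagrangian fibration $\mu\colon X\to B=(\mathbb{R}/\mathbb{Z})^n$, $\mu(x,\theta)=x$, with fibers $X_b$; $B$ has its standard affine structure. The prequantum line bundle $(L,\nabla)$ on $X$ is the quotient of $(\underline{\mathbb{C}},d-\sqrt{-1}\sum_ix_id\theta_i)$ on $\mathbb{R}^n\times T^n$ by the lifted action $(x,\theta,v)\mapsto(x+m,\theta,e^{\sqrt{-1}\langle m,\theta\rangle}v)$. Thus sections of $L^k$ are functions $\tilde s$ on $\mathbb{R}^n\times T^n$ with $\tilde s(x+m,\theta)=e^{\sqrt{-1}\langle km,\theta\rangle}\tilde s(x,\theta)$. Complex structure: $J_\Omega$ is the complex structure on $X$ induced from that on $\mathbb{R}^n\times T^n$ with $T^{0,1}=\mathrm{Span}_{\mathbb{C}}\{\partial_{x_i}+\sum_j\Omega_{ij}\partial_{\theta_j}\}_{i=1}^n$; $H^0(X_{J_\Omega};L^k)\subset L^2(X;L^k)$ (with respect to $dx\,d\theta$) is the space of sections of $L^k$ annihilated by $\nabla_v$, $v\in T^{0,1}$. It has orthonormal basis $\{\Theta^k_{\Omega,b}\}_{b\in B_k}$ with lifts $\widetilde\Theta^k_{\Omega,b}=\sum_{l\in\mathbb{Z}^n,[l/k]=b}\Psi^k_{\Omega,l/k}$,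 where $\Psi^k_{\Omega,l/k}(x,\theta)=(2\pi)^{-n/2}a_{k,Q}\exp\left(\frac{\sqrt{-1}k}{2}\,{}^t(x-\frac lk)\Omega(x-\frac lk)\right)e^{\sqrt{-1}\langle l,\theta\rangle}$, $a_{k,Q}>0$, $(a_{k,Q})^{-2}=\int_{\mathbb{R}^n}\exp(-k\,{}^txQx)dx$. Berezin–Toeplitz: $T^k(f)=\Pi_kM_f\Pi_k^*\in\mathbb{B}(H^0(X_{J_\Omega};L^k))$, where $\Pi_k$ is the orthogonal projection of $L^2(X;L^k)$ onto $H^0(X_{J_\Omega};L^k)$ and $M_f$ is multiplication by $f$. Real polarization: $B_k=(\frac1k\mathbb{Z}/\mathbb{Z})^n$ and $\mathcal{H}_k=\bigoplus_{b\in B_k}H^0(X_b;L^k\otimes|\Lambda|^{1/2}X_b)$ (parallel sections over the fibers; $|\Lambda|^{1/2}X_b$ is the half-density bundle with its canonical flat connection). The sections $\psi^k_{\bar b}=e^{\sqrt{-1}k\langle\bar b,\theta\rangle}\sqrt{d'\theta}$ over $\{\bar b\}\times T^n$, $\bar b\in\frac1k\mathbb{Z}^n$, $d'\theta=(2\pi)^{-n}d\theta$, are permuted by the $\mathbb{Z}^n$-action ($m$ sends $\psi^k_{\bar b}$ to $\psi^k_{\bar b+m}$) and hence induce an orthonormal basis $\{\vartheta_b^k\}_{b\in B_k}$ of $\mathcal{H}_k$. Conditions (U). $\mathcal{U}$ is an open covering of $B$ such that: (U1) $\mathcal{U}$ is locally finite and each $U\in\mathcal{U}$ admits an open affine embedding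 into $\mathbb{R}^n$ with convex image; (U2) for any $U,V\in\mathcal{U}$, $U\cap V$ also admits an open affine embedding into $\mathbb{R}^n$ with convex image; (U3) for each $U\in\mathcal{U}$, $\overline{U}$ is compact in $B$. The maps $\phi^k_{H_P,\mathcal{U}}$: $H_P=\mathrm{Span}\{\partial_{x_i}+\sum_jP_{ij}\partial_{\theta_j}\}_{1\le i\le n}\subset TX$. A path $\gamma$ in $B$ from $b$ to $c$ gives, via $H_P$-horizontal lifts, a parallel transport $X_b\to X_c$, and via $\nabla$ along these lifts and the flat connection on vertical half-densities a covering parallel transport of $L^k\otimes|\Lambda|^{1/2}$; this yields an $L^2$-pairing $\langle\cdot,\cdot\rangle_\gamma$ (conjugate-linear in the first variable) between sections over $X_b$ and over $X_c$. Points $b,c\in B$ are close if some $U\in\mathcal{U}$ contains both; then $\langle\cdot,\cdot\rangle_{\mathcal{U}}:=\langle\cdot,\cdot\rangle_\gamma$ with $\gamma$ the affine segment from $b$ to $c$ in $U$, and $(b+c)/2$ is its midpoint. Then $\phi^k_{H_P,\mathcal{U}}(f)(\vartheta_c^k)=\sum_{b\in B_k,\ b\text{ close to }c}\langle\vartheta_b^k,f|_{X_{(b+c)/2}}\vartheta_c^k\rangle_{\mathcal{U}}\,\vartheta_b^k$, where $f|_{X_{(b+c)/2}}$ is regarded as a function on $X_c$ via the parallel transport along the segment between $(b+c)/2$ and $c$. $\|\cdot\|$ is the operator norm. *)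

(* Defs.v *)
From HB Require Import structures.
From mathcomp Require Import all_boot all_order all_algebra.
From mathcomp Require Import generic_quotient complex.
From mathcomp Require Import all_classical all_reals all_analysis.
From mathcomp.analysis.showcase Require Import summability.

Set Implicit Arguments.
Unset Strict Implicit.
Unset Printing Implicit Defensive.

Import Order.TTheory GRing.Theory Num.Theory.
Import numFieldNormedType.Exports.

Local Open Scope classical_set_scope.
Local Open Scope ring_scope.
Local Open Scope complex_scope.
Local Open Scope quotient_scope.

Section TupleMeasure.
Context d (T : measurableType d) (R : realType).
Variable mu : {sigma_finite_measure set T -> \bar R}.

Definition tcons n (u : T * n.-tuple T) : n.+1.-tuple T := [tuple of u.1 :: u.2].

Definition tuncons n (u : n.+1.-tuple T) : T * n.-tuple T :=
  (tnth u ord0, [tuple of behead u]).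

Lemma tconsK n : cancel (@tcons n) (@tuncons n).
Proof. by move=> [t u]; rewrite /tuncons /tcons/=; congr pair; exact: val_inj. Qed.

Lemma measurable_tcons n : measurable_fun setT (@tcons n).
Proof. by apply: measurable_cons. Qed.

Lemma measurable_tuncons n : measurable_fun setT (@tuncons n).
Proof.
apply/measurable_fun_pairP; split; first exact: measurable_tnth.
exact: measurable_behead.
Qed.

Section step.
Context (n : nat) (nu : {sigma_finite_measure set (n.-tuple T) -> \bar R}).

Definition tuple_measureS : set (n.+1.-tuple T) -> \bar R :=
  pushforward (product_measure1 mu nu) (@tcons n).

HB.instance Definition _ := Measure.copy tuple_measureS
  (measure_function_pushforward__canonical__measure_function_Measure
     (product_measure1 mu nu) (@measurable_tcons n)).

Lemma tuple_measureS_sigma_finite : sigma_finite setT tuple_measureS.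
Proof.
have /sigma_finiteP[F [TF ndF Foo]] := sigma_finiteT mu.
have /sigma_finiteP[G [TG ndG Goo]] := sigma_finiteT nu.
exists (fun i => @tuncons n @^-1` (F i `*` G i)).
  rewrite -preimage_bigcup [X in _ @^-1` X](_ : _ = setT) ?preimage_setT//.
  apply/seteqP; split=> // -[x y] _.
  have [i _ Fix] : (\bigcup_i F i) x by rewrite -TF.
  have [j _ Gjy] : (\bigcup_i G i) y by rewrite -TG.
  exists (maxn i j) => //; split.
  - by move: x Fix; exact/subsetPset/ndF/leq_maxl.
  - by move: y Gjy; exact/subsetPset/ndG/leq_maxr.
move=> i; have [mFi Fioo] := Foo i; have [mGi Gioo] := Goo i; split.
  rewrite -[X in measurable X]setTI.
  by apply: measurable_tuncons => //; exact: measurableX.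
rewrite /tuple_measureS /pushforward -comp_preimage.
rewrite (_ : _ \o _ = id); last by apply/funext => u; exact: tconsK.
by rewrite preimage_id product_measure1E// lte_mul_pinfty// ge0_fin_numE.
Qed.

HB.instance Definition _ := @Measure_isSigmaFinite.Build _ _ _ tuple_measureS
  tuple_measureS_sigma_finite.

End step.

Fixpoint tuple_measure n : {sigma_finite_measure set (n.-tuple T) -> \bar R} :=
  match n with
  | 0 => dirac [tuple]
  | m.+1 => tuple_measureS (tuple_measure m)
  end.

End TupleMeasure.

Definition lebesgue_tuple (R : realType) n :
    {sigma_finite_measure set (n.-tuple (measurableTypeR R)) -> \bar R} :=
  tuple_measure (@lebesgue_measure R) n.

(* Points of R^n are row vectors, and everything living over
   X = (R/Z)^n x T^n is described by its lift to R^n x R^n: functions and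
   sections are maps of a pair (x, theta), 2 pi-periodic in each theta_j and
   periodic (functions) or quasi-periodic (sections) in x. *)

Section TorusQuantization.
Context (R : realType) (n : nat).
Local Notation V := 'rV[R]_n.
Local Notation E := (V * V)%type.
Local Notation lattice := 'rV[int]_n.
Local Notation Re := complex.Re.
Local Notation Im := complex.Im.

Definition dot (x y : V) : R := \sum_(i < n) x ord0 i * y ord0 i.

Definition of_lattice (m : lattice) : V := map_mx (fun z : int => z%:~R) m.

Definition cexp (z : R[i]) : R[i] :=
  (expR (Re z))%:C * (cos (Im z) +i* sin (Im z)).

Definition cderive (W : normedModType R) (s : W -> R[i]) (p v : W) : R[i] :=
  'D_v (fun q => Re (s q)) p +i* 'D_v (fun q => Im (s q)) p.

Fixpoint Cm (W : normedModType R) (m : nat) (g : W -> R) : Prop :=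
  continuous g /\
  match m with
  | 0 => True
  | m'.+1 => forall v, (forall p, derivable g p v) /\ Cm m' (fun p => 'D_v g p)
  end.

Definition smooth (W : normedModType R) (s : W -> R[i]) : Prop :=
  forall m, Cm m (fun p => Re (s p)) /\ Cm m (fun p => Im (s p)).

Definition cintegral d (T : measurableType d) (mu : {measure set T -> \bar R})
    (D : set T) (s : T -> R[i]) : R[i] :=
  (Rintegral mu D (fun p => Re (s p))) +i* (Rintegral mu D (fun p => Im (s p))).

Definition vec_of_tuple (u : n.-tuple (measurableTypeR R)) : V :=
  \row_i tnth u i.

Definition cube (a : R) : set (n.-tuple (measurableTypeR R)) :=
  [set u | forall i, 0 <= (tnth u i : R) <= a].

(* with respect to d'theta = (2 pi)^-n dtheta *)
Definition integral_T (g : V -> R[i]) : R[i] :=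
  ((2 * pi) ^- n : R)%:C *
  cintegral (lebesgue_tuple R n) (cube (2 * pi)) (fun u => g (vec_of_tuple u)).

(* with respect to dx dtheta, over the fundamental domain [0,1]^n x [0,2pi]^n *)
Definition integral_X (g : E -> R[i]) : R[i] :=
  cintegral (product_measure1 (lebesgue_tuple R n) (lebesgue_tuple R n))
    (cube 1 `*` cube (2 * pi))
    (fun u => g (vec_of_tuple u.1, vec_of_tuple u.2)).

(* X being compact, every smooth function on X is compactly supported *)
Definition Cc_infty_X (f : E -> R[i]) : Prop :=
  [/\ smooth f,
      forall (m : lattice) x theta, f (x + of_lattice m, theta) = f (x, theta)
    & forall (m : lattice) x theta,
        f (x, theta + (2 * pi) *: of_lattice m) = f (x, theta)].

Definition is_section (k : nat) (s : E -> R[i]) : Prop :=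
  (forall (m : lattice) x theta,
     s (x + of_lattice m, theta) =
     cexp ('i * (k%:R * dot (of_lattice m) theta)%:C) * s (x, theta)) /\
  (forall (m : lattice) x theta,
     s (x, theta + (2 * pi) *: of_lattice m) = s (x, theta)).

(* d - i k sum_j x_j dtheta_j is the connection of L^k *)
Definition nabla (k : nat) (v : E) (s : E -> R[i]) (p : E) : R[i] :=
  cderive s p v - 'i * (k%:R * dot p.1 v.2)%:C * s p.

Definition d_x (i : 'I_n) : E := (delta_mx ord0 i, 0).
Definition d_theta (j : 'I_n) : E := (0, delta_mx ord0 j).

Definition Omega (P Q : 'M[R]_n) : 'M[R[i]]_n :=
  \matrix_(i, j) (P i j +i* Q i j).

Definition ip_X (s t : E -> R[i]) : R[i] :=
  integral_X (fun p => (s p)^* * t p).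

Definition norm_X (s : E -> R[i]) : R := Num.sqrt (Re (ip_X s s)).

(* nabla extended complex-linearly to T^{0,1} *)
Definition H0 (k : nat) (Om : 'M[R[i]]_n) : set (E -> R[i]) :=
  [set s | [/\ smooth s, is_section k s &
    forall i p, nabla k (d_x i) s p +
      \sum_(j < n) Om i j * nabla k (d_theta j) s p = 0]].

Definition proj_H0 (k : nat) (Om : 'M[R[i]]_n) (s : E -> R[i]) : E -> R[i] :=
  xget (fun=> 0) [set t | H0 k Om t /\
    forall u, H0 k Om u -> ip_X u (fun p => s p - t p) = 0].

Definition toeplitz (k : nat) (Om : 'M[R[i]]_n) (f s : E -> R[i]) :
    E -> R[i] :=
  proj_H0 k Om (fun p => f p * s p).

Definition lattice_eqv : rel V :=
  fun x y => [forall i, (x ord0 i - y ord0 i) \is a Num.int].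

Lemma lattice_eqv_refl : reflexive lattice_eqv.
Proof. by move=> x; apply/forallP => i; rewrite subrr rpred0. Qed.

Lemma lattice_eqv_sym : symmetric lattice_eqv.
Proof.
by move=> x y; apply: eq_forallb => i; rewrite -rpredN opprB.
Qed.

Lemma lattice_eqv_trans : transitive lattice_eqv.
Proof.
move=> y x z /forallP xy /forallP yz; apply/forallP => i.
by rewrite -(subrKA (y ord0 i)) rpredD.
Qed.

Canonical lattice_equiv :=
  EquivRel lattice_eqv lattice_eqv_refl lattice_eqv_sym lattice_eqv_trans.

Definition base : Type := quotient_topology {eq_quot lattice_equiv}.
HB.instance Definition _ := Topological.on base.

Definition pr (x : V) : base :=
  \pi_(quotient_topology {eq_quot lattice_equiv}) x.

(* maps between affine manifolds are affine when they are locally so in the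
   charts, which for the base are the local inverses of pr *)
Definition affine_on (U : set base) (phi : base -> V) : Prop :=
  forall x, U (pr x) -> exists (A : 'M[R]_n) (v : V),
    \forall y \near x, phi (pr y) = y *m A + v.

Definition affine_convex_embedding (U : set base) (phi : base -> V) : Prop :=
  [/\ {in U &, injective phi},
      {within U, continuous phi},
      forall W, open W -> W `<=` U -> open (phi @` W),
      affine_on U phi
    & convex_set (phi @` U)].

Definition affinely_convex (U : set base) : Prop :=
  exists phi, affine_convex_embedding U phi.

Definition open_covering (C : set (set base)) : Prop :=
  (forall U, C U -> open U) /\ (forall b, exists2 U, C U & U b).

Definition locally_finite (C : set (set base)) : Prop :=
  forall b : base, exists2 N, nbhs b N & finite_set [set U | C U /\ U `&` N !=set0].

Definition condU1 (C : set (set base)) : Prop :=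
  locally_finite C /\ (forall U, C U -> affinely_convex U).

Definition condU2 (C : set (set base)) : Prop :=
  forall U W, C U -> C W -> affinely_convex (U `&` W).

Definition condU3 (C : set (set base)) : Prop :=
  forall U, C U -> compact (closure U).

Definition segment (x y : V) (t : R) : V := (1 - t) *: x + t *: y.

Definition segment_inside (U : set base) (x y : V) : Prop :=
  forall t, 0 <= t <= 1 -> U (pr (segment x y t)).

Definition close_in (C : set (set base)) (b c : base) : Prop :=
  exists2 U, C U & U b /\ U c.

(* a lift to R^n of the affine segment from b to c in a member of C; it is
   unique up to translation by Z^n when (U1) and (U2) hold *)
Definition close_lift (C : set (set base)) (b c : base) : E :=
  xget (0, 0) [set e | [/\ pr e.1 = b, pr e.2 = c &
    exists2 U, C U & segment_inside U e.1 e.2]].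

(* (p, q) is a lift to R^n x R^n of a curve in X over [0,1] tangent to the
   distribution spanned by the d/dx_i + sum_j P_ij d/dtheta_j *)
Definition horizontal (P : 'M[R]_n) (p q : R -> V) : Prop :=
  {within `[0, 1], continuous q} /\
  forall t, 0 < t < 1 ->
    [/\ derivable p t 1, derivable q t 1 & derive1 q t = derive1 p t *m P].

(* v is a section of L^k along the curve (p, q), parallel for the pull-back
   of the connection *)
Definition parallel (k : nat) (p q : R -> V) (v : R -> R[i]) : Prop :=
  [/\ {within `[0, 1], continuous (fun t => Re (v t))},
      {within `[0, 1], continuous (fun t => Im (v t))}
    & forall t, 0 < t < 1 ->
      [/\ derivable (fun r => Re (v r)) t 1, derivable (fun r => Im (v r)) t 1
        & cderive v t 1 - 'i * (k%:R * dot (p t) (derive1 q t))%:C * v t = 0]].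

(* from functions on the fiber over p 0 to functions on the fiber over p 1 *)
Definition transport_fun (P : 'M[R]_n) (p : R -> V) (g : V -> R[i]) (theta : V) :
    R[i] :=
  xget 0 [set z | exists q, [/\ horizontal P p q, q 1 = theta & z = g (q 0)]].

(* Sections of L^k times half-densities are written in terms of the half-density
   sqrt(d'theta), which is preserved by the transport. *)
Definition transport_section (k : nat) (P : 'M[R]_n) (p : R -> V)
    (s : V -> R[i]) (theta : V) : R[i] :=
  xget 0 [set z | exists q v, [/\ horizontal P p q, parallel k p q v,
    q 1 = theta, v 0 = s (q 0) & z = v 1]].

(* s lives over the fiber at p 0 and t over the fiber at p 1 *)
Definition pairing (k : nat) (P : 'M[R]_n) (p : R -> V) (s t : V -> R[i]) :
    R[i] :=
  integral_T (fun theta => (transport_section k P p s theta)^* * t theta).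

(* B_k = ((1/k) Z / Z)^n, indexed by the representatives j / k, 0 <= j < k *)
Definition Bk (k : nat) : finType := {ffun 'I_n -> 'I_k}.

Definition bs_lift (k : nat) (b : Bk k) : V := \row_i ((b i)%:R / k%:R).

Definition bs_point (k : nat) (b : Bk k) : base := pr (bs_lift b).

(* A family of sections over the fibers at the points of B_k is a function
   s (x, theta) which vanishes unless [x] is in B_k; it is not required to be
   continuous in x. *)
Definition Hk (k : nat) : set (E -> R[i]) :=
  [set s | [/\ is_section k s,
    forall x theta, (forall b : Bk k, pr x <> bs_point b) -> s (x, theta) = 0
  & forall b : Bk k, forall x, pr x = bs_point b ->
      smooth (fun theta => s (x, theta)) /\
      forall j theta, nabla k (d_theta j) s (x, theta) = 0]].

Definition ip_Hk (k : nat) (s t : E -> R[i]) : R[i] :=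
  \sum_(b : Bk k) integral_T (fun theta =>
    (s (bs_lift b, theta))^* * t (bs_lift b, theta)).

Definition norm_Hk (k : nat) (s : E -> R[i]) : R := Num.sqrt (Re (ip_Hk k s s)).

Definition psi (k : nat) (x theta : V) : R[i] :=
  cexp ('i * (k%:R * dot x theta)%:C).

Definition vartheta (k : nat) (b : Bk k) (p : E) : R[i] :=
  if `[< pr p.1 = bs_point b >] then psi k p.1 p.2 else 0.

(* < vartheta_b , f|_{X_(b+c)/2} vartheta_c >_C along the segment from x to y *)
Definition phi_coef (k : nat) (P : 'M[R]_n) (C : set (set base))
    (f : E -> R[i]) (b c : Bk k) : R[i] :=
  let: (x, y) := close_lift C (bs_point b) (bs_point c) in
  let mid := segment x y (2^-1) in
  pairing k P (segment x y)
    (fun theta => vartheta b (x, theta))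
    (fun theta => transport_fun P (segment mid y) (fun eta => f (mid, eta)) theta
                  * vartheta c (y, theta)).

Definition phi_op (k : nat) (P : 'M[R]_n) (C : set (set base))
    (f : E -> R[i]) (s : E -> R[i]) : E -> R[i] := fun p =>
  \sum_(c : Bk k) ip_Hk k (vartheta c) s *
    (\sum_(b : Bk k | `[< close_in C (bs_point b) (bs_point c) >])
       phi_coef P C f b c * vartheta b p).

Definition qform (K : comPzRingType) (A : 'M[K]_n) (x : 'rV[K]_n) : K :=
  \sum_(i < n) \sum_(j < n) x ord0 i * A i j * x ord0 j.

Definition pos_def (Q : 'M[R]_n) : Prop := forall x : V, x != 0 -> 0 < qform Q x.

Definition a_coef (k : nat) (Q : 'M[R]_n) : R :=
  (Num.sqrt (Rintegral (lebesgue_tuple R n) setT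
    (fun u => expR (- (k%:R * qform Q (vec_of_tuple u))))))^-1.

Definition Psi (k : nat) (P Q : 'M[R]_n) (l : lattice) (p : E) : R[i] :=
  ((Num.sqrt (2 * pi)) ^- n * a_coef k Q : R)%:C *
  cexp ('i * k%:R / 2%:R *
    qform (Omega P Q) (map_mx (fun r => r%:C) (p.1 - k%:R^-1 *: of_lattice l))) *
  cexp ('i * (dot (of_lattice l) p.2)%:C).

(* the lattice sum is the limit over the finite subsets of Z^n *)
Definition Theta (k : nat) (P Q : 'M[R]_n) (b : Bk k) (p : E) : R[i] :=
  @summability.sum lattice R[i] R[i]^o (fun l =>
    if `[< pr (k%:R^-1 *: of_lattice l) = bs_point b >] then Psi k P Q l p
    else 0).

Definition identification (k : nat) (P Q : 'M[R]_n) (s : E -> R[i]) :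
    E -> R[i] := fun p =>
  \sum_(b : Bk k) ip_Hk k (vartheta b) s * Theta P Q b p.

(* With U : H_k -> H^0 the unitary identification, phi and T acting on H_k and
   H^0 respectively, ||U phi U^-1 - T|| = ||U phi - T U||. *)
Definition opnorm_diff (k : nat) (P Q : 'M[R]_n) (C : set (set base))
    (f : E -> R[i]) : \bar R :=
  ereal_sup [set (norm_X (fun p =>
      identification k P Q (phi_op k P C f s) p
      - toeplitz k (Omega P Q) f (identification k P Q s) p))%:E
    | s in [set s | Hk k s /\ norm_Hk k s <= 1]].

End TorusQuantization.

(* Main.v *)
(** Both operators are given by matrices indexed by pairs of points b, c of B_k.
    Expand f as the sum over p in Z^n of f_p(x) exp(i<p, theta>), where
    |f_p| <= C w(p) with w summable.

    Along a segment, the horizontal transport is a translation of the fiber and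
    the holonomy is the exponential of a quadratic form; the phases cancel, and
    the (b, c) entry of phi is f_p(mid), where p / k is the displacement from c
    to b along the segment and mid its midpoint.

    Restricted to the fiber over x, a holomorphic section has Fourier
    coefficients which satisfy a first order linear equation in x, so that they
    are multiples of Gaussians; hence the theta functions span H^0.  Unfolding
    the lattice sums shows that they are orthonormal and that the p-th Fourier
    mode contributes to the (b, c) entry of T, when b - c = p / k modulo Z^n,
    the mean of f_p, times a phase tending to 1, for a Gaussian density of width
    k^(-1/2) centered at the same midpoint.

    For each p the difference of the two entries tends to 0 uniformly in b, c;
    it is O(w(p)) for all p, and each p meets every row and every column exactly
    once, so that Schur's test concludes.

    For p fixed and k large the displacement p / k is realized by a segment in a
    member of the covering (Lebesgue number), and any other lift of the pair
    (b, c), in U' say, has the same displacement: both segments run along the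
    straight line between b and c in an affine chart of the intersection of the
    two members, by (U2). *)

Require Import Defs.
From HB Require Import structures.
From mathcomp Require Import all_boot all_order all_algebra.
From mathcomp Require Import finmap generic_quotient complex ring lra zify.
From mathcomp Require Import all_classical all_reals all_analysis measurable_realfun.
From mathcomp.analysis.showcase Require Import summability.

Set Implicit Arguments.
Unset Strict Implicit.
Unset Printing Implicit Defensive.

Import Order.TTheory GRing.Theory Num.Theory.
Import numFieldNormedType.Exports.

Local Open Scope classical_set_scope.
Local Open Scope ring_scope.
Local Open Scope complex_scope.

(** * Complex modulus and exponential *)

(** A pair (b, c) determines the displacement p only modulo k: its Toeplitz entry is a sum over a
    whole residue class, while [phi] keeps at most one p, which (U1) and (U2) make canonical once p
    / k is short. Hence the cut into finitely many modes, compared for k large, and a tail estimated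
    uniformly in k by the decay of the Fourier coefficients. A summable weight is wanted, not a
    bound on single entries, because rows and columns have k^n entries. The midpoint arises twice
    for different reasons. On the real side, recentring the fiber average at the midpoint leaves the
    characters of l and m evaluated at half the transport, and the holonomy is their exact inverse.
    On the holomorphic side, the product of two Gaussians centred at l / k and (l + p) / k is a
    Gaussian centred halfway; of P only the cross term survives, an oscillation trivial at the
    centre. Sums, averages and derivatives are interchanged by two devices: the M-test, and
    remainders bounded by a multiple of h^2, a form of differentiability that survives summation. *)

Notation cmod := (@Normc.normc _).

Section Modulus.
Context {R : realType}.
Implicit Types z w : R[i].
Local Notation Re := complex.Re.
Local Notation Im := complex.Im.

Lemma cmodM z w : cmod (z * w) = cmod z * cmod w.
Proof. exact: Normc.normcM. Qed.

Lemma ler_cmodD z w : cmod (z + w) <= cmod z + cmod w.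
Proof. exact: le_normcD. Qed.

Lemma cmodN z : cmod (- z) = cmod z.
Proof. exact: normcN. Qed.

Lemma cmodJ z : cmod z^* = cmod z.
Proof. by case: z => a b /=; rewrite sqrrN. Qed.

Lemma cmod0 : cmod (0 : R[i]) = 0.
Proof. exact: Normc.normc0. Qed.

Lemma cmod0_eq0 z : cmod z = 0 -> z = 0.
Proof. exact: Normc.eq0_normc. Qed.

Lemma cmod_ge0 z : 0 <= cmod z.
Proof. by case: z => a b; exact: sqrtr_ge0. Qed.

Lemma cmodBC z w : cmod (z - w) = cmod (w - z).
Proof. by rewrite -cmodN opprB. Qed.

Lemma ler_cmodB z w : cmod (z - w) <= cmod z + cmod w.
Proof. by rewrite -(cmodN w) ler_cmodD. Qed.

Lemma cmod_real (x : R) : cmod x%:C = `|x|.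
Proof. by rewrite /= expr0n addr0 sqrtr_sqr. Qed.

Lemma cmodi : cmod ('i : R[i]) = 1.
Proof. by rewrite /= expr0n add0r expr1n sqrtr1. Qed.

Lemma sqr_cmod z : cmod z ^+ 2 = Re z ^+ 2 + Im z ^+ 2.
Proof. by case: z => a b /=; rewrite sqr_sqrtr// addr_ge0// sqr_ge0. Qed.

Lemma mulJc z : z^* * z = (cmod z ^+ 2)%:C.
Proof. by case: z => a b; rewrite sqr_cmod /=; simpc; congr (_ +i* _); ring. Qed.

Lemma ler_Re_cmod z : `|Re z| <= cmod z.
Proof.
by case: z => a b /=; rewrite -sqrtr_sqr ler_wsqrtr// lerDl sqr_ge0.
Qed.

Lemma ler_Im_cmod z : `|Im z| <= cmod z.
Proof.
by case: z => a b /=; rewrite -sqrtr_sqr ler_wsqrtr// lerDr sqr_ge0.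
Qed.

Lemma ler_cmod_ReIm z : cmod z <= `|Re z| + `|Im z|.
Proof.
have -> : z = (Re z)%:C + 'i * (Im z)%:C by rewrite -complexE.
apply: (le_trans (ler_cmodD _ _)); rewrite cmodM cmodi mul1r !cmod_real.
by rewrite -complexE.
Qed.

Lemma ler_cmod_sum (I : Type) (s : seq I) (P : pred I) (F : I -> R[i]) :
  cmod (\sum_(i <- s | P i) F i) <= \sum_(i <- s | P i) cmod (F i).
Proof.
elim/big_rec2: _ => [|i x y _ le]; first by rewrite cmod0.
by apply: (le_trans (ler_cmodD _ _)); rewrite lerD2l.
Qed.

Lemma cmod_eps_eq z w : (forall e, 0 < e -> cmod (z - w) <= e) -> z = w.
Proof.
move=> h; apply/eqP; rewrite -subr_eq0; apply/eqP/cmod0_eq0/eqP.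
rewrite eq_le cmod_ge0 andbT; apply/ler_addgt0Pl => e e0.
by rewrite addr0; exact: h.
Qed.

Lemma Re_sum (I : Type) (s : seq I) (P : pred I) (F : I -> R[i]) :
  Re (\sum_(i <- s | P i) F i) = \sum_(i <- s | P i) Re (F i).
Proof. by elim/big_rec2: _ => // i x [a b] _ <-; case: (F i). Qed.

Lemma Im_sum (I : Type) (s : seq I) (P : pred I) (F : I -> R[i]) :
  Im (\sum_(i <- s | P i) F i) = \sum_(i <- s | P i) Im (F i).
Proof. by elim/big_rec2: _ => // i x [a b] _ <-; case: (F i). Qed.

Lemma rcD (x y : R) : (x + y)%:C = x%:C + y%:C. Proof. exact: rmorphD. Qed.
Lemma rcN (x : R) : (- x)%:C = - x%:C. Proof. exact: rmorphN. Qed.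
Lemma rcB (x y : R) : (x - y)%:C = x%:C - y%:C. Proof. exact: rmorphB. Qed.
Lemma rcM (x y : R) : (x * y)%:C = x%:C * y%:C. Proof. exact: rmorphM. Qed.
Lemma rcX (x : R) m : (x ^+ m)%:C = x%:C ^+ m. Proof. exact: rmorphXn. Qed.
Lemma rcV (x : R) : (x^-1)%:C = (x%:C)^-1. Proof. exact: fmorphV. Qed.

Lemma rc_sum (I : Type) (s : seq I) (P : pred I) (F : I -> R) :
  (\sum_(i <- s | P i) F i)%:C = \sum_(i <- s | P i) (F i)%:C.
Proof. exact: rmorph_sum. Qed.

Lemma ReD z w : Re (z + w) = Re z + Re w. Proof. by case: z w => [? ?] []. Qed.
Lemma ImD z w : Im (z + w) = Im z + Im w. Proof. by case: z w => [? ?] []. Qed.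
Lemma ReN z : Re (- z) = - Re z. Proof. by case: z. Qed.
Lemma ImN z : Im (- z) = - Im z. Proof. by case: z. Qed.
Lemma ReM z w : Re (z * w) = Re z * Re w - Im z * Im w.
Proof. by case: z w => [? ?] []. Qed.
Lemma ImM z w : Im (z * w) = Re z * Im w + Im z * Re w.
Proof. by case: z w => [a b] [c d]; rewrite /= addrC mulrC [a * _]mulrC addrC mulrC. Qed.

Lemma cexpD z w : cexp (z + w) = cexp z * cexp w.
Proof.
case: z w => [a b] [c d]; rewrite /cexp /= expRD cosD sinD.
by simpc; congr (_ +i* _); ring.
Qed.

Lemma cexp0 : cexp (0 : R[i]) = 1.
Proof. by rewrite /cexp /= expR0 cos0 sin0 mul1r. Qed.

Lemma cmod_cexp z : cmod (cexp z) = expR (Re z).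
Proof.
rewrite /cexp cmodM cmod_real /= cos2Dsin2 sqrtr1 mulr1.
by rewrite ger0_norm ?expR_ge0.
Qed.

Lemma cmod_cexpi (x : R) : cmod (cexp ('i * x%:C)) = 1.
Proof. by rewrite cmod_cexp ReM /= mul0r mulr0 subr0 expR0. Qed.

Lemma cexpJ z : (cexp z)^* = cexp z^*.
Proof. by case: z => a b; rewrite /cexp /= cosN sinN; simpc. Qed.

Lemma cexp_neq0 z : cexp z != 0.
Proof.
apply/eqP => /(congr1 (@Normc.normc _)); rewrite cmod_cexp cmod0.
by apply/eqP; rewrite gt_eqF ?expR_gt0.
Qed.

Lemma cexpN z : cexp (- z) = (cexp z)^-1.
Proof.
apply: (mulfI (cexp_neq0 z)).
by rewrite -cexpD subrr cexp0 mulfV// cexp_neq0.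
Qed.

Lemma cexp_real (x : R) : cexp x%:C = (expR x)%:C.
Proof. by rewrite /cexp /= cos0 sin0 mulr1. Qed.

Lemma cexpiE (x : R) : cexp ('i * x%:C) = cos x +i* sin x.
Proof.
by rewrite /cexp ReM ImM /= ?mul0r ?mulr0 ?subr0 ?addr0 ?add0r ?expR0 ?mul1r.
Qed.

Lemma cexpiZ_int (z : int) : cexp ('i * (z%:~R * (2 * pi))%:C) = 1 :> R[i].
Proof.
have nat_case (m : nat) : cexp ('i * (m%:R * (2 * pi))%:C) = 1 :> R[i].
  elim: m => [|m IH]; first by rewrite mul0r mulr0 cexp0.
  rewrite -addn1 natrD mulrDl mul1r rcD mulrDr cexpD IH mul1r.
  by rewrite cexpiE mulr_natl cos2pi sin2pi.
case: z => m; first exact: nat_case.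
rewrite NegzE mulrNz mulNr rcN mulrN cexpN.
by rewrite -[m.+1%:~R]/(m.+1%:R) nat_case invr1.
Qed.

End Modulus.

(** * Mean value and Taylor estimates *)

Section SecondOrder.
Context {R : realType}.

Lemma ler_norm_MVT (g g' : R -> R) (M h : R) :
  (forall t : R, is_derive t 1 g (g' t)) ->
  (forall t : R, `|t| <= `|h| -> `|g' t| <= M) -> `|g h - g 0| <= M * `|h|.
Proof.
move=> dg g'M.
have cg a b : {within `[a, b], continuous g}.
  apply: continuous_subspaceT => x; apply: differentiable_continuous.
  by apply/derivable1_diffP; have [] := dg x.
have [h0|h0] := leP 0 h.
  have [c cI ->] := MVT_segment h0 (fun x _ => dg x) (cg 0 h).
  rewrite subr0 normrM ler_wpM2r// g'M//.
  by move: cI; rewrite in_itv/= => /andP[c0 ch]; rewrite !ger0_norm.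
have [c cI e] := MVT_segment (ltW h0) (fun x _ => dg x) (cg h 0).
rewrite distrC e sub0r normrM normrN ler_wpM2r// g'M//.
move: cI; rewrite in_itv/= => /andP[c0 ch].
by rewrite !ler0_norm ?(ltW h0)// lerN2.
Qed.

(** The mean value inequality is applied twice, to [g'] and to [g t - t * g' 0], at the cost of the
    factor 1/2 of Taylor's formula. *)
Lemma ler_norm_taylor2 (g g' g'' : R -> R) (M h : R) :
  (forall t : R, is_derive t 1 g (g' t)) -> (forall t : R, is_derive t 1 g' (g'' t)) ->
  (forall t : R, `|t| <= `|h| -> `|g'' t| <= M) ->
  `|g h - g 0 - h * g' 0| <= M * `|h| ^+ 2.
Proof.
move=> dg dg' g''M.
have d1 (t : R) : is_derive t 1 (fun t => g t - t * g' 0) (g' t - g' 0).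
  have := dg t => dgt.
  by apply: is_derive_eq; rewrite scaler0 add0r [_ *: _]mulr1.
have := @ler_norm_MVT _ _ (M * `|h|) h d1; rewrite mul0r subr0.
rewrite expr2 mulrA [_ - _ - g 0]addrAC; apply => t th.
apply: (le_trans (ler_norm_MVT dg' (fun s ss => g''M s (le_trans ss th)))).
by apply: ler_wpM2l => //; apply: le_trans (g''M 0 _); rewrite ?normr0.
Qed.

End SecondOrder.

Section ExpBounds.
Context {R : realType}.
Implicit Types w : R[i].
Local Notation Re := complex.Re.
Local Notation Im := complex.Im.

Lemma is_derive_expR_cos (a b t : R) :
  is_derive t 1 (fun s => expR (s * a) * cos (s * b))
    (expR (t * a) * (a * cos (t * b) - b * sin (t * b))).
Proof.
apply: is_derive_eq; rewrite /GRing.scale/= ?mulr0 ?addr0 ?add0r ?mulr1; ring.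
Qed.

Lemma is_derive_expR_sin (a b t : R) :
  is_derive t 1 (fun s => expR (s * a) * sin (s * b))
    (expR (t * a) * (a * sin (t * b) + b * cos (t * b))).
Proof.
apply: is_derive_eq; rewrite /GRing.scale/= ?mulr0 ?addr0 ?add0r ?mulr1; ring.
Qed.

Lemma cexp_line (t : R) w : cexp (t%:C * w) =
  (expR (t * Re w) * cos (t * Im w)) +i* (expR (t * Re w) * sin (t * Im w)).
Proof. by case: w => a b; rewrite /cexp; simpc. Qed.

Lemma is_derive_cexp_line w (t : R) :
  is_derive t 1 (fun s => Re (cexp (s%:C * w))) (Re (w * cexp (t%:C * w))) /\
  is_derive t 1 (fun s => Im (cexp (s%:C * w))) (Im (w * cexp (t%:C * w))).
Proof.
have eR : (fun s => Re (cexp (s%:C * w))) =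
    fun s => expR (s * Re w) * cos (s * Im w).
  by apply/funext => s; rewrite cexp_line.
have eI : (fun s => Im (cexp (s%:C * w))) =
    fun s => expR (s * Re w) * sin (s * Im w).
  by apply/funext => s; rewrite cexp_line.
rewrite eR eI cexp_line; split.
  apply: (is_derive_eq (is_derive_expR_cos _ _ _)); rewrite ReM /=; ring.
apply: (is_derive_eq (is_derive_expR_sin _ _ _)); rewrite ImM /=; ring.
Qed.

Lemma cexp_line_bound w (t : R) : `|t| <= 1 -> cmod (cexp (t%:C * w)) <= expR (cmod w).
Proof.
move=> t1; rewrite cmod_cexp ler_expR ReM /= mul0r subr0.
apply: le_trans (ler_norm _) _; rewrite normrM.
by apply: le_trans (ler_Re_cmod w); rewrite ler_piMl.
Qed.

Lemma is_deriveZ_cexp_line c w (t : R) :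
  is_derive t 1 (fun s => Re (c * cexp (s%:C * w)))
    (Re (c * (w * cexp (t%:C * w)))) /\
  is_derive t 1 (fun s => Im (c * cexp (s%:C * w)))
    (Im (c * (w * cexp (t%:C * w)))).
Proof.
have [dR dI] := is_derive_cexp_line w t.
have eR : (fun s => Re (c * cexp (s%:C * w))) =
    fun s => Re c * Re (cexp (s%:C * w)) - Im c * Im (cexp (s%:C * w)).
  by apply/funext => s; rewrite ReM.
have eI : (fun s => Im (c * cexp (s%:C * w))) =
    fun s => Re c * Im (cexp (s%:C * w)) + Im c * Re (cexp (s%:C * w)).
  by apply/funext => s; rewrite ImM.
rewrite eR eI; split; apply: is_derive_eq; rewrite [in RHS](ReM, ImM) /GRing.scale/=; ring.
Qed.

(** The mean value inequality along the segment from 0 to w has no complex form; it is applied to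
    the real and the imaginary parts, whence the factor 2. *)
Lemma cexp_order1 w : cmod (cexp w - 1) <= 2 * cmod w * expR (cmod w).
Proof.
have b t : `|t| <= `|1 : R| -> cmod (w * cexp (t%:C * w)) <= cmod w * expR (cmod w).
  by rewrite normr1 => t1; rewrite cmodM ler_wpM2l ?cmod_ge0// cexp_line_bound.
have hR := ler_norm_MVT (fun t => (is_derive_cexp_line w t).1)
  (fun t th => le_trans (ler_Re_cmod _) (b t th)).
have hI := ler_norm_MVT (fun t => (is_derive_cexp_line w t).2)
  (fun t th => le_trans (ler_Im_cmod _) (b t th)).
apply: (le_trans (ler_cmod_ReIm _)).
move: hR hI; rewrite !mul1r mul0r cexp0 normr1 mulr1 ReD ImD ReN ImN /=.
by move=> hR hI; rewrite -mulrA mulr_natl mulr2n lerD.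
Qed.

Lemma cexp_order2 w :
  cmod (cexp w - 1 - w) <= 2 * cmod w ^+ 2 * expR (cmod w).
Proof.
have b t : `|t| <= `|1 : R| ->
    cmod (w * (w * cexp (t%:C * w))) <= cmod w ^+ 2 * expR (cmod w).
  rewrite normr1 => t1; rewrite 2!cmodM expr2 -mulrA.
  by rewrite !ler_wpM2l ?cmod_ge0// cexp_line_bound.
have hR := ler_norm_taylor2 (fun t => (is_derive_cexp_line w t).1)
  (fun t => (is_deriveZ_cexp_line w w t).1)
  (fun t th => le_trans (ler_Re_cmod _) (b t th)).
have hI := ler_norm_taylor2 (fun t => (is_derive_cexp_line w t).2)
  (fun t => (is_deriveZ_cexp_line w w t).2)
  (fun t th => le_trans (ler_Im_cmod _) (b t th)).
apply: (le_trans (ler_cmod_ReIm _)).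
move: hR hI; rewrite !mul1r mul0r cexp0 normr1 expr1n !mulr1 !ReD !ImD !ReN !ImN /=.
by move=> hR hI; rewrite -mulrA mulr_natl mulr2n lerD.
Qed.

End ExpBounds.

(** * Unordered sums *)

Section HasSum.
Context {R : realType} {I : choiceType}.
Implicit Types (f g : I -> R[i]) (w : I -> R) (A B : {fset I}) (S : R[i]).
Local Notation Re := complex.Re.
Local Notation Im := complex.Im.

(** Unconditional convergence along finite subsets, phrased with the real modulus; [library_sumE]
    links it to the sums in the definition of [Theta]. *)
Definition has_sum f S := forall e : R, 0 < e -> exists A,
  forall B, (A `<=` B)%fset -> cmod (\sum_(i <- B) f i - S) <= e.

Definition csum f : R[i] := xget 0 [set S | has_sum f S].

Definition sum_bounded w (M : R) := forall A, \sum_(i <- A) w i <= M.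

Lemma has_sum_uniq f S S' : has_sum f S -> has_sum f S' -> S = S'.
Proof.
move=> fS fS'; apply: cmod_eps_eq => e e0.
have [A hA] := fS _ (divr_gt0 e0 (ltr0n R 2)).
have [A' hA'] := fS' _ (divr_gt0 e0 (ltr0n R 2)).
have := hA _ (fsubsetUl A A'); have := hA' _ (fsubsetUr A A').
set s := \sum_(i <- _) _ => h1 h2.
rewrite (_ : S - S' = (s - S') - (s - S)); last by ring.
by rewrite (le_trans (ler_cmodB _ _))// (splitr e) lerD.
Qed.

Lemma csumE f S : has_sum f S -> csum f = S.
Proof.
move=> fS; apply: (@has_sum_uniq f) => //.
by rewrite /csum; case: xgetP => [S' _ //|/(_ S)].
Qed.

Lemma has_sumD f g S T : has_sum f S -> has_sum g T ->
  has_sum (fun i => f i + g i) (S + T).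
Proof.
move=> fS gT e e0.
have [A hA] := fS _ (divr_gt0 e0 (ltr0n R 2)).
have [A' hA'] := gT _ (divr_gt0 e0 (ltr0n R 2)).
exists (A `|` A')%fset => B; rewrite fsubUset => /andP[AB A'B].
rewrite big_split/= opprD addrACA (le_trans (ler_cmodD _ _))// (splitr e).
by rewrite lerD ?hA ?hA'.
Qed.

Lemma has_sumZ c f S : has_sum f S -> has_sum (fun i => c * f i) (c * S).
Proof.
move=> fS e e0; have c1 : 0 < cmod c + 1 by rewrite ltr_wpDl ?cmod_ge0.
have [A hA] := fS _ (divr_gt0 e0 c1).
exists A => B AB; rewrite -mulr_sumr -mulrBr cmodM.
apply: le_trans (_ : (cmod c + 1) * (e / (cmod c + 1)) <= _).
  by apply: ler_pM; rewrite ?cmod_ge0 ?lerDl// hA.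
by rewrite mulrC divfK// gt_eqF.
Qed.

Lemma eq_has_sum f g S : f =1 g -> has_sum f S -> has_sum g S.
Proof. by move=> /funext ->. Qed.

Lemma has_sum_fin f A : (forall i, i \notin A -> f i = 0) ->
  has_sum f (\sum_(i <- A) f i).
Proof.
move=> f0 e e0; exists A => B AB.
rewrite (big_fset_incl _ AB) ?subrr ?cmod0 ?ltW// => i _ iA; exact: f0.
Qed.

Lemma ler_sum_fsub w A B : (forall i, 0 <= w i) -> (A `<=` B)%fset ->
  \sum_(i <- A) w i <= \sum_(i <- B) w i.
Proof.
move=> w0 AB; rewrite (big_fsetID _ (mem A) B)/=.
have -> : [fset x | x in B & x \in A]%fset = A.
  apply/fsetP => x; rewrite !inE/= andbC.
  by case: (boolP (x \in A)) => // /(fsubsetP AB) ->.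
by rewrite lerDl sumr_ge0.
Qed.

(** A is chosen with a partial sum within e of the supremum of all partial sums; adding a disjoint B
    cannot pass the supremum. *)
Lemma sum_bounded_tail w M : (forall i, 0 <= w i) -> sum_bounded w M ->
  forall e : R, 0 < e -> exists A, forall B, [disjoint A & B]%fset ->
    \sum_(i <- B) w i <= e.
Proof.
move=> w0 wM e e0.
pose E := [set \sum_(i <- A) w i | A in [set: {fset I}]].
have supE : has_sup E.
  split; first by exists (\sum_(i <- fset0) w i), fset0.
  by exists M => _ [A _ <-].
have [_ [A _ <-] hA] := sup_adherent e0 supE.
exists A => B dAB.
have le : \sum_(i <- (A `|` B)%fset) w i <= sup E.
  by apply: ub_le_sup; [exact: supE.2|exists (A `|` B)%fset].
have eU : \sum_(i <- (A `|` B)%fset) w i =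
    \sum_(i <- A) w i + \sum_(i <- B) w i.
  rewrite (big_fsetID _ (mem A))/=; congr (_ + _); apply: eq_fbigl => x.
    by rewrite !inE/=; case: (boolP (x \in A)); rewrite ?andbF.
  rewrite !inE/=; case: (boolP (x \in A)) => //= [xA|_]; last by rewrite andbT.
  by apply/esym/negbTE; apply: (fdisjointP dAB).
move: le hA; rewrite eU; move: (\sum_(i <- A) _) (\sum_(i <- B) _) => a b; lra.
Qed.

Lemma cmod_sumB f A B e : (A `<=` B)%fset ->
  (forall B', [disjoint A & B']%fset -> \sum_(i <- B') cmod (f i) <= e) ->
  cmod (\sum_(i <- B) f i - \sum_(i <- A) f i) <= e.
Proof.
move=> AB he.
have -> : \sum_(i <- B) f i - \sum_(i <- A) f i =
    \sum_(i <- (B `\` A)%fset) f i.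
  rewrite (big_fsetID _ (mem A) B)/=.
  have -> : [fset x | x in B & x \in A]%fset = A.
    apply/fsetP => x; rewrite !inE/= andbC.
    by case: (boolP (x \in A)) => // /(fsubsetP AB) ->.
  rewrite addrAC subrr add0r; apply: eq_fbigl => x.
  by rewrite !inE/= andbC.
apply: le_trans (ler_cmod_sum _ _ _) (he _ _).
by apply/fdisjointP => x xA; rewrite inE xA.
Qed.

Lemma has_sum_ge0 w M : (forall i, 0 <= w i) -> sum_bounded w M ->
  exists S : R, has_sum (fun i => (w i)%:C) S%:C.
Proof.
move=> w0 wM.
pose E := [set \sum_(i <- A) w i | A in [set: {fset I}]].
have supE : has_sup E.
  split; first by exists (\sum_(i <- fset0) w i), fset0.
  by exists M => _ [A _ <-].
exists (sup E) => e e0; have [_ [A _ <-] hA] := sup_adherent e0 supE.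
exists A => B AB; rewrite -rc_sum -rcB cmod_real.
have le : \sum_(i <- B) w i <= sup E.
  by apply: ub_le_sup; [exact: supE.2|exists B].
rewrite ler0_norm ?subr_le0// opprB lerBlDr -lerBlDl.
by apply: (le_trans (ltW hA)); exact: ler_sum_fsub.
Qed.

(** Monotone convergence is applied to the nonnegative families |w| + w and |w|, whose difference is
    w. *)
Lemma has_sum_real w M : sum_bounded (fun i => `|w i|) M ->
  exists S : R, has_sum (fun i => (w i)%:C) S%:C.
Proof.
move=> wM.
have b (s : I -> R) : (forall i, 0 <= s i <= 2 * `|w i|) ->
    exists S : R, has_sum (fun i => (s i)%:C) S%:C.
  move=> hs; apply: (@has_sum_ge0 _ (2 * M)) => [i|A]; first by have /andP[] := hs i.
  apply: (le_trans (ler_sum _ (fun i _ => proj2 (andP (hs i))))).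
  by rewrite -mulr_sumr ler_wpM2l.
have [|S hS] := b (fun i => `|w i| + w i).
  move=> i; have := ler_norm (w i); have := ler_norm (- w i); rewrite normrN.
  by move=> ? ?; apply/andP; split; lra.
have [|T hT] := b (fun i => `|w i|); first by move=> i; have := normr_ge0 (w i); lra.
exists (S - T); rewrite rcB -mulN1r.
apply: eq_has_sum (has_sumD hS (has_sumZ (-1) hT)) => i.
by rewrite mulN1r -rcN -rcD addrAC subrr add0r.
Qed.

Lemma has_sum_ex f M : sum_bounded (fun i => cmod (f i)) M ->
  exists S, has_sum f S.
Proof.
move=> fM.
have [|S hS] := @has_sum_real (fun i => Re (f i)) M.
  by move=> A; apply: le_trans (fM A); apply: ler_sum => i _; exact: ler_Re_cmod.
have [|T hT] := @has_sum_real (fun i => Im (f i)) M.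
  by move=> A; apply: le_trans (fM A); apply: ler_sum => i _; exact: ler_Im_cmod.
exists (S%:C + 'i * T%:C); apply: eq_has_sum (has_sumD hS (has_sumZ 'i hT)) => i.
by rewrite -complexE.
Qed.

Lemma csumP f M : sum_bounded (fun i => cmod (f i)) M -> has_sum f (csum f).
Proof. by move=> /has_sum_ex[S fS]; rewrite (csumE fS). Qed.

Lemma has_sum_cmod_le f S (M : R) :
  has_sum f S -> (forall A, cmod (\sum_(i <- A) f i) <= M) -> cmod S <= M.
Proof.
move=> fS fM; apply/ler_addgt0Pr => e e0; have [A hA] := fS e e0.
rewrite -(subrK (\sum_(i <- A) f i) S) (le_trans (ler_cmodD _ _))// addrC lerD//.
by rewrite cmodBC hA.
Qed.

Lemma has_sum_bounded_le f S M : has_sum f S ->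
  sum_bounded (fun i => cmod (f i)) M -> cmod S <= M.
Proof.
by move=> fS fM; apply: (has_sum_cmod_le fS) => A; apply: le_trans (ler_cmod_sum _ _ _) _.
Qed.

(** Weierstrass's M-test: the tails of w dominate those of every [f t], so that A does not depend on
    t. Nonnegativity of w is read off at a point of T, and for T empty there is nothing to prove. *)
Lemma has_sum_uniform (T : Type) (f : T -> I -> R[i]) (s : T -> R[i]) w M :
  sum_bounded w M -> (forall t i, cmod (f t i) <= w i) ->
  (forall t, has_sum (f t) (s t)) ->
  forall e : R, 0 < e -> exists A, forall B, (A `<=` B)%fset -> forall t,
    cmod (s t - \sum_(i <- B) f t i) <= e.
Proof.
have [[t0]|noT] := pselect (inhabited T); last first.
  by move=> *; exists fset0 => B _ t; exfalso; apply: noT; exists.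
move=> wM fw fs e e0.
have w0 i : 0 <= w i := le_trans (cmod_ge0 _) (fw t0 i).
have [A hA] := sum_bounded_tail w0 wM (divr_gt0 e0 (ltr0n R 2)).
exists A => B AB t; have [A' hA'] := fs t _ (divr_gt0 e0 (ltr0n R 2)).
rewrite -(subrK (\sum_(i <- (A' `|` B)%fset) f t i) (s t)) -addrA.
rewrite (le_trans (ler_cmodD _ _))// (splitr e) lerD//.
  by rewrite cmodBC hA' ?fsubsetUl.
apply: cmod_sumB; first exact: fsubsetUr.
move=> B' dBB'; apply: le_trans (ler_sum _ (fun i _ => fw t i)) (hA _ _).
by apply: fdisjointWl AB dBB'.
Qed.

Lemma has_sum_le f w S (W : R) : has_sum f S ->
  has_sum (fun i => (w i)%:C) W%:C -> (forall i, cmod (f i) <= w i) -> cmod S <= W.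
Proof.
move=> fS wW fw; apply/ler_addgt0Pr => e e0.
have [A hA] := fS _ (divr_gt0 e0 (ltr0n R 2)).
have [A' hA'] := wW _ (divr_gt0 e0 (ltr0n R 2)).
have := hA _ (fsubsetUl A A'); have := hA' _ (fsubsetUr A A').
set B := (A `|` A')%fset; rewrite -rc_sum -rcB cmod_real => h1 h2.
rewrite -(subrK (\sum_(i <- B) f i) S) (le_trans (ler_cmodD _ _))//.
rewrite cmodBC; apply: (le_trans (lerD h2 (ler_cmod_sum _ _ _))).
have /(le_trans _) : \sum_(i <- B) cmod (f i) <= \sum_(i <- B) w i by exact: ler_sum.
have := le_trans (ler_norm _) h1; set a := \sum_(i <- B) w i.
by move=> h3 h4; rewrite addrC; apply: (le_trans (lerD (h4 _ (lexx _)) (lexx _))); lra.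
Qed.

End HasSum.

Section Reindex.
Context {R : realType} {I J : choiceType}.
Implicit Types (f : I -> R[i]) (h : J -> I).

(** As h is only onto the support of f, a finite subset of I is replaced by its preimage, finite by
    injectivity; the indices lost in this way carry zero terms. *)
Lemma has_sum_reindex f h (S : R[i]) : injective h ->
  (forall i, f i != 0 -> exists j, i = h j) ->
  has_sum (f \o h) S <-> has_sum f S.
Proof.
move=> hi hs.
have img (A : {fset J}) : \sum_(j <- A) f (h j) = \sum_(i <- (h @` A)%fset) f i.
  by rewrite big_imfset//= => x y _ _; exact: hi.
pose hinv i := xget None [set o | exists2 j, o = Some j & i = h j].
have hinvK j : hinv (h j) = Some j.
  rewrite /hinv; case: xgetP => [_ -> [j' -> /hi ->//]|/(_ (Some j))[]].
  by exists j.
have hinvP i j : hinv i = Some j -> i = h j.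
  by rewrite /hinv; case: xgetP => // _ -> [j' -> ->] [->].
have [A0 hA0] : exists pre : {fset I} -> {fset J},
    forall A j, (j \in pre A) = (h j \in A).
  exists (fun A => [fset j in pmap hinv A]%fset) => A j.
  rewrite !inE/= mem_pmap; apply/mapP/idP => [[i iA /esym/hinvP <-//]|jA].
  by exists (h j) => //; rewrite hinvK.
split=> [fS e e0|fS e e0].
  have [A hA] := fS e e0; exists (h @` A)%fset => B AB.
  rewrite (_ : \sum_(i <- B) f i = \sum_(j <- A0 B) f (h j)); last first.
    rewrite img; apply/esym/big_fset_incl.
      by apply/fsubsetP => _ /imfsetP[j /= + ->]; rewrite hA0.
    move=> i iB inA; apply/eqP; apply: contraNT inA => /hs[j ij].
    by rewrite ij in_imfset//= hA0 -ij.
  apply: hA; apply/fsubsetP => j jA; rewrite hA0.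
  by apply: (fsubsetP AB); rewrite in_imfset.
have [A hA] := fS e e0; exists (A0 A) => B AB; rewrite /comp img.
set C := (h @` B)%fset.
rewrite (_ : \sum_(i <- C) f i = \sum_(i <- (A `|` C)%fset) f i); last first.
  apply: big_fset_incl; first exact: fsubsetUr.
  move=> i; rewrite inE => /orP[iA iC|->//]; apply/eqP; apply: contraNT iC.
  move=> /hs[j ij]; rewrite ij in_imfset//=; apply: (fsubsetP AB).
  by rewrite hA0 -ij.
by apply: hA; exact: fsubsetUl.
Qed.

End Reindex.

Section LibrarySum.
Context {R : realType} {I : choiceType}.

Lemma library_sumE (f : I -> R[i]) (S : R[i]) : has_sum f S ->
  @summability.sum I R[i] R[i]^o f = S.
Proof.
move=> fS; have F := @totally_filter I.
apply: (@norm_cvg_lim _ R[i]^o); apply/cvgrPdist_le => e e0.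
(* A positive element for the order of [R[i]] has zero imaginary part. *)
have [eR e'] : (complex.Re e)%:C = e /\ 0 < complex.Re e.
  by move: e0; case: e => a b; rewrite ltcE/= => /andP[/eqP -> ].
have [A hA] := fS _ e'; exists A => // B /= AB.
rewrite /partial_sum -(big_seq_fsetE _ _ xpredT f) -eR distrC.
by rewrite -[leLHS]/(cmod _)%:C lecR hA.
Qed.

End LibrarySum.

(** * Integrals over boxes *)

Section RealContinuity.
Context {R : realType} {Z : topologicalType}.
Implicit Types f g : Z -> R.

Lemma ct_cst (c : R) : continuous (fun _ : Z => c).
Proof. exact: cst_continuous. Qed.

Lemma ctD f g : continuous f -> continuous g -> continuous (fun x => f x + g x).
Proof. by move=> cf cg x; apply: cvgD; [exact: cf|exact: cg]. Qed.

Lemma ctN f : continuous f -> continuous (fun x => - f x).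
Proof. by move=> cf x; apply: cvgN; exact: cf. Qed.

Lemma ctB f g : continuous f -> continuous g -> continuous (fun x => f x - g x).
Proof. by move=> cf cg; apply: ctD => //; exact: ctN. Qed.

Lemma ctM f g : continuous f -> continuous g -> continuous (fun x => f x * g x).
Proof. by move=> cf cg x; apply: cvgM; [exact: cf|exact: cg]. Qed.

Lemma ct_sum (I : Type) (s : seq I) (P : pred I) (F : I -> Z -> R) :
  (forall i, continuous (F i)) -> continuous (fun x => \sum_(i <- s | P i) F i x).
Proof.
move=> cF; elim: s => [|i s IH].
  rewrite (_ : (fun _ => _) = fun=> 0); first exact: ct_cst.
  by apply/funext => x; rewrite big_nil.
rewrite (_ : (fun _ => _) = fun x =>
  (if P i then F i x else 0) + \sum_(j <- s | P j) F j x); last first.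
  by apply/funext => x; rewrite big_cons; case: ifP => //; rewrite add0r.
by apply: ctD => //; case: (P i); [exact: cF|exact: ct_cst].
Qed.

Lemma ct_comp (W : topologicalType) (V : topologicalType) (h : W -> V) (f : Z -> W) :
  continuous f -> continuous h -> continuous (fun x => h (f x)).
Proof. by move=> cf ch x; apply: continuous_comp; [exact: cf|exact: ch]. Qed.

Lemma ctDV (V : normedModType R) (f g : Z -> V) :
  continuous f -> continuous g -> continuous (fun x => f x + g x).
Proof. by move=> cf cg x; apply: cvgD; [exact: cf|exact: cg]. Qed.

Lemma ctZV (V : normedModType R) (f : Z -> R) (g : Z -> V) :
  continuous f -> continuous g -> continuous (fun x => f x *: g x).
Proof. by move=> cf cg x; apply: cvgZ; [exact: cf|exact: cg]. Qed.

Lemma ct_pair (V W : topologicalType) (f : Z -> V) (g : Z -> W) :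
  continuous f -> continuous g -> continuous (fun x => (f x, g x)).
Proof. by move=> cf cg x; apply: cvg_pair; [exact: cf|exact: cg]. Qed.

Lemma ct_id : continuous (fun x : Z => x). Proof. by move=> x; exact: cvg_id. Qed.

Lemma ct_const (W : topologicalType) (w : W) : continuous (fun _ : Z => w).
Proof. exact: cst_continuous. Qed.

End RealContinuity.

Lemma ct_fst (V W : topologicalType) : continuous (fun z : V * W => z.1).
Proof. by move=> z; exact: cvg_fst. Qed.

Lemma ct_snd (V W : topologicalType) : continuous (fun z : V * W => z.2).
Proof. by move=> z; exact: cvg_snd. Qed.

Section Rows.
Context {T : Type} {n : nat}.

Definition rowcons (t : T) (x : 'rV[T]_n) : 'rV[T]_n.+1 :=
  \row_i if unlift ord0 i is Some j then x ord0 j else t.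

Definition rowtail (x : 'rV[T]_n.+1) : 'rV[T]_n := \row_j x ord0 (lift ord0 j).

Lemma rowcons0 t x : rowcons t x ord0 ord0 = t.
Proof. by rewrite mxE unlift_none. Qed.

Lemma rowconsS t x j : rowcons t x ord0 (lift ord0 j) = x ord0 j.
Proof. by rewrite mxE liftK. Qed.

Lemma rowcons_eta (x : 'rV[T]_n.+1) : rowcons (x ord0 ord0) (rowtail x) = x.
Proof.
by apply/rowP => i; rewrite mxE; case: unliftP => [j ->|->//]; rewrite mxE.
Qed.

Lemma rowconsK t x : rowtail (rowcons t x) = x.
Proof. by apply/rowP => j; rewrite mxE rowconsS. Qed.

Lemma forall_ord_recl (Q : 'I_n.+1 -> Prop) :
  (forall i, Q i) <-> Q ord0 /\ forall j, Q (lift ord0 j).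
Proof.
split=> [h|[h0 h] i]; first by split=> *; exact: h.
by case: (unliftP ord0 i) => [j ->|->].
Qed.

End Rows.

Section RowContinuity.
Context {R : realType}.

Lemma cvg_row (Z : Type) (F : set_system Z) {FF : Filter F} n
    (f : Z -> 'rV[R]_n) (l : 'rV[R]_n) :
  (forall i, f z ord0 i @[z --> F] --> l ord0 i) -> f @ F --> l.
Proof.
move=> fl; apply/cvgrPdist_lt => e e0.
have : \forall z \near F, forall i, `|l ord0 i - f z ord0 i| < e.
  by apply: filter_forall => i; move/cvgrPdist_lt : (fl i); exact.
apply: filterS => z h; rewrite [ltLHS]/Num.norm/= mx_normrE.
by apply/bigmax_ltP; split=> // -[i j] _ /=; rewrite !mxE ord1.
Qed.

Lemma continuous_row (Z : topologicalType) n (f : Z -> 'rV[R]_n) :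
  (forall i, continuous (fun z => f z ord0 i)) -> continuous f.
Proof. by move=> cf z; apply: cvg_row => i; exact: cf. Qed.

Lemma coord_cont n (i : 'I_n) : continuous (fun x : 'rV[R]_n => x ord0 i).
Proof. exact: coord_continuous. Qed.

Lemma continuous_rowcons (Z : topologicalType) n (f : Z -> R)
    (g : Z -> 'rV[R]_n) : continuous f -> continuous g ->
  continuous (fun z => rowcons (f z) (g z)).
Proof.
move=> cf cg; apply: continuous_row => i.
rewrite (_ : (fun z => _) = fun z =>
  if unlift ord0 i is Some j then g z ord0 j else f z); last first.
  by apply/funext => z; rewrite mxE.
case: unlift => [j|] //= z.
by apply: (@continuous_comp _ _ _ g (fun x => x ord0 j)); [exact: cg|exact: coord_cont].
Qed.

Lemma ler_coord_norm n (x : 'rV[R]_n) i : `|x ord0 i| <= `|x|.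
Proof.
rewrite [leRHS]/Num.norm/= mx_normrE.
by apply/bigmax_geP; right => /=; exists (ord0, i).
Qed.

Lemma ler_norm_row n (x : 'rV[R]_n) (M : R) : 0 <= M ->
  (forall i, `|x ord0 i| <= M) -> `|x| <= M.
Proof.
move=> M0 h; rewrite [leLHS]/Num.norm/= mx_normrE.
by apply/bigmax_leP; split=> // -[i j] _ /=; rewrite ord1.
Qed.

Definition bounds n (v : 'rV[R]_n) (L : R) : set 'rV[R]_n :=
  [set x | forall i, v ord0 i <= x ord0 i <= v ord0 i + L].

Lemma compact_bounds n (v : 'rV[R]_n) L : compact (bounds v L).
Proof.
have := @rV_compact R n (fun i => `[v ord0 i, v ord0 i + L]%classic)
  (fun i => @segment_compact _ _ _).
by congr compact; apply/seteqP; split=> x h i; have := h i; rewrite /= in_itv.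
Qed.

Lemma continuous_bounded_on (V : topologicalType) (K : set V) (g : V -> R) :
  compact K -> continuous g -> exists2 M : R, 0 <= M & forall x, K x -> `|g x| <= M.
Proof.
move=> cK cg; have /compact_bounded[M [Mr hM]] : compact (g @` K).
  by apply: continuous_compact => //; exact: continuous_subspaceT.
exists (`|M| + 1); first by rewrite addr_ge0.
move=> x Kx; apply: hM; last by exists x.
by rewrite (le_lt_trans (ler_norm _))// ltrDl.
Qed.

End RowContinuity.

Section RowMeasurability.
Context {R : realType} d (T : measurableType d).

(** The topology of row vectors is not compared with the product sigma-algebra. Instead g is
    approached by its values at the grid points of mesh 1 / (N + 1) just below phi; each
    approximation takes countably many values, on measurable pieces cut out by floors. *)
Lemma measurable_row_comp n (phi : 'I_n -> T -> R) (g : 'rV[R]_n -> R) :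
  (forall i, measurable_fun setT (phi i)) -> continuous g ->
  measurable_fun setT (fun t => g (\row_i phi i t)).
Proof.
move=> mphi cg.
pose z (N : nat) (t : T) : {ffun 'I_n -> int} :=
  [ffun i => Num.floor (N.+1%:R * phi i t)].
pose a (N : nat) (c : {ffun 'I_n -> int}) : 'rV[R]_n :=
  \row_i ((c i)%:~R / N.+1%:R).
apply: (@measurable_fun_cvg _ _ _ _ (fun N t => g (a N (z N t)))).
- move=> N _ Y mY; rewrite setTI.
  have -> : (fun t => g (a N (z N t))) @^-1` Y =
      \bigcup_(c in [set: {ffun 'I_n -> int}])
        ([set t | z N t = c] `&` [set t | Y (g (a N c))]).
    apply/seteqP; split=> [t Yt|t [c _ [<-]]//]; first by exists (z N t).
  apply: countable_bigcupT_measurable => // c; apply: measurableI; last first.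
    by have [h|h] := pselect (Y (g (a N c)));
      rewrite (_ : [set _ | _] = (if `[<Y (g (a N c))>] then setT else set0));
      do ?[by apply/seteqP; split=> x //=; case: asboolP]; case: ifP.
  have -> : [set t | z N t = c] = \bigcap_(i in [set: 'I_n])
      (phi i @^-1` `[(c i)%:~R / N.+1%:R, ((c i + 1)%:~R / N.+1%:R)[%classic).
    have e i t : (z N t i == c i) =
        (phi i t \in `[(c i)%:~R / N.+1%:R, ((c i + 1)%:~R / N.+1%:R)[).
      rewrite ffunE in_itv/= ler_pdivrMr// ltr_pdivlMr// mulrC.
      by apply/eqP/idP => [<-|/floor_def//]; exact: floor_itv.
    apply/seteqP; split=> [t /= zc i _|t h].
      by have := e i t; rewrite zc eqxx => /esym.
    by apply/ffunP => i; apply/eqP; rewrite e; exact: (h i).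
  apply: fin_bigcap_measurable => // i _.
  by rewrite -[X in measurable X]setTI; exact: mphi.
- move=> t _; apply: (@continuous_cvg _ _ _ _ _ (fun N => a N (z N t)) g); first exact: cg.
  apply: cvg_row => i; apply/cvgrPdist_le => e e0.
  have /cvgrPdist_le/(_ e e0)[N0 _ hN0] := @cvg_harmonic R.
  exists N0 => // N /= /hN0; rewrite sub0r normrN /harmonic/= ger0_norm// => hN.
  apply: le_trans hN; rewrite !mxE ffunE; have := floor_itv (N.+1%:R * phi i t).
  rewrite intrD => /andP[h1 h2].
  have N0' : 0 < N.+1%:R :> R by [].
  rewrite ger0_norm ?subr_ge0 ?ler_pdivrMr 1?[phi i t * _]mulrC//.
  by rewrite lerBlDr -[X in X + _]mul1r -mulrDl ler_pdivlMr// mulrC addrC ltW.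
Qed.

End RowMeasurability.

Section Boxes.
Context {R : realType}.
Local Notation T := (measurableTypeR R).
Local Notation leb := (@lebesgue_measure R).

Definition box n (v : 'rV[R]_n) (L : R) : set (n.-tuple T) :=
  [set u | forall i, v ord0 i <= (tnth u i : R) <= v ord0 i + L].

Lemma box_cube n (a : R) : cube a = box (0 : 'rV[R]_n) a.
Proof.
by apply/seteqP; split=> u /= h i; have := h i; rewrite mxE add0r.
Qed.

Lemma measurable_box n (v : 'rV[R]_n) L : measurable (box v L).
Proof.
have -> : box v L = \bigcap_(i in [set: 'I_n])
    ((fun u : n.-tuple T => tnth u i) @^-1` `[v ord0 i, v ord0 i + L]%classic).
  apply/seteqP; split=> u h i; [move=> _; rewrite /= in_itv/=; exact: h|].
  by have := h i I; rewrite /= in_itv.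
apply: fin_bigcap_measurable => // i _; rewrite -[X in measurable X]setTI.
exact: measurable_tnth.
Qed.

Lemma tnth_tcons0 n (t : T) (u : n.-tuple T) : tnth (tcons (t, u)) ord0 = t.
Proof. by rewrite (tnth_nth t). Qed.

Lemma tnth_tconsS n (t : T) (u : n.-tuple T) j :
  tnth (tcons (t, u)) (lift ord0 j) = tnth u j.
Proof. by rewrite !(tnth_nth t). Qed.

Lemma vec_of_tcons n (t : T) (u : n.-tuple T) :
  vec_of_tuple (tcons (t, u)) = rowcons t (vec_of_tuple u) :> 'rV[R]_n.+1.
Proof.
apply/rowP => i; rewrite !mxE; case: unliftP => [j ->|->].
  by rewrite tnth_tconsS mxE.
by rewrite tnth_tcons0.
Qed.

Lemma tcons_box n (v : 'rV[R]_n.+1) L :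
  @tcons _ T n @^-1` box v L =
  `[v ord0 ord0, v ord0 ord0 + L]%classic `*` box (rowtail v) L.
Proof.
apply/seteqP; split=> -[t u] /=.
  move=> /forall_ord_recl[]; rewrite tnth_tcons0 => h0 h; split=> [|j].
    by rewrite /= in_itv.
  by have := h j; rewrite tnth_tconsS mxE.
move=> [h0 h]; apply/forall_ord_recl; rewrite tnth_tcons0; split=> [|j].
  by move: h0; rewrite /= in_itv.
by have := h j; rewrite tnth_tconsS mxE.
Qed.

Lemma lebesgue_tuple_box n (v : 'rV[R]_n) L : 0 <= L ->
  lebesgue_tuple R n (box v L) = (L ^+ n)%:E.
Proof.
move=> L0; elim: n v => [|n IH] v.
  by rewrite /lebesgue_tuple/= diracE mem_set ?expr0// => -[].
rewrite /lebesgue_tuple/= /tuple_measureS /pushforward.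
have := tcons_box v L; rewrite /preimage/= => ->.
rewrite product_measure1E; [|exact: measurable_itv|exact: measurable_box].
rewrite [X in (_ * X)%E](IH _).
have := lebesgue_measure_itv `[v ord0 ord0, v ord0 ord0 + L] => /= ->.
rewrite lte_fin ltrDl exprS EFinM; case: ltP => [_|L0']; first by rewrite -EFinB addrC addKr.
by have -> : L = 0 by apply/eqP; rewrite eq_le L0 L0'.
Qed.

Lemma measurable_vec n (g : 'rV[R]_n -> R) : continuous g ->
  measurable_fun setT (fun u : n.-tuple T => g (vec_of_tuple u)).
Proof.
by move=> cg; apply: measurable_row_comp => // i; exact: measurable_tnth.
Qed.

Lemma vec_bounds n (v : 'rV[R]_n) L (u : n.-tuple T) :
  box v L u -> bounds v L (vec_of_tuple u).
Proof. by move=> h i; rewrite mxE; exact: h. Qed.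

Definition bint n (v : 'rV[R]_n) (L : R) (g : 'rV[R]_n -> R) : R :=
  Rintegral (lebesgue_tuple R n) (box v L) (fun u => g (vec_of_tuple u)).

Lemma bint_integrable n (v : 'rV[R]_n) L (g : 'rV[R]_n -> R) : 0 <= L -> continuous g ->
  (lebesgue_tuple R n).-integrable (box v L)
    (EFin \o (fun u => g (vec_of_tuple u))).
Proof.
move=> L0 cg; apply: measurable_bounded_integrable.
- exact: measurable_box.
- by have := lebesgue_tuple_box v L0 => /= ->; rewrite ltry.
- by apply: measurable_funS (measurable_vec cg).
- have [M M0 hM] := continuous_bounded_on (@compact_bounds R n v L) cg.
  exists M; split; first exact: num_real.
  move=> N MN u /vec_bounds /hM /=; move=> h; exact: le_trans h (ltW MN).
Qed.

Lemma bint_cst n (v : 'rV[R]_n) L c : 0 <= L -> bint v L (fun=> c) = c * L ^+ n.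
Proof.
move=> L0; rewrite /bint Rintegral_cst; last exact: measurable_box.
by rewrite [X in fine X](_ : _ = (L ^+ n)%:E)//; exact: lebesgue_tuple_box.
Qed.

Lemma bintD n (v : 'rV[R]_n) L (g h : 'rV[R]_n -> R) : 0 <= L -> continuous g -> continuous h ->
  bint v L (fun x => g x + h x) = bint v L g + bint v L h.
Proof.
by move=> L0 cg ch; rewrite /bint RintegralD//;
  [exact: measurable_box|exact: bint_integrable|exact: bint_integrable].
Qed.

Lemma bintZ n (v : 'rV[R]_n) L (c : R) (g : 'rV[R]_n -> R) : 0 <= L -> continuous g ->
  bint v L (fun x => c * g x) = c * bint v L g.
Proof.
by move=> L0 cg; rewrite /bint RintegralZl//;
  [exact: measurable_box|exact: bint_integrable].
Qed.

Lemma eq_bint n (v : 'rV[R]_n) L (g h : 'rV[R]_n -> R) : {in bounds v L, g =1 h} ->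
  bint v L g = bint v L h.
Proof.
move=> gh; apply: eq_Rintegral => u; rewrite inE => /vec_bounds uB.
by apply: gh; rewrite inE.
Qed.

Lemma ler_bint n (v : 'rV[R]_n) L (g h : 'rV[R]_n -> R) : 0 <= L -> continuous g -> continuous h ->
  (forall x, bounds v L x -> g x <= h x) -> bint v L g <= bint v L h.
Proof.
move=> L0 cg ch gh; apply: le_Rintegral;
  [exact: measurable_box|exact: bint_integrable|exact: bint_integrable|].
by move=> u /vec_bounds; exact: gh.
Qed.

Lemma ler_norm_bint n (v : 'rV[R]_n) L (g h : 'rV[R]_n -> R) : 0 <= L ->
  continuous g -> continuous h ->
  (forall x, bounds v L x -> `|g x| <= h x) -> `|bint v L g| <= bint v L h.
Proof.
move=> L0 cg ch gh; rewrite ler_norml -mulN1r -bintZ//.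
have cNh : continuous (fun x => -1 * h x).
  by apply: ctM => //; exact: ct_cst.
by apply/andP; split; apply: ler_bint => // x /gh; rewrite ler_norml ?mulN1r => /andP[].
Qed.

End Boxes.

Section FubiniRestricted.
Context d1 d2 (T1 : measurableType d1) (T2 : measurableType d2) (R : realType).
Variable m1 : {sigma_finite_measure set T1 -> \bar R}.
Variable m2 : {sigma_finite_measure set T2 -> \bar R}.

Lemma Rintegral_setX (A : set T1) (B : set T2) (h : T1 * T2 -> R) :
  measurable A -> measurable B ->
  (product_measure1 m1 m2).-integrable (A `*` B) (EFin \o h) ->
  (forall x, A x -> m2.-integrable B (EFin \o (fun y => h (x, y)))) ->
  Rintegral (product_measure1 m1 m2) (A `*` B) h =
  Rintegral m1 A (fun x => Rintegral m2 B (fun y => h (x, y))).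
Proof.
move=> mA mB ih ihx; rewrite /Rintegral; congr fine.
have mAB : measurable (A `*` B) by exact: measurableX.
rewrite integral_mkcond -integral12_prod_meas1; last first.
  by rewrite -integrable_mkcond.
rewrite [RHS]integral_mkcond; apply: eq_integral => x _.
rewrite [RHS]patchE; case: ifPn => [/set_mem Ax|xA]; last first.
  apply: integral0_eq => y _; rewrite patchE ifN//.
  by apply: contra xA; rewrite !inE => -[].
rewrite fineK; last by apply: integrable_fin_num => //; exact: ihx.
rewrite [RHS]integral_mkcond; apply: eq_integral => y _.
rewrite !patchE; congr (if _ then _ else _).
by rewrite in_setX (mem_set Ax).
Qed.

End FubiniRestricted.

Section BoxFubini.
Context {R : realType}.
Local Notation T := (measurableTypeR R).
Local Notation leb := (@lebesgue_measure R).

Definition itvint (a b : R) (h : R -> R) : R := Rintegral leb `[a, b]%classic h.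

Lemma itvint_integrable (a b : R) h : continuous h ->
  leb.-integrable `[a, b]%classic (EFin \o h).
Proof.
move=> ch; apply: continuous_compact_integrable; first exact: segment_compact.
exact: continuous_subspaceT.
Qed.

(** By compactness of the box, joint continuity makes F (w', x) close to F (w, x) uniformly in x for
    w' near w. *)
Lemma continuous_bint_param (W : topologicalType) n (v : 'rV[R]_n) L
    (F : W * 'rV[R]_n -> R) : 0 <= L -> continuous F ->
  continuous (fun w => bint v L (fun x => F (w, x))).
Proof.
move=> L0 cF w; apply/cvgrPdist_le => e e0.
(* The [+ 1] keeps the divisor positive even when [L = 0]. *)
have Ln : 0 < L ^+ n + 1 by rewrite ltr_wpDl// exprn_ge0.
have e'0 : 0 < e / (L ^+ n + 1) by rewrite divr_gt0.
have cFw w' : continuous (fun x => F (w', x)).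
  by apply: (@ct_comp _ _ _ F (fun x => (w', x))) => //; apply: ct_pair;
    [exact: ct_const|exact: ct_id].
have near_w : \forall w' \near w, forall x, bounds v L x ->
    `|F (w, x) - F (w', x)| <= e / (L ^+ n + 1).
  have := (compact_near_coveringP _).1 (@compact_bounds _ _ v L) W (nbhs w)
    (fun w' x => `|F (w, x) - F (w', x)| <= e / (L ^+ n + 1)) _.
  apply => x _.
  have h2 := divr_gt0 e'0 (ltr0n R 2).
  have [[A1 A2] /= [n1 n2] hA] : \forall z \near (x, w),
      `|F (w, x) - F (z.2, z.1)| < e / (L ^+ n + 1) / 2.
    have : {for (x, w), continuous (fun z : 'rV[R]_n * W => F (z.2, z.1))}.
      have : continuous (fun z : 'rV[R]_n * W => (z.2, z.1)).
        by apply: ct_pair; [exact: ct_snd|exact: ct_fst].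
      by move/ct_comp => /(_ _ F cF); apply.
    by move/cvgrPdist_lt; apply.
  exists (A1, A2) => // -[x' w'] [/= A1x' A2w'].
  have h1 := hA (x', w') (conj A1x' A2w').
  have h3 := hA (x', w) (conj A1x' (nbhs_singleton n2)).
  rewrite (_ : _ - _ = (F (w, x) - F (w', x')) - (F (w, x) - F (w, x'))); last by ring.
  by rewrite (le_trans (ler_normB _ _))// (splitr (e / _)) lerD// ltW.
apply: filterS near_w => w' hw.
rewrite -mulN1r -bintZ// -bintD//; last by apply: ctM => //; exact: ct_cst.
apply: (le_trans (@ler_norm_bint _ _ _ _ _ (fun=> e / (L ^+ n + 1)) L0 _ _ _)).
- by apply: ctD => //; apply: ctM => //; exact: ct_cst.
- exact: ct_cst.
- by move=> x bx; rewrite mulN1r; exact: hw.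
- rewrite bint_cst// -mulrA ler_piMr ?(ltW e0)// ler_pdivrMl// mulr1.
  by rewrite lerDl.
Qed.

(** Fubini in the first coordinate, carried through the push-forward by [tcons] that defines the
    measure on (n+1)-tuples. It is the induction step of all statements on boxes. *)
Lemma bintS n (v : 'rV[R]_n.+1) L (g : 'rV[R]_n.+1 -> R) :
  0 <= L -> continuous g ->
  bint v L g = itvint (v ord0 ord0) (v ord0 ord0 + L)
    (fun t => bint (rowtail v) L (fun x => g (rowcons t x))).
Proof.
move=> L0 cg; rewrite /bint /itvint.
have mi : measurable (`[v ord0 ord0, v ord0 ord0 + L]%classic : set T).
  exact: measurable_itv.
have mp : measurable_fun setT (@tcons _ T n) := @measurable_tcons _ T n.
have eD := tcons_box v L.
have mgv := measurable_vec cg.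
have ig : (product_measure1 leb (lebesgue_tuple R n)).-integrable
    (@tcons _ T n @^-1` box v L) ((EFin \o (fun u => g (vec_of_tuple u))) \o @tcons _ T n).
  apply: measurable_bounded_integrable.
  - by rewrite eD; apply: measurableX => //; exact: measurable_box.
  - rewrite [X in (X < _)%E](_ : _ = (L ^+ n.+1)%:E) ?ltry//.
    exact: (lebesgue_tuple_box v L0).
  - by apply: measurable_funS (measurableT_comp mgv mp).
  - have [M M0 hM] := continuous_bounded_on (@compact_bounds R _ v L) cg.
    exists M; split; first exact: num_real.
    by move=> N MN u /vec_bounds /hM /= h; exact: le_trans h (ltW MN).
have cgt t : continuous (fun x => g (rowcons t x)).
  by apply: ct_comp => //; apply: continuous_rowcons; [exact: ct_cst|exact: ct_id].
rewrite {1}/Rintegral [X in fine X](_ : _ =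
  \int[product_measure1 leb (lebesgue_tuple R n)]_(u in @tcons _ T n @^-1` box v L)
    ((EFin \o (fun u => g (vec_of_tuple u))) \o @tcons _ T n) u)%E; last first.
  rewrite -(integral_pushforward mp _ ig (measurable_box v L))//.
  exact/measurable_EFinP.
rewrite eD.
transitivity (Rintegral (product_measure1 leb (lebesgue_tuple R n))
  (`[v ord0 ord0, v ord0 ord0 + L]%classic `*` box (rowtail v) L)
  (fun z => g (rowcons (z.1 : R) (vec_of_tuple z.2)))).
  rewrite /Rintegral; congr fine; apply: eq_integral => -[t u] _ /=.
  by rewrite vec_of_tcons.
rewrite Rintegral_setX//; first exact: measurable_box.
- move: ig; rewrite eD; congr (_.-integrable _ _).
  by apply/funext => -[t u] /=; rewrite vec_of_tcons.
- by move=> t _; exact: (bint_integrable (rowtail v) L0 (cgt t)).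
Qed.

Lemma bint0 (v : 'rV[R]_0) L (g : 'rV[R]_0 -> R) : 0 <= L -> bint v L g = g 0.
Proof.
move=> L0; rewrite (@eq_bint _ _ _ _ _ (fun=> g 0)).
  by rewrite bint_cst// expr0 mulr1.
by move=> x _; congr g; apply/rowP => -[].
Qed.

Lemma itvint_shift (a b c : R) h : a <= b -> continuous h ->
  itvint (a + c) (b + c) h = itvint a b (fun t => h (t + c)).
Proof.
move=> ab ch; rewrite /itvint /Rintegral; congr fine.
pose F (t : R) := t + c.
have dF (t : R) : is_derive t 1 F 1.
  by apply: is_derive_eq; rewrite addr0.
have F'1 : derive1 F = cst 1.
  by apply/funext => t; rewrite derive1E; have [_ ->] := dF t.
have cF : continuous F.
  by move=> t; apply: cvgD; [exact: cvg_id|exact: cvg_cst].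
rewrite -[a + c]/(F a) -[b + c]/(F b).
rewrite (integration_by_substitution_increasing ab) ?F'1//.
- by apply: eq_integral => t _ /=; rewrite mulr1.
- by move=> x y _ _ xy; rewrite ltrD2r.
- by move=> x _; exact: cvg_cst.
- exact: is_cvg_cst.
- exact: is_cvg_cst.
- split.
  + by move=> t _; have [] := dF t.
  + by apply: cvg_at_right_filter; exact: cF.
  + by apply: cvg_at_left_filter; exact: cF.
- exact: continuous_subspaceT.
Qed.

Lemma itvint_cat (a b c : R) h : a <= b -> b <= c -> continuous h ->
  itvint a c h = itvint a b h + itvint b c h.
Proof.
move=> ab bc ch; rewrite /itvint.
have := @Rintegral_itvB R h (BLeft a) (BRight c) b (itvint_integrable a c ch).
rewrite !bnd_simp => /(_ ab bc) /esym/eqP.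
rewrite Rintegral_itv_obnd_cbnd.
  by rewrite eq_sym subr_eq addrC => /eqP.
by apply: integrableS (itvint_integrable b c ch) => //;
  apply: subset_itvr; rewrite bnd_simp.
Qed.

Lemma itvintD (a b : R) h h' : continuous h -> continuous h' ->
  itvint a b (fun t => h t + h' t) = itvint a b h + itvint a b h'.
Proof.
by move=> ch ch'; rewrite /itvint RintegralD//; exact: itvint_integrable.
Qed.

Lemma itvint_sum (I : Type) (s : seq I) (a b : R) (h : I -> R -> R) :
  (forall i, continuous (h i)) ->
  itvint a b (fun x => \sum_(i <- s) h i x) = \sum_(i <- s) itvint a b (h i).
Proof.
move=> ch; elim: s => [|i s IH].
  rewrite big_nil /itvint (_ : (fun _ => _) = cst 0) ?Rintegral0//.
    by rewrite /Rintegral integral0_eq.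
  by apply/funext => x; rewrite big_nil.
rewrite big_cons -IH -itvintD//; last exact: ct_sum.
by congr itvint; apply/funext => x; rewrite big_cons.
Qed.

(** After reducing the shift to c' in [0, a] modulo a, the interval [c', a + c'] is cut at a and its
    second piece is moved back by one period. *)
Lemma itvint_periodic (a c : R) h : 0 < a -> continuous h ->
  (forall t (z : int), h (t + a * z%:~R) = h t) ->
  itvint 0 a (fun t => h (t + c)) = itvint 0 a h.
Proof.
move=> a0 ch ph.
pose c' := c - a * (Num.floor (c / a))%:~R.
have -> : (fun t => h (t + c)) = fun t => h (t + c').
  apply/funext => t; rewrite -[RHS](ph _ (Num.floor (c / a))).
  by rewrite /c' addrA subrK.
have /andP[c'0 c'a] : 0 <= c' <= a.
  have /andP[h1 h2] := floor_itv (c / a).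
  rewrite /c' subr_ge0 lerBlDr mulrC -ler_pdivlMr// h1/=.
  by move: h2; rewrite intrD ltr_pdivrMr// mulrDl mul1r addrC => /ltW.
rewrite -itvint_shift ?(ltW a0)// add0r (@itvint_cat _ a)//; last by rewrite lerDl.
rewrite [in X in _ + X = _]addrC -{2}(add0r a) itvint_shift//.
rewrite (_ : (fun t => h (t + a)) = h); last first.
  by apply/funext => t; rewrite -(ph t 1) mulr1.
by rewrite addrC -itvint_cat.
Qed.

End BoxFubini.

(** * Tilings by lattice translates *)

Section Tiling.
Context {R : realType}.

Lemma rowconsD n (t s : R) (x y : 'rV[R]_n) :
  rowcons t x + rowcons s y = rowcons (t + s) (x + y).
Proof. by apply/rowP => i; rewrite !mxE; case: unlift => [j|]; rewrite ?mxE. Qed.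

Lemma rowconsZ n (c t : R) (x : 'rV[R]_n) :
  c *: rowcons t x = rowcons (c * t) (c *: x).
Proof. by apply/rowP => i; rewrite !mxE; case: unlift => [j|]; rewrite ?mxE. Qed.

Lemma of_lattice_rowcons n (z : int) (r : 'rV[int]_n) :
  of_lattice R (rowcons z r) = rowcons z%:~R (of_lattice R r) :> 'rV[R]_n.+1.
Proof. by apply/rowP => i; rewrite !mxE; case: unlift => [j|]; rewrite ?mxE. Qed.

Lemma of_latticeD n (r s : 'rV[int]_n) :
  of_lattice R (r + s) = of_lattice R r + of_lattice R s :> 'rV[R]_n.
Proof. by apply/rowP => i; rewrite !mxE intrD. Qed.

Lemma of_latticeN n (r : 'rV[int]_n) : of_lattice R (- r) = - of_lattice R r :> 'rV[R]_n.
Proof. by apply/rowP => i; rewrite !mxE mulrNz. Qed.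

Lemma of_latticeB n (r s : 'rV[int]_n) :
  of_lattice R (r - s) = of_lattice R r - of_lattice R s :> 'rV[R]_n.
Proof. by rewrite of_latticeD of_latticeN. Qed.

Lemma of_lattice0 n : of_lattice R 0 = 0 :> 'rV[R]_n.
Proof. by apply/rowP => i; rewrite !mxE. Qed.

(** Built one coordinate at a time, as the integrals over boxes are, so that tilings follow by
    induction on n. *)
Fixpoint zbox n (s : seq int) : seq 'rV[int]_n :=
  match n with
  | 0 => [:: 0]
  | m.+1 => [seq rowcons a r | a <- s, r <- zbox m s]
  end.

Lemma mem_zbox n s (r : 'rV[int]_n) :
  (r \in zbox n s) = [forall i, r ord0 i \in s].
Proof.
elim: n r => [|n IH] r.
  rewrite /= inE; apply/eqP/forallP => [_ []//|_].
  by apply/rowP => -[].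
apply/allpairsP/forallP => /= [[[a r'] /= [aS r'S ->]]|/forall_ord_recl[h0 h]].
  move: r'S; rewrite IH => /forallP r'S; apply/forall_ord_recl; rewrite rowcons0.
  by split=> // j; rewrite rowconsS.
exists (r ord0 ord0, rowtail r); rewrite rowcons_eta IH; split=> //=.
by apply/forallP => j; rewrite mxE.
Qed.

Lemma zbox_uniq n s : uniq s -> uniq (zbox n s).
Proof.
move=> us; elim: n => //= n IH; apply: allpairs_uniq => // -[a r] [b q] _ _ /= e.
have := congr1 (fun x : 'rV_n.+1 => x ord0 ord0) e; rewrite !rowcons0 => ->.
by have := congr1 rowtail e; rewrite !rowconsK => ->.
Qed.

Lemma sum_zbox_prod n s (w : int -> R) :
  \sum_(r <- zbox n s) \prod_i w (r ord0 i) = (\sum_(a <- s) w a) ^+ n.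
Proof.
elim: n => [|n IH] /=; first by rewrite big_seq1 big_ord0 expr0.
rewrite big_allpairs_dep/= exprS mulr_suml; apply: eq_bigr => a _.
rewrite -IH mulr_sumr; apply: eq_bigr => r _.
rewrite big_ord_recl rowcons0; congr (_ * _).
by apply: eq_bigr => j _; rewrite rowconsS.
Qed.

Lemma itvint_tile (m : nat) (a : R) h : continuous h ->
  itvint a (a + m%:R) h =
  \sum_(z <- [seq Posz j | j <- iota 0 m]) itvint 0 1 (fun t => h (t + (a + z%:~R))).
Proof.
move=> ch; elim: m => [|m IH].
  by rewrite big_nil addr0 /itvint set_itv1 Rintegral_set1.
rewrite -[m.+1]addn1 iotaD map_cat big_cat/= big_seq1 -IH.
rewrite (@itvint_cat _ a (a + m%:R)) ?lerDl//; last by rewrite lerD2l ler_nat leq_addr.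
congr (_ + _); rewrite add0n -itvint_shift// add0r; congr itvint.
by rewrite natrD addrA addrC [1 + _]addrC; ring.
Qed.

Lemma ct_shift n (v : 'rV[R]_n) : continuous (fun x : 'rV[R]_n => x + v).
Proof.
by apply: ctDV; [exact: ct_id|exact: ct_const].
Qed.

Lemma continuous_rowcons_l n (g : 'rV[R]_n.+1 -> R) t : continuous g ->
  continuous (fun x => g (rowcons t x)).
Proof.
by move=> cg; apply: ct_comp => //; apply: continuous_rowcons;
  [exact: ct_cst|exact: ct_id].
Qed.

Lemma continuous_bint_rowcons n (v : 'rV[R]_n) L (g : 'rV[R]_n.+1 -> R) :
  0 <= L -> continuous g -> continuous (fun t => bint v L (fun x => g (rowcons t x))).
Proof.
move=> L0 cg; apply: (@continuous_bint_param _ _ _ _ _ (fun z => g (rowcons z.1 z.2))) => //.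
by apply: ct_comp => //; apply: continuous_rowcons; [exact: ct_fst|exact: ct_snd].
Qed.

Lemma rowtail0 n : rowtail 0 = 0 :> 'rV[R]_n.
Proof. by apply/rowP => i; rewrite !mxE. Qed.

Lemma bint_tile n (m : nat) (v : 'rV[R]_n) (g : 'rV[R]_n -> R) : continuous g ->
  bint v m%:R g =
  \sum_(r <- zbox n [seq Posz j | j <- iota 0 m])
    bint 0 1 (fun x => g (x + (v + of_lattice R r))).
Proof.
elim: n v g => [|n IH] v g cg.
  rewrite /= big_seq1 !bint0//; congr g; by apply/rowP => -[].
rewrite bintS// itvint_tile//; last exact: continuous_bint_rowcons.
rewrite /= big_allpairs_dep/=; apply: eq_bigr => z _.
have cgv (w : 'rV[R]_n.+1) : continuous (fun x : 'rV[R]_n.+1 => g (x + w)).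
  by apply: ct_comp => //; exact: ct_shift.
have -> : (fun t => bint (rowtail v) m%:R
      (fun x => g (rowcons (t + (v ord0 ord0 + z%:~R)) x))) =
    fun t => \sum_(r <- zbox n [seq Posz j | j <- iota 0 m])
      bint 0 1 (fun x => g (rowcons t x + (v + of_lattice R (rowcons z r)))).
  apply/funext => t; rewrite IH; last exact: continuous_rowcons_l.
  apply: eq_bigr => r _; congr bint; apply/funext => x; congr g.
  by rewrite of_lattice_rowcons -[in RHS](rowcons_eta v) !rowconsD.
rewrite itvint_sum.
  apply: eq_bigr => r _.
  by rewrite [in RHS](bintS 0 ler01 (cgv _)) rowtail0 mxE add0r.
by move=> r; exact: (@continuous_bint_rowcons _ 0 1 (fun y => g (y + _))).
Qed.

Definition lattice_periodic n (a : R) (U : Type) (g : 'rV[R]_n -> U) : Prop :=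
  forall (m : 'rV[int]_n) x, g (x + a *: of_lattice R m) = g x.

Lemma bint_periodic n (a : R) (v : 'rV[R]_n) (g : 'rV[R]_n -> R) :
  0 < a -> continuous g -> lattice_periodic a g ->
  bint 0 a (fun x => g (x + v)) = bint 0 a g.
Proof.
move=> a0; have a0' := ltW a0; elim: n v g => [|n IH] v g cg pg.
  by rewrite !bint0//; congr g; apply/rowP => -[].
have cgv : continuous (fun x : 'rV[R]_n.+1 => g (x + v)).
  by apply: ct_comp => //; exact: ct_shift.
rewrite (bintS 0 a0' cgv) (bintS 0 a0' cg) rowtail0 mxE add0r.
have -> : (fun t => bint 0 a (fun x => g (rowcons t x + v))) =
    fun t => bint 0 a (fun x => g (rowcons (t + v ord0 ord0) x)).
  apply/funext => t.
  rewrite -(IH (rowtail v) (fun x => g (rowcons (t + v ord0 ord0) x))).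
  - by congr bint; apply/funext => x; rewrite -{1}(rowcons_eta v) rowconsD.
  - exact: continuous_rowcons_l.
  - move=> m x; rewrite -[RHS](pg (rowcons 0 m)); congr g.
    by rewrite of_lattice_rowcons rowconsZ rowconsD mulr0 addr0.
apply: (@itvint_periodic _ a (v ord0 ord0)
  (fun t => bint 0 a (fun x => g (rowcons t x)))) => //.
  exact: continuous_bint_rowcons.
move=> t z; congr bint; apply/funext => x.
rewrite -[RHS](pg (rowcons z 0)); congr g.
by rewrite of_lattice_rowcons rowconsZ rowconsD of_lattice0 scaler0 addr0.
Qed.

End Tiling.

Section Unfolding.
Context {R : realType}.
Local Notation T := (measurableTypeR R).

(** The left endpoints of the 2N unit intervals tiling [-N, N]: -N is included, N is not. *)
Definition centered (N : nat) : seq int := [seq Posz j - Posz N | j <- iota 0 (N + N)].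

Lemma mem_centered N (z : int) : (`|z| < N)%N -> z \in centered N.
Proof.
move=> zN; apply/mapP; exists (absz (z + Posz N)); last by lia.
by rewrite mem_iota; lia.
Qed.

Lemma centered_uniq N : uniq (centered N).
Proof. by rewrite map_inj_uniq ?iota_uniq// => i j /addIr []. Qed.

Lemma zbox_cofinal n (A : {fset 'rV[int]_n}) :
  exists N0, forall N, (N0 <= N)%N -> forall r, r \in A -> r \in zbox n (centered N).
Proof.
exists (\max_(r <- A) \max_i `|r ord0 i|%N).+1 => N N0N r rA.
rewrite mem_zbox; apply/forallP => i; apply: mem_centered.
apply: leq_trans N0N; rewrite ltnS.
apply: (@leq_trans (\max_i `|r ord0 i|%N)%N).
  exact: (@leq_bigmax _ (fun i => absz (r ord0 i))).
by rewrite (big_rem r)//= leq_maxl.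
Qed.

Lemma bint_tile_centered n (N : nat) (v : 'rV[R]_n) (g : 'rV[R]_n -> R) :
  continuous g -> bint (v - const_mx N%:R) (N + N)%:R g =
  \sum_(r <- zbox n (centered N)) bint 0 1 (fun x => g (x + (v + of_lattice R r))).
Proof.
move=> cg; rewrite bint_tile//.
have -> : zbox n (centered N) =
    [seq r - const_mx (Posz N) | r <- zbox n [seq Posz j | j <- iota 0 (N + N)]].
  elim: n {v g cg} => [|n IH] /=; first by congr cons; apply/rowP => -[].
  rewrite IH; rewrite /centered !allpairs_mapl map_allpairs allpairs_mapr.
  apply: eq_allpairs => // a r; apply/rowP => i; rewrite !mxE.
  by case: unlift => [j|]; rewrite ?mxE.
rewrite big_map; apply: eq_bigr => r _; congr bint; apply/funext => x; congr g.
by apply/rowP => i; rewrite !mxE intrD mulrNz -pmulrn; ring.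
Qed.

(** Both sides are limits along the cubes of side 2N centred at v: the integral by monotone
    convergence, the unordered sum because the corresponding cubes of lattice points eventually
    contain any finite set. *)
Lemma has_sum_unfold n (v : 'rV[R]_n) (g : 'rV[R]_n -> R) M :
  continuous g -> (forall x, 0 <= g x) ->
  sum_bounded (fun r => bint 0 1 (fun x => g (x + (v + of_lattice R r)))) M ->
  has_sum (fun r : 'rV[int]_n => (bint 0 1 (fun x => g (x + (v + of_lattice R r))))%:C)
    (Rintegral (lebesgue_tuple R n) setT (fun u => g (vec_of_tuple u)))%:C.
Proof.
move=> cg g0 gM.
have b0 r : 0 <= bint 0 1 (fun x => g (x + (v + of_lattice R r))).
  by apply: Rintegral_ge0 => u _; exact: g0.
have [S hS] := has_sum_ge0 b0 gM.
suff -> : Rintegral (lebesgue_tuple R n) setT (fun u => g (vec_of_tuple u)) = S by [].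
pose B N : set (n.-tuple T) := box (v - const_mx N%:R) (N + N)%:R.
have BT : \bigcup_N B N = setT.
  apply/seteqP; split=> // u _.
  have [N hN] : exists N : nat, `|vec_of_tuple u - v| <= N%:R.
    exists (Num.bound `|vec_of_tuple u - v|).
    by apply: ltW; apply: archi_boundP; exact: normr_ge0.
  exists N => // i; have := le_trans (ler_coord_norm _ i) hN; rewrite !mxE natrD.
  by rewrite ler_norml => /andP[]; lra.
have ndB : nondecreasing_seq B.
  move=> N N' NN'; apply/subsetPset => u h i; have := h i; rewrite !mxE !natrD.
  have : N%:R <= N'%:R :> R by rewrite ler_nat.
  by clear BT; lra.
have mB N : measurable (B N) by exact: measurable_box.
have mg := measurable_vec cg.
have cvg1 := @ge0_nondecreasing_set_cvg_integral _ _ _ B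
  (EFin \o (fun u => g (vec_of_tuple u))) (lebesgue_tuple R n) ndB mB
  (fun N => (measurable_EFinP _ _).2 (measurable_funS measurableT (@subsetT _ _) mg))
  (fun N u _ => g0 _).
rewrite BT in cvg1.
have eB N : (\int[lebesgue_tuple R n]_(u in B N) (g (vec_of_tuple u))%:E =
    (\sum_(r <- zbox n (centered N)) bint 0 1 (fun x => g (x + (v + of_lattice R r))))%:E)%E.
  rewrite -bint_tile_centered// /bint /Rintegral fineK//.
  apply: integrable_fin_num; first exact: mB.
  exact: (bint_integrable (v - const_mx N%:R) (ler0n R (N + N)) cg).
suff cvg2 : (\int[lebesgue_tuple R n]_(u in B N) (g (vec_of_tuple u))%:E
    @[N --> \oo] --> S%:E)%E.
  rewrite /Rintegral.
  by have -> := cvg_unique (@ereal_hausdorff R) cvg1 cvg2.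
rewrite (_ : (fun N => _) = EFin \o (fun N =>
  \sum_(r <- zbox n (centered N)) bint 0 1 (fun x => g (x + (v + of_lattice R r))))); last first.
  by apply/funext => N; exact: eB.
apply: cvg_EFin; first by near=> N.
apply/cvgrPdist_le => e e0.
have [A hA] := hS e e0; have [N0 hN0] := zbox_cofinal A.
exists N0 => // N /= /hN0 AN.
pose Z := [fset r in zbox n (centered N)]%fset.
have := hA Z; rewrite -rc_sum -rcB cmod_real distrC.
rewrite (_ : \sum_(i <- Z) _ = \sum_(r <- zbox n (centered N))
  bint 0 1 (fun x => g (x + (v + of_lattice R r)))); last first.
  apply: perm_big; apply: uniq_perm; first exact: fset_uniq.
    exact/zbox_uniq/centered_uniq.
  by move=> r; rewrite !inE.
by apply; apply/fsubsetP => r /AN; rewrite !inE.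
Unshelve. all: by end_near.
Qed.

End Unfolding.

(** * Averages over cubes *)

Section ComplexContinuity.
Context {R : realType} {Z : topologicalType}.
Implicit Types f g : Z -> R[i].
Local Notation Re := complex.Re.
Local Notation Im := complex.Im.

Definition ccont f := continuous (fun z => Re (f z)) /\ continuous (fun z => Im (f z)).

Lemma ccontP f : (forall z (e : R), 0 < e -> \forall z' \near z, cmod (f z - f z') <= e) <->
  ccont f.
Proof.
split=> [h|[cR cI] z e e0].
  split=> z; apply/cvgrPdist_le => e e0; apply: filterS (h z e e0) => z';
    apply: le_trans.
    by rewrite -ReN -ReD; exact: ler_Re_cmod.
  by rewrite -ImN -ImD; exact: ler_Im_cmod.
have e2 := divr_gt0 e0 (ltr0n R 2).
move/cvgrPdist_le/(_ _ e2) : (cR z) => h1; move/cvgrPdist_le/(_ _ e2) : (cI z) => h2.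
apply: filterS2 h1 h2 => z' h1 h2; apply: (le_trans (ler_cmod_ReIm _)).
by rewrite ReD ImD ReN ImN (splitr e) lerD.
Qed.

Lemma ccont_cst (c : R[i]) : ccont (fun=> c).
Proof. by split; exact: ct_cst. Qed.

Lemma ccont_real (f : Z -> R) : continuous f -> ccont (fun z => (f z)%:C).
Proof. by move=> cf; split=> //; exact: ct_cst. Qed.

Lemma ccontD f g : ccont f -> ccont g -> ccont (fun z => f z + g z).
Proof.
move=> [fR fI] [gR gI]; split.
  by under eq_fun do rewrite ReD; exact: ctD.
by under eq_fun do rewrite ImD; exact: ctD.
Qed.

Lemma ccontM f g : ccont f -> ccont g -> ccont (fun z => f z * g z).
Proof.
move=> [fR fI] [gR gI]; split.
  by under eq_fun do rewrite ReM; apply: ctB; exact: ctM.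
by under eq_fun do rewrite ImM; apply: ctD; exact: ctM.
Qed.

Lemma ccontZ c f : ccont f -> ccont (fun z => c * f z).
Proof. by move=> cf; apply: ccontM => //; exact: ccont_cst. Qed.

Lemma ccontN f : ccont f -> ccont (fun z => - f z).
Proof. by move=> cf; under eq_fun do rewrite -mulN1r; exact: ccontZ. Qed.

Lemma ccontB f g : ccont f -> ccont g -> ccont (fun z => f z - g z).
Proof. by move=> cf cg; apply: ccontD => //; exact: ccontN. Qed.

Lemma ccontJ f : ccont f -> ccont (fun z => (f z)^*).
Proof.
move=> [fR fI]; split.
  by rewrite (_ : (fun _ => _) = fun z => Re (f z))//; apply/funext => z; case: (f z).
rewrite (_ : (fun _ => _) = fun z => - Im (f z)); first exact: ctN.
by apply/funext => z; case: (f z).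
Qed.

Lemma ccont_sum (I : Type) (s : seq I) (P : pred I) (F : I -> Z -> R[i]) :
  (forall i, ccont (F i)) -> ccont (fun z => \sum_(i <- s | P i) F i z).
Proof.
move=> cF; split.
  by under eq_fun do rewrite Re_sum; apply: ct_sum => i; have [] := cF i.
by under eq_fun do rewrite Im_sum; apply: ct_sum => i; have [] := cF i.
Qed.

Lemma ccont_cexp f : ccont f -> ccont (fun z => cexp (f z)).
Proof.
move=> [fR fI]; apply: ccontM; first by apply: ccont_real; apply: ct_comp => //; exact: continuous_expR.
split; first by apply: (ct_comp fI); exact: continuous_cos.
by apply: (ct_comp fI); exact: continuous_sin.
Qed.

Lemma ccont_cmod f : ccont f -> continuous (fun z => cmod (f z)).
Proof.
move=> /ccontP cf z; apply/cvgrPdist_le => e e0; apply: filterS (cf z e e0) => z'.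
apply: le_trans; rewrite ler_norml; apply/andP; split.
  rewrite lerNl opprB lerBlDr cmodBC -[in leLHS](subrK (f z) (f z')).
  exact: ler_cmodD.
by rewrite lerBlDr -[in leLHS](subrK (f z') (f z)); exact: ler_cmodD.
Qed.

Lemma ccont_uniform_limit f :
  (forall (z : Z) (e : R), 0 < e -> exists g, ccont g /\
    \forall z' \near z, cmod (f z' - g z') <= e) -> ccont f.
Proof.
move=> h; apply/ccontP => z e e0.
have e3 : 0 < e / 3 by rewrite divr_gt0.
have [g [/ccontP cg fg]] := h z _ e3.
have fz := nbhs_singleton fg.
apply: filterS2 (cg z _ e3) fg => z' gz fz'.
rewrite (_ : _ - _ = (f z - g z) + (g z - g z') - (f z' - g z')); last by ring.
apply: (le_trans (ler_cmodB _ _)); have := ler_cmodD (f z - g z) (g z - g z').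
by move: fz gz fz'; lra.
Qed.

End ComplexContinuity.

Lemma ccont_comp (R : realType) (Z W : topologicalType) (f : W -> R[i]) (g : Z -> W) :
  continuous g -> ccont f -> ccont (fun z => f (g z)).
Proof. by move=> cg [fR fI]; split; [exact: (ct_comp cg fR)|exact: (ct_comp cg fI)]. Qed.

Section Average.
Context {R : realType} (n : nat) (a : R).
Hypothesis a0 : 0 < a.
Local Notation V := 'rV[R]_n.
Local Notation Re := complex.Re.
Local Notation Im := complex.Im.
Implicit Types (f g : V -> R[i]) (h : V -> R).

Definition ravg h : R := a ^- n * bint 0 a h.

Definition avg f : R[i] := ravg (fun x => Re (f x)) +i* ravg (fun x => Im (f x)).

Definition fdomain : set V := bounds 0 a.

Lemma fdomainP x : fdomain x <-> forall i, 0 <= x ord0 i <= a.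
Proof. by split=> h i; have := h i; rewrite mxE add0r. Qed.

Lemma compact_fdomain : compact fdomain. Proof. exact: compact_bounds. Qed.

Let a0' : 0 <= a := ltW a0.

Let an0 : 0 <= a ^- n. Proof. by rewrite invr_ge0 exprn_ge0. Qed.

Lemma ravg_cst c : ravg (fun=> c) = c.
Proof. by rewrite /ravg bint_cst// mulrCA mulVf ?mulr1// expf_neq0// gt_eqF. Qed.

Lemma ravgD h h' : continuous h -> continuous h' ->
  ravg (fun x => h x + h' x) = ravg h + ravg h'.
Proof. by move=> ch ch'; rewrite /ravg bintD// mulrDr. Qed.

Lemma ravgZ c h : continuous h -> ravg (fun x => c * h x) = c * ravg h.
Proof. by move=> ch; rewrite /ravg bintZ// mulrCA. Qed.

Lemma ravgB h h' : continuous h -> continuous h' ->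
  ravg (fun x => h x - h' x) = ravg h - ravg h'.
Proof.
move=> ch ch'; rewrite -[- ravg h']mulN1r -ravgZ// -ravgD//.
  by congr ravg; apply/funext => x; rewrite mulN1r.
by apply: ctM => //; exact: ct_cst.
Qed.

Lemma ler_ravg h h' : continuous h -> continuous h' ->
  (forall x, fdomain x -> h x <= h' x) -> ravg h <= ravg h'.
Proof. by move=> ch ch' hh'; rewrite ler_wpM2l//; exact: ler_bint. Qed.

Lemma ler_norm_ravg h h' : continuous h -> continuous h' ->
  (forall x, fdomain x -> `|h x| <= h' x) -> `|ravg h| <= ravg h'.
Proof.
by move=> ch ch' hh'; rewrite normrM ger0_norm// ler_wpM2l//; exact: ler_norm_bint.
Qed.

Lemma eq_avg f g : (forall x, fdomain x -> f x = g x) -> avg f = avg g.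
Proof.
move=> fg; rewrite /avg /ravg; congr Complex; congr (_ * _);
  by apply: eq_bint => x; rewrite inE => /fg ->.
Qed.

Lemma avg_cst c : avg (fun=> c) = c.
Proof. by rewrite /avg !ravg_cst; case: c. Qed.

Lemma avg_real h : avg (fun x => (h x)%:C) = (ravg h)%:C.
Proof. by rewrite /avg/= ravg_cst. Qed.

Lemma avgD f g : ccont f -> ccont g -> avg (fun x => f x + g x) = avg f + avg g.
Proof.
move=> [fR fI] [gR gI]; rewrite /avg.
under eq_fun do rewrite ReD; under [in X in _ +i* X]eq_fun do rewrite ImD.
by rewrite !ravgD.
Qed.

Lemma avgZ c f : ccont f -> avg (fun x => c * f x) = c * avg f.
Proof.
move=> [fR fI]; rewrite /avg.
under eq_fun do rewrite ReM; under [in X in _ +i* X]eq_fun do rewrite ImM.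
have cM (e : R) h : continuous h -> continuous (fun x => e * h x).
  by move=> ch; apply: ctM => //; exact: ct_cst.
rewrite ravgB ?ravgD//; do ?exact: cM.
by rewrite !ravgZ//; case: c => c d /=; simpc; congr (_ +i* _); ring.
Qed.

Lemma avgB f g : ccont f -> ccont g -> avg (fun x => f x - g x) = avg f - avg g.
Proof.
move=> cf cg; under eq_fun do rewrite -mulN1r.
by rewrite avgD ?avgZ ?mulN1r//; exact: ccontZ.
Qed.

Lemma avg_sum (I : Type) (s : seq I) (F : I -> V -> R[i]) :
  (forall i, ccont (F i)) ->
  avg (fun x => \sum_(i <- s) F i x) = \sum_(i <- s) avg (F i).
Proof.
move=> cF; elim: s => [|i s IH].
  by rewrite big_nil -[RHS]avg_cst; congr avg; apply/funext => x; rewrite big_nil.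
rewrite big_cons -IH -avgD//; last exact: ccont_sum.
by congr avg; apply/funext => x; rewrite big_cons.
Qed.

Lemma avgJ f : ccont f -> avg (fun x => (f x)^*) = (avg f)^*.
Proof.
move=> [fR fI]; rewrite /avg/=.
rewrite -mulN1r -ravgZ//; congr (ravg _ +i* ravg _); apply/funext => x;
  by case: (f x) => b c //=; rewrite mulN1r.
Qed.

(** Real and imaginary parts are estimated separately. This factor 2 is the one that reappears in
    the bounds on Fourier coefficients and on Toeplitz entries. *)
Lemma ler_cmod_avg f h : ccont f -> continuous h ->
  (forall x, fdomain x -> cmod (f x) <= h x) -> cmod (avg f) <= 2 * ravg h.
Proof.
move=> [fR fI] ch fh; apply: (le_trans (ler_cmod_ReIm _)); rewrite /=.
rewrite mulr_natl mulr2n lerD//; apply: ler_norm_ravg => // x /fh; apply: le_trans.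
  exact: ler_Re_cmod.
exact: ler_Im_cmod.
Qed.

Lemma ler_cmod_avg_cst f (M : R) : ccont f ->
  (forall x, fdomain x -> cmod (f x) <= M) -> cmod (avg f) <= 2 * M.
Proof.
move=> cf fM; rewrite -(ravg_cst M); apply: ler_cmod_avg => //; exact: ct_cst.
Qed.

Lemma avg_shift f v : ccont f -> lattice_periodic a f ->
  avg (fun x => f (x + v)) = avg f.
Proof.
move=> [fR fI] pf; rewrite /avg /ravg; congr Complex; congr (_ * _).
  by apply: (bint_periodic v a0 fR) => m x; rewrite pf.
by apply: (bint_periodic v a0 fI) => m x; rewrite pf.
Qed.

(** Termwise averaging by the M-test. Domination and convergence are asked on the fundamental cube
    alone, where the theta functions and their terms are bounded by compactness. *)
Lemma has_sum_avg (I : choiceType) (F : I -> V -> R[i]) (s : V -> R[i]) w M :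
  sum_bounded w M -> (forall i, ccont (F i)) -> ccont s ->
  (forall x, fdomain x -> forall i, cmod (F i x) <= w i) ->
  (forall x, fdomain x -> has_sum (fun i => F i x) (s x)) ->
  has_sum (fun i => avg (F i)) (avg s).
Proof.
move=> wM cF cs Fw Fs e e0; have e2 := divr_gt0 e0 (ltr0n R 2).
have [A hA] := @has_sum_uniform R I {x : V | fdomain x}
  (fun x i => F i (sval x)) (fun x => s (sval x)) w M wM
  (fun x i => Fw _ (svalP x) i) (fun x => Fs _ (svalP x)) _ e2.
exists A => B AB; rewrite -avg_sum// cmodBC -avgB//; last exact: ccont_sum.
have -> : e = 2 * (e / 2) by rewrite mulrCA mulfV ?mulr1.
apply: ler_cmod_avg_cst; first by apply: ccontB => //; exact: ccont_sum.
by move=> x Dx; exact: (hA B AB (exist _ x Dx)).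
Qed.

Lemma ccont_avg_param (W : topologicalType) (F : W * V -> R[i]) : ccont F ->
  ccont (fun w => avg (fun x => F (w, x))).
Proof.
move=> [FR FI]; split; rewrite /avg/= /ravg.
  by apply: ctM; [exact: ct_cst|exact: (@continuous_bint_param _ _ _ 0 a (fun z => Re (F z)) a0' FR)].
by apply: ctM; [exact: ct_cst|exact: (@continuous_bint_param _ _ _ 0 a (fun z => Im (F z)) a0' FI)].
Qed.

Lemma ccont_bounded f : ccont f ->
  exists2 M : R, 0 <= M & forall x, fdomain x -> cmod (f x) <= M.
Proof.
move=> /ccont_cmod cf; have [M M0 hM] := continuous_bounded_on compact_fdomain cf.
by exists M => // x /hM; rewrite ger0_norm ?cmod_ge0.
Qed.

Lemma ravg_ge_box h (v : V) (b c : R) : continuous h -> (forall x, 0 <= h x) ->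
  0 <= b -> (forall x, bounds v b x -> fdomain x /\ c <= h x) ->
  a ^- n * (c * b ^+ n) <= ravg h.
Proof.
move=> ch h0 b0 hc; rewrite /ravg ler_wpM2l// -(bint_cst v _ b0).
apply: (@le_trans _ _ (bint v b h)).
  by apply: ler_bint => // [|x /hc[]//]; exact: ct_cst.
rewrite /bint /Rintegral fine_le//.
- by apply: integrable_fin_num; [exact: measurable_box|exact: (bint_integrable v b0 ch)].
- by apply: integrable_fin_num; [exact: measurable_box|exact: (bint_integrable 0 a0' ch)].
apply: ge0_subset_integral; [exact: measurable_box|exact: measurable_box| | |].
- by have [] := integrableP _ _ _ (bint_integrable 0 a0' ch).
- by move=> u _; rewrite lee_fin; exact: h0.
- by move=> u /vec_bounds /hc[hD _] i; have := hD i; rewrite !mxE.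
Qed.

End Average.

Section IntegralX.
Context {R : realType} (n : nat).
Local Notation V := 'rV[R]_n.
Local Notation T := (measurableTypeR R).
Local Notation Re := complex.Re.
Local Notation Im := complex.Im.

Lemma pi2_gt0 : 0 < 2 * pi :> R. Proof. by rewrite mulr_gt0// pi_gt0. Qed.

Lemma integral_TE (g : V -> R[i]) : integral_T g = avg (2 * pi) g.
Proof.
rewrite /integral_T /cintegral box_cube /avg /ravg /bint.
by simpc.
Qed.

(** The two vectors are glued into one row of length n + n, so that [measurable_row_comp]
    applies. *)
Lemma measurable_vec2 (g : V * V -> R) : continuous g ->
  measurable_fun setT (fun u : n.-tuple T * n.-tuple T => g (vec_of_tuple u.1, vec_of_tuple u.2)).
Proof.
move=> cg; pose phi (i : 'I_(n + n)) (u : n.-tuple T * n.-tuple T) : R :=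
  match fintype.split i with inl j => tnth u.1 j | inr j => tnth u.2 j end.
pose g' (z : 'rV[R]_(n + n)) := g (lsubmx z, rsubmx z).
have -> : (fun u : n.-tuple T * n.-tuple T => g (vec_of_tuple u.1, vec_of_tuple u.2)) =
    fun u => g' (\row_i phi i u).
  apply/funext => u; rewrite /g'; congr (g (_, _)); apply/rowP => j; rewrite !mxE /phi.
    by rewrite (unsplitK (inl j)).
  by rewrite (unsplitK (inr j)).
apply: measurable_row_comp.
  move=> i; rewrite /phi; case: fintype.split => j.
    by apply: (measurableT_comp (measurable_tnth j)); exact: measurable_fst.
  by apply: (measurableT_comp (measurable_tnth j)); exact: measurable_snd.
apply: ct_comp => //; apply: ct_pair; apply: continuous_row => i.
  rewrite (_ : (fun _ => _) = fun z : 'rV[R]_(n + n) => z ord0 (lshift n i)); first exact: coord_cont.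
  by apply/funext => z; rewrite mxE.
rewrite (_ : (fun _ => _) = fun z : 'rV[R]_(n + n) => z ord0 (rshift n i)); first exact: coord_cont.
by apply/funext => z; rewrite mxE.
Qed.

Lemma Rintegral_X (a b : R) (g : V * V -> R) : 0 <= a -> 0 <= b -> continuous g ->
  Rintegral (product_measure1 (lebesgue_tuple R n) (lebesgue_tuple R n))
    (cube a `*` cube b) (fun u => g (vec_of_tuple u.1, vec_of_tuple u.2)) =
  bint 0 a (fun x => bint 0 b (fun t => g (x, t))).
Proof.
move=> a0 b0 cg; rewrite !box_cube.
have mA := measurable_box (0 : V) a; have mB := measurable_box (0 : V) b.
rewrite Rintegral_setX//.
- apply: measurable_bounded_integrable.
  + exact: measurableX.
  + rewrite [X in (X < _)%E](_ : _ = (a ^+ n * b ^+ n)%:E) ?ltry//.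
    rewrite [LHS](product_measure1E (lebesgue_tuple R n) (lebesgue_tuple R n) mA mB).
    exact: (congr2 mule (lebesgue_tuple_box 0 a0) (lebesgue_tuple_box 0 b0)).
  + by apply: measurable_funS (measurable_vec2 cg); [exact: measurableT|exact: subsetT].
  + have cK : compact (bounds (0 : V) a `*` bounds (0 : V) b).
      by apply: compact_setX; exact: compact_bounds.
    have [M M0 hM] := continuous_bounded_on cK cg.
    exists M; split; first exact: num_real.
    move=> N MN u [/vec_bounds h1 /vec_bounds h2] /=.
    have Bu : (bounds (0 : V) a `*` bounds (0 : V) b) (vec_of_tuple u.1, vec_of_tuple u.2).
      by split.
    exact: le_trans (hM _ Bu) (ltW MN).
- move=> u _; apply: (@bint_integrable R n 0 b (fun t => g (vec_of_tuple u, t)) b0).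
  by apply: ct_comp cg; apply: ct_pair; [exact: ct_const|exact: ct_id].
Qed.

Lemma integral_XE (g : V * V -> R[i]) : ccont g ->
  integral_X g = ((2 * pi) ^+ n)%:C * avg 1 (fun x => avg (2 * pi) (fun t => g (x, t))).
Proof.
move=> [gR gI]; rewrite /integral_X /cintegral.
rewrite (@Rintegral_X _ _ (fun z => Re (g z)))//; last exact/ltW/pi2_gt0.
rewrite (@Rintegral_X _ _ (fun z => Im (g z)))//; last exact/ltW/pi2_gt0.
rewrite /avg /ravg/= expr1n invr1 !mul1r.
have c0 : (2 * pi) ^+ n != 0 :> R by rewrite expf_neq0// gt_eqF// pi2_gt0.
have cb h : continuous h -> continuous (fun x : V => bint 0 (2 * pi) (fun t : V => h (x, t))).
  by move=> ch; apply: continuous_bint_param => //; exact/ltW/pi2_gt0.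
rewrite (bintZ 0 ((2 * pi) ^- n) ler01 (cb _ gR)) (bintZ 0 ((2 * pi) ^- n) ler01 (cb _ gI)).
have cM (c a b : R) : c != 0 -> a +i* b = c%:C * ((c^-1 * a) +i* (c^-1 * b)).
  by move=> cn0; simpc; rewrite !mulrA mulfV// !mul1r.
exact: cM.
Qed.

End IntegralX.

(** * Smooth functions *)

Section DirectionalDerivatives.
Context {R : realType}.
Local Notation Re := complex.Re.
Local Notation Im := complex.Im.

(** A quadratic bound on the remainder is stable under sums of series and averages; all termwise
    differentiations below rest on this criterion. *)
Lemma is_derive_quad (W : normedModType R) (f : W -> R) (p v : W) (d K e : R) :
  0 < e -> (forall t, `|t| <= e -> `|f (p + t *: v) - f p - t * d| <= K * t ^+ 2) ->
  is_derive p v f d.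
Proof.
move=> e0 hf.
have cf : h^-1 *: ((f \o shift p) (h *: v) - f p) @[h --> 0^'] --> d.
  apply/cvgrPdist_le => r r0.
  have K1 : 0 < `|K| + 1 by rewrite ltr_wpDl.
  near=> h.
  have h0 : h != 0 by near: h; exact: nbhs_dnbhs_neq.
  have he : `|h| <= e by near: h; exact: dnbhs0_le.
  have hr : `|h| <= r / (`|K| + 1) by near: h; apply: dnbhs0_le; rewrite divr_gt0.
  rewrite /=.
  rewrite (_ : d - _ = - (h^-1 * (f (p + h *: v) - f p - h * d))); last first.
    by rewrite [h *: v + p]addrC -[h^-1 *: _]/(h^-1 * _) -[X in X - _](mulKf h0 d); ring.
  rewrite normrN normrM normfV ler_pdivrMl ?normr_gt0//.
  apply: (le_trans (hf h he)); rewrite -(real_normK (num_real h)) expr2 mulrCA.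
  rewrite ler_wpM2l//; apply: (@le_trans _ _ ((`|K| + 1) * `|h|)).
    by rewrite ler_wpM2r// (le_trans (ler_norm K))// lerDl.
  by rewrite mulrC -ler_pdivlMr.
split; first by apply/cvg_ex; exists d.
exact: (@cvg_lim R^o).
Unshelve. all: by end_near.
Qed.

(** Brings directional derivatives to the real line, where the rules for functions of one variable
    are available. *)
Lemma is_derive_line (W : normedModType R) (f : W -> R) (p v : W) (d t : R) :
  is_derive (p + t *: v) v f d <-> is_derive t 1 (fun s => f (p + s *: v)) d.
Proof.
have e : (fun h => h^-1 *: ((f \o shift (p + t *: v)) (h *: v) - f (p + t *: v))) =
    (fun h => h^-1 *: (((fun s => f (p + s *: v)) \o shift t) (h *: (1 : R)) -
                       (fun s => f (p + s *: v)) t)).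
  apply/funext => h /=; congr (_ *: (f _ - _)).
  by rewrite scalerDl [h *: 1]mulr1 addrC -addrA [t *: v + _]addrC.
have dE : derivable f (p + t *: v) v = derivable (fun s : R => f (p + s *: v)) t 1.
  by rewrite /derivable e.
have DE : 'D_v f (p + t *: v) = 'D_1 (fun s : R => f (p + s *: v)) t by rewrite /derive e.
by split=> -[d1 d2]; split; [rewrite -dE|rewrite -DE|rewrite dE|rewrite DE].
Qed.

Lemma is_derive_line0 (W : normedModType R) (f : W -> R) (p v : W) (d : R) :
  is_derive p v f d <-> is_derive (0 : R) 1 (fun s => f (p + s *: v)) d.
Proof. by rewrite -is_derive_line scale0r addr0. Qed.

Definition is_cder (W : normedModType R) (s : W -> R[i]) (p v : W) (d : R[i]) : Prop :=
  is_derive p v (fun q => Re (s q)) (Re d) /\ is_derive p v (fun q => Im (s q)) (Im d).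

Context {W : normedModType R}.
Implicit Types (s t : W -> R[i]) (p v : W) (c d : R[i]).

Lemma is_cder_cderive s p v d : is_cder s p v d -> cderive s p v = d.
Proof. by move=> [[_ e1] [_ e2]]; rewrite /cderive e1 e2; case: d {e1 e2}. Qed.

Lemma is_cder_quad s p v d (K e : R) : 0 < e ->
  (forall h : R, `|h| <= e -> cmod (s (p + h *: v) - s p - h%:C * d) <= K * h ^+ 2) ->
  is_cder s p v d.
Proof.
move=> e0 hs; split; apply: (is_derive_quad e0) => h /hs; apply: le_trans.
  apply: le_trans (ler_Re_cmod _); rewrite !ReD !ReN ReM /=.
  by rewrite mul0r subr0.
apply: le_trans (ler_Im_cmod _); rewrite !ImD !ImN ImM /=.
by rewrite mul0r addr0.
Qed.

(** Settles linear and quadratic exponents at once, their expansion along a line being exact. *)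
Lemma is_cder_poly2 s p v d c :
  (forall h : R, s (p + h *: v) = s p + h%:C * d + (h ^+ 2)%:C * c) -> is_cder s p v d.
Proof.
move=> hs; apply: (@is_cder_quad _ _ _ _ (cmod c) 1) => // h _.
rewrite hs (_ : _ - _ - _ = (h ^+ 2)%:C * c); last by ring.
by rewrite cmodM cmod_real ger0_norm ?sqr_ge0// mulrC.
Qed.

Lemma is_cder_cst c p v : is_cder (fun=> c) p v 0.
Proof. by apply: (@is_cder_poly2 _ _ _ _ 0) => h; rewrite !mulr0 !addr0. Qed.

Lemma is_cderD s t p v d c : is_cder s p v d -> is_cder t p v c ->
  is_cder (fun q => s q + t q) p v (d + c).
Proof.
move=> [s1 s2] [t1 t2]; split.
  by under eq_fun do rewrite ReD; rewrite ReD; exact: is_deriveD.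
by under eq_fun do rewrite ImD; rewrite ImD; exact: is_deriveD.
Qed.

Lemma is_cderM s t p v d c : is_cder s p v d -> is_cder t p v c ->
  is_cder (fun q => s q * t q) p v (d * t p + s p * c).
Proof.
move=> [s1 s2] [t1 t2]; split.
  under eq_fun do rewrite ReM.
  by apply: is_derive_eq; rewrite ReD !ReM /GRing.scale/=; ring.
under eq_fun do rewrite ImM.
by apply: is_derive_eq; rewrite ImD !ImM /GRing.scale/=; ring.
Qed.

Lemma is_cderZ c s p v d : is_cder s p v d -> is_cder (fun q => c * s q) p v (c * d).
Proof.
by move=> sd; have := is_cderM (is_cder_cst c p v) sd; rewrite mul0r add0r.
Qed.

Lemma is_cder_eq s p v d c : is_cder s p v d -> d = c -> is_cder s p v c.
Proof. by move=> ? <-. Qed.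

Lemma is_cder_sum (I : Type) (r : seq I) (F : I -> W -> R[i]) (D : I -> R[i]) p v :
  (forall i, is_cder (F i) p v (D i)) ->
  is_cder (fun q => \sum_(i <- r) F i q) p v (\sum_(i <- r) D i).
Proof.
move=> FD; elim: r => [|i r IH].
  rewrite big_nil (_ : (fun _ => _) = fun=> 0); first exact: is_cder_cst.
  by apply/funext => q; rewrite big_nil.
rewrite big_cons (_ : (fun _ => _) = fun q => F i q + \sum_(j <- r) F j q).
  exact: is_cderD.
by apply/funext => q; rewrite big_cons.
Qed.

Lemma is_cder_cexp s p v d : is_cder s p v d ->
  is_cder (fun q => cexp (s q)) p v (d * cexp (s p)).
Proof.
move=> [/is_derive_line0 s1 /is_derive_line0 s2].
rewrite /cexp; split; apply/is_derive_line0.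
  rewrite (_ : (fun _ => _) = fun h => expR (Re (s (p + h *: v))) * cos (Im (s (p + h *: v)))).
    by apply: is_derive_eq; rewrite scale0r addr0 !ReM ImM /GRing.scale/=; ring.
  by apply/funext => h; rewrite ReM /= mul0r subr0.
rewrite (_ : (fun _ => _) = fun h => expR (Re (s (p + h *: v))) * sin (Im (s (p + h *: v)))).
  by apply: is_derive_eq; rewrite scale0r addr0 !(ReM, ImM) /GRing.scale/=; ring.
by apply/funext => h; rewrite ImM /= mul0r addr0.
Qed.

End DirectionalDerivatives.

Section Smooth.
Context {R : realType} {W : normedModType R}.
Implicit Types (f g : W -> R) (s t : W -> R[i]).
Local Notation Re := complex.Re.
Local Notation Im := complex.Im.

Lemma CmW m f : Cm m.+1 f -> Cm m f.
Proof.
elim: m f => [|m IH] f [cf df]; first by split.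
split=> // v; have [dfv Cf] := df v; split=> //; exact: IH.
Qed.

Lemma Cm_derive m f (D : W -> W -> R) :
  continuous f -> (forall p v, is_derive p v f (D v p)) ->
  (forall v, Cm m (D v)) -> Cm m.+1 f.
Proof.
move=> cf df CD; split=> // v; split=> [p|]; first by have [] := df p v.
rewrite (_ : (fun p => 'D_v f p) = D v); first exact: CD.
by apply/funext => p; have [] := df p v.
Qed.

Lemma CmS m f : Cm m.+1 f -> continuous f /\
  (forall p v, is_derive p v f ('D_v f p)) /\ forall v, Cm m (fun p => 'D_v f p).
Proof.
move=> [cf df]; split=> //; split=> [p v|v]; last by have [] := df v.
by apply: derivableP; have [] := df v.
Qed.

Lemma Cm_cst m (c : R) : Cm m (fun _ : W => c).
Proof.
elim: m c => [|m IH] c; first by split=> //; exact: ct_cst.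
apply: (@Cm_derive _ _ (fun v p => 0)) => [|v].
- exact: ct_cst.
- exact: IH.
Qed.

Lemma CmD m f g : Cm m f -> Cm m g -> Cm m (fun p => f p + g p).
Proof.
elim: m f g => [|m IH] f g; first by move=> [cf _] [cg _]; split=> //; exact: ctD.
move=> /CmS[cf [df Cf]] /CmS[cg [dg Cg]].
apply: (@Cm_derive _ _ (fun v p => 'D_v f p + 'D_v g p)) => [|v].
- exact: ctD.
- exact: IH.
Qed.

Lemma CmM m f g : Cm m f -> Cm m g -> Cm m (fun p => f p * g p).
Proof.
elim: m f g => [|m IH] f g; first by move=> [cf _] [cg _]; split=> //; exact: ctM.
move=> Hf Hg; have /CmS[cf [df Cf]] := Hf; have /CmS[cg [dg Cg]] := Hg.
apply: (@Cm_derive _ _ (fun v p => f p * 'D_v g p + g p * 'D_v f p)) => [|v].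
- exact: ctM.
- by apply: CmD; apply: IH => //; exact: CmW.
Qed.

Lemma CmN m f : Cm m f -> Cm m (fun p => - f p).
Proof.
move=> Cf; have := CmM (Cm_cst m (-1)) Cf.
by rewrite (_ : (fun p => -1 * f p) = (fun p => - f p))//; apply/funext => p; rewrite mulN1r.
Qed.

Definition cCm m s := Cm m (fun p => Re (s p)) /\ Cm m (fun p => Im (s p)).

Lemma cCm_ccont m s : cCm m s -> ccont s.
Proof. by case: m => [|m] [[? ?] [? ?]]; split. Qed.

Lemma cCm_cst m (c : R[i]) : cCm m (fun _ : W => c).
Proof. by split; exact: Cm_cst. Qed.

Lemma cCmD m s t : cCm m s -> cCm m t -> cCm m (fun p => s p + t p).
Proof.
move=> [s1 s2] [t1 t2]; split.
  by under eq_fun do rewrite ReD; exact: CmD.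
by under eq_fun do rewrite ImD; exact: CmD.
Qed.

Lemma cCmM m s t : cCm m s -> cCm m t -> cCm m (fun p => s p * t p).
Proof.
move=> [s1 s2] [t1 t2]; split.
  by under eq_fun do rewrite ReM; apply: CmD; [|apply: CmN]; exact: CmM.
by under eq_fun do rewrite ImM; apply: CmD; exact: CmM.
Qed.

Lemma cCmZ m (c : R[i]) s : cCm m s -> cCm m (fun p => c * s p).
Proof. by move=> sm; apply: cCmM => //; exact: cCm_cst. Qed.

Lemma cCm_sum m (I : Type) (r : seq I) (F : I -> W -> R[i]) :
  (forall i, cCm m (F i)) -> cCm m (fun p => \sum_(i <- r) F i p).
Proof.
move=> CF; elim: r => [|i r IH].
  rewrite (_ : (fun _ => _) = fun=> 0); first exact: cCm_cst.
  by apply/funext => q; rewrite big_nil.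
rewrite (_ : (fun _ => _) = fun q => F i q + \sum_(j <- r) F j q).
  exact: cCmD.
by apply/funext => q; rewrite big_cons.
Qed.

Lemma cCm_der m s (D : W -> W -> R[i]) :
  ccont s -> (forall p v, is_cder s p v (D v p)) ->
  (forall v, cCm m (D v)) -> cCm m.+1 s.
Proof.
move=> [c1 c2] ds CD; split.
  apply: (@Cm_derive _ _ (fun v p => Re (D v p))) => // [p v|v].
    by have [] := ds p v.
  by have [] := CD v.
apply: (@Cm_derive _ _ (fun v p => Im (D v p))) => // [p v|v].
  by have [] := ds p v.
by have [] := CD v.
Qed.

Lemma cCm_cder m s : cCm m.+1 s -> forall p v, is_cder s p v (cderive s p v).
Proof.
by move=> [/CmS[_ [d1 _]] /CmS[_ [d2 _]]] p v; split; [exact: d1|exact: d2].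
Qed.

Lemma cCm_cderive m s v : cCm m.+1 s -> cCm m (fun p => cderive s p v).
Proof. by move=> [/CmS[_ [_ d1]] /CmS[_ [_ d2]]]; split; [exact: d1|exact: d2]. Qed.

Lemma smoothP s : smooth s <-> forall m, cCm m s.
Proof. by []. Qed.

Lemma smooth_ccont s : smooth s -> ccont s.
Proof. by move=> /(_ 0%N)/(@cCm_ccont 0 s). Qed.

Lemma smooth_cder s : smooth s -> forall p v, is_cder s p v (cderive s p v).
Proof. by move=> /(_ 1%N)/(@cCm_cder 0 s). Qed.

Lemma smooth_cderive s v : smooth s -> smooth (fun p => cderive s p v).
Proof. by move=> ss m; apply: cCm_cderive; exact: ss. Qed.

Lemma smoothD s t : smooth s -> smooth t -> smooth (fun p => s p + t p).
Proof. by move=> ss st m; exact: cCmD. Qed.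

Lemma smoothM s t : smooth s -> smooth t -> smooth (fun p => s p * t p).
Proof. by move=> ss st m; exact: cCmM. Qed.

Lemma smoothZ (c : R[i]) s : smooth s -> smooth (fun p => c * s p).
Proof. by move=> ss m; exact: cCmZ. Qed.

Lemma smooth_sum (I : Type) (r : seq I) (F : I -> W -> R[i]) :
  (forall i, smooth (F i)) -> smooth (fun p => \sum_(i <- r) F i p).
Proof. by move=> CF m; apply: cCm_sum => i; exact: CF. Qed.

(** The second derivative along v is bounded on the compact set of all p + h v with p in K and |h|
    <= 1. The resulting remainder is uniform over K, as differentiation under an average
    requires. *)
Lemma smooth_taylor2 s (K : set W) (v : W) : smooth s -> compact K ->
  exists2 M : R, 0 <= M & forall p (h : R), K p -> `|h| <= 1 ->
    cmod (s (p + h *: v) - s p - h%:C * cderive s p v) <= M * h ^+ 2.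
Proof.
move=> ss cK.
pose s2 q := cderive (fun p => cderive s p v) q v.
have cs2 : continuous (fun z : W * R => cmod (s2 (z.1 + z.2 *: v))).
  apply: ccont_cmod; apply: (@ccont_comp _ _ _ s2 (fun z : W * R => z.1 + z.2 *: v)).
    apply: ctDV; first exact: ct_fst.
    by apply: ctZV; [exact: ct_snd|exact: ct_const].
  by apply: smooth_ccont; do 2!apply: smooth_cderive.
have cKI : compact (K `*` `[-1, 1]%classic : set (W * R)).
  by apply: compact_setX => //; exact: segment_compact.
have [M M0 hM] := continuous_bounded_on cKI cs2.
exists (2 * M); first by rewrite mulr_ge0.
move=> p h Kp h1.
have b (t : R) : `|t| <= `|h| -> cmod (s2 (p + t *: v)) <= M.
  move=> th; have /hM : (K `*` `[-1, 1]%classic) (p, t).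
    by split=> //=; rewrite in_itv/= -ler_norml (le_trans th).
  by rewrite ger0_norm// cmod_ge0.
have d1 (t : R) : is_cder s (p + t *: v) v (cderive s (p + t *: v) v) by exact: smooth_cder.
have d2 (t : R) : is_cder (fun p => cderive s p v) (p + t *: v) v (s2 (p + t *: v)).
  by apply: smooth_cder; exact: smooth_cderive.
have hR := ler_norm_taylor2 (fun t : R => (is_derive_line _ _ _ _ _).1 (d1 t).1)
  (fun t : R => (is_derive_line _ _ _ _ _).1 (d2 t).1)
  (fun u th => le_trans (ler_Re_cmod _) (b u th)).
have hI := ler_norm_taylor2 (fun t : R => (is_derive_line _ _ _ _ _).1 (d1 t).2)
  (fun t : R => (is_derive_line _ _ _ _ _).1 (d2 t).2)
  (fun u th => le_trans (ler_Im_cmod _) (b u th)).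
apply: (le_trans (ler_cmod_ReIm _)); move: hR hI.
rewrite !ReD !ReN ReM !ImD !ImN ImM /= scale0r addr0 mul0r subr0 mul0r addr0.
rewrite real_normK ?num_real// => hR hI.
by apply: (le_trans (lerD hR hI)); rewrite -mulrA mulr_natl mulr2n.
Qed.

End Smooth.

(** * Exponential series *)

Section LatticeWeight.
Context {R : realType} (n : nat).
Implicit Types l : 'rV[int]_n.

Definition lat1 l : R := \sum_i `|(l ord0 i)%:~R|.

(** A product, so that its sum over a cube of lattice points is the n-th power of a sum over
    integers. Its inverse is the symbol of the product over i of the operators 1 - d^2/dtheta_i^2,
    which is where the decay of Fourier coefficients comes from. *)
Definition wt l : R := \prod_i (1 + (l ord0 i)%:~R ^+ 2)^-1.

Lemma lat1_ge0 l : 0 <= lat1 l.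
Proof. by apply: sumr_ge0. Qed.

Lemma wt_ge0 l : 0 <= wt l.
Proof. by apply: prodr_ge0 => i _; rewrite invr_ge0 addr_ge0// sqr_ge0. Qed.

(** A telescoping argument: for d = 0 the sum of the first N + 1 terms is at most 3 - 2 / (N + 1),
    with equality at N = 0. The offset d is 1 on the negative and 0 on the nonnegative half-line. *)
Lemma sum_inv_sqr (N : nat) (d : nat) :
  \sum_(0 <= j < N) (1 + (j + d)%:R ^+ 2)^-1 <= 3 :> R.
Proof.
apply: (@le_trans _ _ (\sum_(0 <= j < N) (1 + j%:R ^+ 2)^-1)).
  apply: ler_sum => j _; rewrite lef_pV2 ?posrE ?ltr_wpDr ?sqr_ge0//.
  by rewrite lerD2l lerXn2r ?nnegrE// ler_nat leq_addr.
case: N => [|N]; first by rewrite big_geq.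
suff : \sum_(0 <= j < N.+1) (1 + j%:R ^+ 2)^-1 <= 3 - 2 / N.+1%:R :> R.
  by move/le_trans; apply; rewrite gerBl divr_ge0.
elim: N => [|N IH]; first by rewrite big_nat1 expr0n addr0; lra.
rewrite big_nat_recr//=; apply: le_trans (lerD IH (lexx _)) _.
have x1 : 1 <= N.+1%:R :> R by rewrite ler1n.
rewrite -[N.+2]addn1 natrD; move: (N.+1%:R) x1 => x x1.
have x0 : 0 < x by lra.
rewrite -subr_ge0 (_ : _ - _ = (x ^+ 2 - x + 2) / ((1 + x ^+ 2) * x * (x + 1))).
  have x2 : 0 <= x ^+ 2 by exact: sqr_ge0.
  by rewrite divr_ge0 ?mulr_ge0//; nra.
by field; rewrite !gt_eqF//; first nra; lra.
Qed.

Lemma sum_bounded_wt : sum_bounded wt (6 ^+ n).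
Proof.
move=> A; have [N hN] := zbox_cofinal A.
apply: (@le_trans _ _ (\sum_(r <- zbox n (centered N)) wt r)).
  pose Z := [fset r in zbox n (centered N)]%fset.
  rewrite (_ : \sum_(r <- zbox n (centered N)) wt r = \sum_(r <- Z) wt r).
    apply: ler_sum_fsub; first exact: wt_ge0.
    by apply/fsubsetP => r /(hN N (leqnn _)); rewrite !inE.
  apply: perm_big; apply: uniq_perm; last by move=> r; rewrite !inE.
    exact/zbox_uniq/centered_uniq.
  exact: fset_uniq.
rewrite (sum_zbox_prod _ _ (fun z => (1 + z%:~R ^+ 2)^-1)).
rewrite lerXn2r ?nnegrE ?sumr_ge0// => [z _|]; first by rewrite invr_ge0 addr_ge0// sqr_ge0.
rewrite /centered big_map iotaD big_cat/= add0n.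
(* One 3 for the negative integers, one for the others. *)
rewrite (_ : 6 = 3 + 3); last by ring.
apply: lerD.
  have := sum_inv_sqr N 1; apply: le_trans.
  rewrite -[X in iota 0 X]subn0 -/(index_iota 0 N) big_nat_rev/= big_nat [leRHS]big_nat.
  apply: ler_sum => j /andP[_ jN]; rewrite add0n.
  suff -> : (Posz (N - j.+1) - Posz N)%:~R = - (j + 1)%:R :> R by rewrite sqrrN.
  by rewrite pmulrn -mulrNz; congr (_%:~R); lia.
have := sum_inv_sqr N 0; apply: le_trans.
rewrite -[X in iota N X](addnK N N) -/(index_iota N (N + N)).
rewrite -{1}[N]add0n big_addn addnK.
apply: ler_sum => j _; rewrite addn0.
by rewrite (_ : (Posz (j + N) - Posz N)%:~R = j%:R :> R)// pmulrn; congr (_%:~R); lia.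
Qed.

Lemma expR_ge_sqr (t : R) : 0 <= t -> 1 + t ^+ 2 <= 4 * expR t.
Proof.
move=> t0; rewrite (_ : t = t / 2 + t / 2); last by rewrite -splitr.
rewrite expRD; have := expR_ge1Dx (t / 2); set u := t / 2.
have u0 : 0 <= u by rewrite divr_ge0.
by move: (expR u) => e he; nra.
Qed.

Lemma expRN_lat1_wt l : expR (- lat1 l) <= 4 ^+ n * wt l.
Proof.
rewrite /lat1 -sumrN.
rewrite (big_morph (@expR R) (@expRD R) (@expR0 R)).
rewrite (_ : 4 ^+ n * wt l = \prod_(i < n) (4 * (1 + (l ord0 i)%:~R ^+ 2)^-1)); last first.
  by rewrite big_split/= prodr_const card_ord.
apply: ler_prod => i _; rewrite expR_ge0/= expRN.
have x0 : 0 <= `|(l ord0 i)%:~R| :> R by [].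
rewrite -(real_normK (num_real (l ord0 i)%:~R)).
move: (`|_|) x0 (expR_ge_sqr x0) => x x0 hx.
by rewrite ler_pdivlMr ?ltr_wpDr ?sqr_ge0// mulrC ler_pdivrMr ?expR_gt0.
Qed.

End LatticeWeight.
Arguments lat1 {R n} l.
Arguments wt R {n} l.

Section ExponentialSeries.
Context {R : realType} (n : nat) (W : normedModType R).
Variables (lam : 'rV[int]_n -> W -> R[i]) (K : R).
Hypothesis K0 : 0 <= K.
Hypothesis lamD : forall l p (h : R) v, lam l (p + h *: v) = lam l p + h%:C * lam l v.
Hypothesis lam_le : forall l p, cmod (lam l p) <= K * lat1 l * `|p|.
Implicit Types (c : 'rV[int]_n -> R[i]) (l : 'rV[int]_n) (p v : W).

(** The exponents [lam l p] have real parts of order |l|, whence the demand of decay beyond every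
    exponential. This class is stable under multiplication by [lam l v], so that the derivative of a
    series is a series of the same kind. *)
Definition rapid c := forall r : R, exists C : R, forall l, cmod (c l) * expR (r * lat1 l) <= C.

Definition exp_series c p : R[i] := csum (fun l => c l * cexp (lam l p)).

Lemma rapid_ge0 c r C : (forall l, cmod (c l) * expR (r * lat1 l) <= C) -> 0 <= C.
Proof. by move=> /(_ 0); apply: le_trans; rewrite mulr_ge0 ?cmod_ge0 ?expR_ge0. Qed.

Lemma rapid_mul c (d : 'rV[int]_n -> R[i]) (A B : R) : rapid c ->
  (forall l, cmod (d l) <= A * expR (B * lat1 l)) -> rapid (fun l => c l * d l).
Proof.
move=> rc dA r; have [C hC] := rc (r + B); exists (C * A) => l.
have A0 : 0 <= A.
  by have := le_trans (cmod_ge0 _) (dA 0); rewrite pmulr_lge0 ?expR_gt0.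
rewrite cmodM; apply: (@le_trans _ _ (cmod (c l) * (A * expR (B * lat1 l)) * expR (r * lat1 l))).
  by rewrite ler_wpM2r ?expR_ge0// ler_wpM2l ?cmod_ge0.
rewrite (_ : _ * _ * _ = cmod (c l) * expR ((r + B) * lat1 l) * A); last first.
  by rewrite mulrDl expRD; ring.
by rewrite ler_wpM2r.
Qed.

Lemma rapid_wt c (rho : R) : rapid c -> exists2 C : R, 0 <= C &
  forall l, cmod (c l) * expR (rho * lat1 l) <= C * wt R l.
Proof.
move=> rc; have [C hC] := rc (rho + 1).
have C0 := rapid_ge0 hC; exists (C * 4 ^+ n); first by rewrite mulr_ge0// exprn_ge0.
move=> l; rewrite -mulrA.
apply: le_trans (ler_wpM2l C0 (expRN_lat1_wt l)).
apply: le_trans (ler_wpM2r (expR_ge0 _) (hC l)).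
by rewrite -mulrA -expRD mulrDl mul1r addrK.
Qed.

Lemma cmod_cexp_le (z : R[i]) : cmod (cexp z) <= expR (cmod z).
Proof.
by rewrite cmod_cexp ler_expR (le_trans (ler_norm _))// ler_Re_cmod.
Qed.

Lemma exp_series_term_le c (rho : R) : rapid c -> exists2 C : R, 0 <= C &
  forall p, `|p| <= rho -> forall l, cmod (c l * cexp (lam l p)) <= C * wt R l.
Proof.
move=> /(rapid_wt (K * rho))[C C0 hC]; exists C => // p prho l.
apply: le_trans (hC l); rewrite cmodM ler_wpM2l ?cmod_ge0//.
apply: (le_trans (cmod_cexp_le _)); rewrite ler_expR (le_trans (lam_le l p))//.
by rewrite mulrAC ler_wpM2r ?lat1_ge0// ler_wpM2l.
Qed.

Lemma sum_bounded_scale (w : 'rV[int]_n -> R) M (C : R) : 0 <= C ->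
  sum_bounded w M -> sum_bounded (fun l => C * w l) (C * M).
Proof. by move=> C0 wM A; rewrite -mulr_sumr ler_wpM2l. Qed.

Lemma sum_bounded_le (w w' : 'rV[int]_n -> R) M : (forall l, w l <= w' l) ->
  sum_bounded w' M -> sum_bounded w M.
Proof. by move=> ww' wM A; apply: le_trans (wM A); exact: ler_sum. Qed.

Lemma exp_series_has_sum c p : rapid c -> has_sum (fun l => c l * cexp (lam l p)) (exp_series c p).
Proof.
move=> /(exp_series_term_le `|p|)[C C0 hC].
apply: (@csumP _ _ _ (C * 6 ^+ n)).
exact: sum_bounded_le (hC p (lexx _)) (sum_bounded_scale C0 (@sum_bounded_wt R n)).
Qed.

Lemma nbhs_dist_le p (e : R) : 0 < e -> \forall p' \near p, `|p - p'| <= e.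
Proof.
move=> e0; apply/nbhs_ballP; exists e => // q.
by rewrite -ball_normE => /ltW.
Qed.

Lemma lam_ccont l : ccont (lam l).
Proof.
apply/ccontP => p e e0; have L1 : 0 < K * lat1 l + 1.
  by rewrite ltr_wpDl// mulr_ge0// lat1_ge0.
near=> p'; have -> : p' = p + 1 *: (p' - p) by rewrite scale1r addrC subrK.
rewrite lamD opprD addrA subrr sub0r cmodN cmodM cmod_real normr1 mul1r.
apply: (le_trans (lam_le _ _)).
apply: (@le_trans _ _ ((K * lat1 l + 1) * `|p' - p|)).
  by rewrite ler_wpM2r// lerDl.
rewrite mulrC -ler_pdivlMr// distrC; near: p'.
by apply: nbhs_dist_le; rewrite divr_gt0.
Unshelve. all: by end_near.
Qed.

Lemma exp_series_ccont c : rapid c -> ccont (exp_series c).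
Proof.
move=> rc; apply: ccont_uniform_limit => p e e0.
have [C C0 hC] := exp_series_term_le (`|p| + 1) rc.
have [A hA] := @has_sum_uniform R _ {p' : W | `|p'| <= `|p| + 1}
  (fun (q : {p' : W | `|p'| <= `|p| + 1}) l => c l * cexp (lam l (sval q))) (fun q => exp_series c (sval q)) _ _
  (sum_bounded_scale C0 (@sum_bounded_wt R n)) (fun q l => hC _ (svalP q) l)
  (fun q => exp_series_has_sum (sval q) rc) e e0.
exists (fun p' => \sum_(l <- A) c l * cexp (lam l p')); split.
  by apply: ccont_sum => l; apply: ccontZ; apply: ccont_cexp; exact: lam_ccont.
near=> p'.
have pp' : `|p'| <= `|p| + 1.
  rewrite -[p'](subrK p) addrC (le_trans (ler_normD _ _))// lerD2l distrC.
  by near: p'; exact: nbhs_dist_le.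
exact: (hA A (fsubset_refl _) (exist _ p' pp')).
Unshelve. all: by end_near.
Qed.

Lemma rapid_lam c v : rapid c -> rapid (fun l => c l * lam l v).
Proof.
move=> rc; apply: (@rapid_mul _ _ 4 (K * `|v|)) => // l.
apply: (le_trans (lam_le _ _)); rewrite mulrAC.
set x := _ * lat1 l; have x0 : 0 <= x by rewrite !mulr_ge0 ?lat1_ge0.
by have := expR_ge_sqr x0; move: (expR x) => y; nra.
Qed.

Lemma exp_series_cder c p v : rapid c ->
  is_cder (exp_series c) p v (exp_series (fun l => c l * lam l v) p).
Proof.
(* With y = |lam l v|, one factor exp(y) comes from [cexp_order2] and another from y^2 <= 4 exp(y);
   hence 2 |v| in the radius, and 8 = 2 * 4 in the remainder. *)
move=> rc; have [C C0 hC] := rapid_wt (K * (`|p| + 2 * `|v|)) rc.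
apply: (@is_cder_quad _ _ _ _ _ _ (8 * (C * 6 ^+ n)) 1) => // h h1.
have hs := has_sumD (exp_series_has_sum (p + h *: v) rc) (has_sumD
  (has_sumZ (-1) (exp_series_has_sum p rc)) (has_sumZ (- h%:C) (exp_series_has_sum p (rapid_lam v rc)))).
rewrite (_ : _ - _ - _ = exp_series c (p + h *: v) + (-1 * exp_series c p +
   - h%:C * exp_series (fun l => c l * lam l v) p)); last by ring.
rewrite [leRHS](_ : _ = (8 * h ^+ 2 * C) * 6 ^+ n); last by ring.
have C8 : 0 <= 8 * h ^+ 2 * C by rewrite mulr_ge0// mulr_ge0// sqr_ge0.
apply: (has_sum_bounded_le hs); apply: sum_bounded_le (sum_bounded_scale C8 (@sum_bounded_wt R n)) => /=.
move=> l; rewrite lamD cexpD.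
  rewrite (_ : _ + _ = c l * cexp (lam l p) * (cexp (h%:C * lam l v) - 1 - h%:C * lam l v)); last by ring.
  rewrite 2!cmodM.
  apply: (@le_trans _ _ (cmod (c l) * expR (cmod (lam l p)) *
     (8 * h ^+ 2 * (expR (cmod (lam l v)) * expR (cmod (lam l v)))))).
    rewrite ler_pM ?mulr_ge0 ?cmod_ge0//; first by rewrite ler_wpM2l ?cmod_ge0// cmod_cexp_le.
    apply: (le_trans (cexp_order2 _)); rewrite cmodM cmod_real.
    have y0 := cmod_ge0 (lam l v); move: (cmod (lam l v)) y0 => y y0.
    have h0 : 0 <= h ^+ 2 by exact: sqr_ge0.
    rewrite exprMn real_normK ?num_real//.
    have hy : expR (`|h| * y) <= expR y by rewrite ler_expR ler_piMl.
    have e0 := expR_ge0 (`|h| * y).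
    have := expR_ge_sqr y0; move: (expR y) (expR (`|h| * y)) hy e0 => E e hy e0 hE.
    rewrite -[leRHS]mulrA (_ : 2 * _ * e = h ^+ 2 * (2 * y ^+ 2 * e)); last by ring.
    rewrite (_ : 8 * _ = h ^+ 2 * (2 * (4 * E) * E)); last by ring.
    apply: ler_wpM2l => //; apply: ler_pM => //; first by rewrite mulr_ge0// sqr_ge0.
    by rewrite ler_wpM2l//; lra.
rewrite [leLHS](_ : _ = 8 * h ^+ 2 * (cmod (c l) * (expR (cmod (lam l p)) *
   (expR (cmod (lam l v)) * expR (cmod (lam l v)))))); last by ring.
rewrite -[leRHS]mulrA; apply: ler_wpM2l; first by rewrite mulr_ge0// sqr_ge0.
apply: le_trans (hC l); rewrite ler_wpM2l ?cmod_ge0// -!expRD ler_expR.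
by have := lam_le l p; have := lam_le l v; lra.
Qed.

Lemma exp_series_smooth c : rapid c -> smooth (exp_series c).
Proof.
move=> rc m; elim: m c rc => [|m IH] c rc.
  by have [? ?] := exp_series_ccont rc; split; split.
apply: (@cCm_der _ _ m _ (fun v p => exp_series (fun l => c l * lam l v) p)).
- exact: exp_series_ccont.
- by move=> p v; exact: exp_series_cder.
- by move=> v; apply: IH; exact: rapid_lam.
Qed.

End ExponentialSeries.

(** * Fourier series on the torus *)

Section Dot.
Context {R : realType} {n : nat}.
Implicit Types (x y z : 'rV[R]_n) (l m : 'rV[int]_n).

Lemma dotC x y : dot x y = dot y x.
Proof. by apply: eq_bigr => i _; rewrite mulrC. Qed.

Lemma dotDl x y z : dot (x + y) z = dot x z + dot y z.
Proof. by rewrite /dot -big_split; apply: eq_bigr => i _; rewrite mxE mulrDl. Qed.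

Lemma dotZl (c : R) x y : dot (c *: x) y = c * dot x y.
Proof. by rewrite /dot mulr_sumr; apply: eq_bigr => i _; rewrite mxE mulrA. Qed.

Lemma dotDr x y z : dot x (y + z) = dot x y + dot x z.
Proof. by rewrite dotC dotDl !(dotC x). Qed.

Lemma dotZr (c : R) x y : dot x (c *: y) = c * dot x y.
Proof. by rewrite dotC dotZl dotC. Qed.

Lemma dotNl x y : dot (- x) y = - dot x y.
Proof. by rewrite -scaleN1r dotZl mulN1r. Qed.

Lemma dotNr x y : dot x (- y) = - dot x y.
Proof. by rewrite dotC dotNl dotC. Qed.

Lemma dot0l x : dot 0 x = 0.
Proof. by rewrite -(scale0r 0) dotZl mul0r. Qed.

Lemma dot0r x : dot x 0 = 0.
Proof. by rewrite dotC dot0l. Qed.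

Lemma dot_delta x (i : 'I_n) : dot x (delta_mx ord0 i) = x ord0 i.
Proof.
rewrite /dot (bigD1 i)//= mxE !eqxx mulr1 big1 ?addr0// => j ji.
by rewrite mxE (negPf ji) andbF mulr0.
Qed.

Lemma dot_lattice l m : dot (of_lattice R l) (of_lattice R m) =
  (\sum_i l ord0 i * m ord0 i)%:~R.
Proof.
by rewrite /dot (big_morph _ (@intrD R) (mulr0z 1)); apply: eq_bigr => i _; rewrite !mxE intrM.
Qed.

Lemma ler_dot_lattice l x : `|dot (of_lattice R l) x| <= lat1 l * `|x|.
Proof.
apply: (le_trans (ler_norm_sum _ _ _)); rewrite /lat1 mulr_suml; apply: ler_sum => i _.
by rewrite mxE normrM ler_wpM2l// ler_coord_norm.
Qed.

Lemma ct_dot (Z : topologicalType) (f g : Z -> 'rV[R]_n) : continuous f -> continuous g ->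
  continuous (fun z : Z => dot (f z) (g z)).
Proof.
move=> cf cg; apply: ct_sum => i; apply: ctM.
  exact: (@ct_comp Z _ _ (fun x : 'rV[R]_n => x ord0 i) f cf (@coord_cont _ _ i)).
exact: (@ct_comp Z _ _ (fun x : 'rV[R]_n => x ord0 i) g cg (@coord_cont _ _ i)).
Qed.

End Dot.

Section Characters.
Context {R : realType} {n : nat}.
Local Notation V := 'rV[R]_n.
Local Notation E := (V * V)%type.
Implicit Types (x y t : V) (l m : 'rV[int]_n).

Definition echar l t : R[i] := cexp ('i * (dot (of_lattice R l) t)%:C).

Lemma echarD l m t : echar (l + m) t = echar l t * echar m t.
Proof. by rewrite /echar of_latticeD dotDl rcD mulrDr cexpD. Qed.

Lemma echar0 t : echar 0 t = 1.
Proof. by rewrite /echar of_lattice0 dot0l mulr0 cexp0. Qed.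

Lemma echar_add l t s : echar l (t + s) = echar l t * echar l s.
Proof. by rewrite /echar dotDr rcD mulrDr cexpD. Qed.

Lemma echarN l t : echar (- l) t = (echar l t)^*.
Proof. by rewrite /echar of_latticeN dotNl cexpJ; congr cexp; simpc. Qed.

Lemma cmod_echar l t : cmod (echar l t) = 1.
Proof. exact: cmod_cexpi. Qed.

Lemma echar_periodic l : lattice_periodic (2 * pi) (echar l).
Proof.
move=> m t; rewrite echar_add [X in _ * X](_ : _ = 1) ?mulr1//.
by rewrite /echar dotZr dot_lattice [2 * pi * _]mulrC cexpiZ_int.
Qed.

Lemma smooth_exponential (W : normedModType R) (s : W -> R[i]) (c : W -> R[i]) :
  ccont s -> (forall p v, is_cder s p v (c v * s p)) -> smooth s.
Proof.
move=> cs ds m; elim: m => [|m IH]; first by case: cs => ? ?; split; split.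
by apply: (@cCm_der _ _ m s (fun v p => c v * s p)) => // v; exact: cCmZ.
Qed.

Lemma ccont_echar l : ccont (echar l).
Proof.
apply: ccont_cexp; apply: ccontZ; apply: ccont_real; apply: ct_dot; [exact: ct_const|exact: ct_id].
Qed.

Lemma ccont_echar2 l : ccont (fun p : E => echar l p.2).
Proof. exact: (ccont_comp (@ct_snd _ _) (ccont_echar l)). Qed.

Lemma echar_cder2 l (p v : E) :
  is_cder (fun p : E => echar l p.2) p v ('i * (dot (of_lattice R l) v.2)%:C * echar l p.2).
Proof.
apply: is_cder_cexp; apply: (@is_cder_poly2 _ _ _ _ _ _ 0) => h.
by rewrite mulr0 addr0 /= dotDr dotZr rcD rcM; ring.
Qed.

Lemma smooth_echar2 l : smooth (fun p : E => echar l p.2).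
Proof. by apply: smooth_exponential (echar_cder2 l); exact: ccont_echar2. Qed.

(** If the coordinate l_i is nonzero, a translation by pi / l_i along the i-th axis multiplies the
    character by -1 while preserving its average. *)
Lemma avg_echar l : avg (2 * pi) (echar l) = (l == 0)%:R.
Proof.
have [->|l0] := eqVneq l 0.
  rewrite -[RHS](@avg_cst R n (2 * pi))//; last exact: pi2_gt0.
  by congr avg; apply/funext => t; rewrite echar0.
have [i li0] : exists i, l ord0 i != 0.
  apply/existsP; rewrite -negb_forall; apply: contra l0 => /forallP h.
  by apply/eqP/rowP => i; rewrite mxE; apply/eqP; exact: h.
pose s : V := (pi / (l ord0 i)%:~R) *: delta_mx ord0 i.
have es : echar l s = -1.
  rewrite /echar /s dotZr dot_delta mxE divfK ?intr_eq0//.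
  by rewrite cexpiE cospi sinpi; simpc.
have := avg_shift pi2_gt0 s (ccont_echar l) (@echar_periodic l).
rewrite (_ : (fun t => echar l (t + s)) = fun t => -1 * echar l t); last first.
  by apply/funext => t; rewrite echar_add es mulrC.
rewrite avgZ ?pi2_gt0//; last exact: ccont_echar.
move/eqP; rewrite mulN1r -subr_eq0 -opprD oppr_eq0 -mulr2n mulrn_eq0 /=.
by move/eqP.
Qed.

Definition fourier_coef (g : V -> R[i]) l : R[i] := avg (2 * pi) (fun t => echar (- l) t * g t).

Lemma fourier_coefZ g c l : ccont g -> fourier_coef (fun t => c * g t) l = c * fourier_coef g l.
Proof.
move=> cg; rewrite /fourier_coef -avgZ ?pi2_gt0//; last by apply: ccontM => //; exact: ccont_echar.
by congr avg; apply/funext => t; rewrite mulrCA.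
Qed.

Lemma fourier_coefD g h l : ccont g -> ccont h ->
  fourier_coef (fun t => g t + h t) l = fourier_coef g l + fourier_coef h l.
Proof.
move=> cg ch; rewrite /fourier_coef -avgD ?pi2_gt0//; [|by apply: ccontM => //; exact: ccont_echar..].
by congr avg; apply/funext => t; rewrite mulrDr.
Qed.

Lemma fourier_coef_sum (I : Type) (r : seq I) (F : I -> V -> R[i]) l : (forall i, ccont (F i)) ->
  fourier_coef (fun t => \sum_(i <- r) F i t) l = \sum_(i <- r) fourier_coef (F i) l.
Proof.
move=> cF; rewrite /fourier_coef -avg_sum ?pi2_gt0//; last first.
  by move=> i; apply: ccontM => //; exact: ccont_echar.
by congr avg; apply/funext => t; rewrite mulr_sumr.
Qed.

Lemma fourier_coef_echarM g m l : fourier_coef (fun t => echar m t * g t) l = fourier_coef g (l - m).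
Proof.
rewrite /fourier_coef; congr avg; apply/funext => t.
by rewrite mulrA -echarD opprB [m - l]addrC.
Qed.

Lemma fourier_coef_echar m l : fourier_coef (echar m) l = (l == m)%:R.
Proof.
rewrite /fourier_coef (_ : (fun t => _) = echar (m - l)).
  by rewrite avg_echar subr_eq0 eq_sym.
by apply/funext => t; rewrite -echarD addrC.
Qed.

Lemma fourier_coef_shift g s l : ccont g -> lattice_periodic (2 * pi) g ->
  fourier_coef (fun t => g (t + s)) l = echar l s * fourier_coef g l.
Proof.
move=> cg pg; have cF : ccont (fun t => echar (- l) t * g t).
  by apply: ccontM => //; exact: ccont_echar.
rewrite /fourier_coef -(avg_shift pi2_gt0 s cF); last first.
  by move=> m t; rewrite (echar_periodic (- l)) pg.
have cFs : ccont (fun t => echar (- l) (t + s) * g (t + s)).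
  by apply: (ccont_comp _ cF); exact: ct_shift.
rewrite -avgZ ?pi2_gt0//; congr avg; apply/funext => t.
rewrite echar_add -{1}[echar (-l) t]mul1r -(echar0 s) -(subrr l) echarD; ring.
Qed.

Lemma ler_cmod_fourier_coef g l (M : R) : ccont g -> (forall t, cmod (g t) <= M) ->
  cmod (fourier_coef g l) <= 2 * M.
Proof.
move=> cg gM; apply: ler_cmod_avg_cst; first exact: pi2_gt0.
  by apply: ccontM => //; exact: ccont_echar.
by move=> t _; rewrite cmodM cmod_echar mul1r.
Qed.

End Characters.

(** * A continuous function is determined by its Fourier coefficients *)

Section FourierUniqueness.
Context {R : realType} {n : nat}.
Local Notation V := 'rV[R]_n.
Local Notation Re := complex.Re.

(** This is sin^2(t_i / 2), a trigonometric polynomial with values in [0, 1] that attains 1 at t_i =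
    pi, in the interior of the interval of integration. *)
Definition peak (i : 'I_n) (t : V) : R := (1 - cos (t ord0 i)) / 2.

Lemma peak_echar i t : (peak i t)%:C =
  2^-1 + (- 4^-1) * echar (delta_mx ord0 i) t + (- 4^-1) * echar (- delta_mx ord0 i) t.
Proof.
have d1 : dot (of_lattice R (delta_mx ord0 i)) t = t ord0 i.
  by rewrite dotC -[RHS]dot_delta; congr dot; apply/rowP => j; rewrite !mxE; case: (_ && _).
rewrite echarN /echar d1 cexpiE.
rewrite -[_ + _ + _]addrA -mulrDr addcJ /= /peak rcM rcB rcV.
by rewrite -[2%:C]/((2%:R)%:C) rmorph_nat; field.
Qed.

Lemma peak_ge0 i t : 0 <= peak i t.
Proof. by rewrite divr_ge0// subr_ge0 cos_le1. Qed.

Lemma peak_le1 i t : peak i t <= 1.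
Proof. by rewrite ler_pdivrMr// mul1r lerBlDr -lerBlDl; have := cos_geN1 (t ord0 i); lra. Qed.

Lemma ct_peak i : continuous (peak i).
Proof.
apply: ctM; last exact: ct_cst; apply: ctB; first exact: ct_cst.
by apply: (ct_comp (@coord_cont _ _ i)); exact: continuous_cos.
Qed.

Definition fvanish (g : V -> R[i]) := ccont g /\ forall l, fourier_coef g l = 0.

(** Multiplication by a trigonometric polynomial only mixes finitely many Fourier coefficients. By
    iteration, g times any power of [kern] still has average 0. *)
Lemma fvanish_peak i g : fvanish g -> fvanish (fun t => (peak i t)%:C * g t).
Proof.
move=> [cg g0].
have cM m : ccont (fun t => echar m t * g t) by apply: ccontM => //; exact: ccont_echar.
split=> [|l]; first by apply: ccontM => //; apply: ccont_real; exact: ct_peak.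
rewrite (_ : (fun t => _) = fun t => 2^-1 * g t +
  (- 4^-1 * (echar (delta_mx ord0 i) t * g t) + - 4^-1 * (echar (- delta_mx ord0 i) t * g t))).
  have c1 c m : ccont (fun t => c * (echar m t * g t)) by exact: ccontZ.
  rewrite fourier_coefD; [|exact: ccontZ|exact: ccontD].
  rewrite fourier_coefD// !fourier_coefZ// !fourier_coef_echarM !g0 !mulr0 !addr0.
  by [].
by apply/funext => t; rewrite peak_echar; ring.
Qed.

Definition kern (t : V) : R := \prod_i peak i t.

Lemma fvanish_kern1 h : fvanish h -> fvanish (fun t => (kern t)%:C * h t).
Proof.
move=> vh; rewrite /kern; elim: (index_enum _) => [|i s IHs].
  by rewrite (_ : (fun t => _) = h)//; apply/funext => t; rewrite big_nil mul1r.
rewrite (_ : (fun t => _) = fun t => (peak i t)%:C * ((\prod_(j <- s) peak j t)%:C * h t)).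
  exact: fvanish_peak.
by apply/funext => t; rewrite big_cons rcM mulrA.
Qed.

Lemma fvanish_kern (N : nat) g : fvanish g -> fvanish (fun t => (kern t ^+ N)%:C * g t).
Proof.
move=> vg; elim: N => [|N IH].
  by rewrite (_ : (fun t => _) = g)//; apply/funext => t; rewrite mul1r.
rewrite (_ : (fun t => _) = fun t => (kern t)%:C * ((kern t ^+ N)%:C * g t)); last first.
  by apply/funext => t; rewrite exprS rcM mulrA.
exact: fvanish_kern1.
Qed.

Lemma ct_kern : continuous kern.
Proof.
rewrite /kern; elim: (index_enum _) => [|i s IHs].
  by rewrite (_ : (fun t => _) = fun=> 1);
    [exact: ct_cst|apply/funext => t; rewrite big_nil].
rewrite (_ : (fun t => _) = fun t => peak i t * \prod_(j <- s) peak j t).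
  by apply: ctM => //; exact: ct_peak.
by apply/funext => t; rewrite big_cons.
Qed.

Lemma kern_ge0 t : 0 <= kern t.
Proof. by apply: prodr_ge0 => i _; exact: peak_ge0. Qed.

Lemma kern_le_peak i t : kern t <= peak i t.
Proof.
rewrite /kern (bigD1 i)//= ler_piMr ?peak_ge0//.
by apply: prodr_ile1 => j _; rewrite peak_ge0 peak_le1.
Qed.

Lemma kern_center : kern (const_mx pi) = 1.
Proof. by apply: big1 => i _; rewrite /peak mxE cospi; lra. Qed.

(* Away from the centre of the cube the kernel is uniformly smaller than its
   value 1 at the centre, so its powers concentrate there. *)
Lemma kern_far (d : R) : 0 < d -> d <= pi -> exists2 rho : R, 0 <= rho < 1 &
  forall t, fdomain (2 * pi) t -> ~ bounds (const_mx (pi - d)) (d + d) t -> kern t <= rho.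
Proof.
move=> d0 dpi; exists ((1 + cos d) / 2).
  have c1 := cos_geN1 d; have : cos d < 1.
    by rewrite -cos0 ltr_cos// in_itv/= ?lexx ?pi_ge0// ltW.
  by move=> c2; apply/andP; split; lra.
move=> t /fdomainP Dt nb; have [i hi] : exists i, ~ (pi - d <= t ord0 i <= pi - d + (d + d)).
  by apply/not_existsP => h; apply: nb => i; rewrite mxE; apply: contrapT; exact: h.
apply: (le_trans (kern_le_peak i t)); rewrite /peak ler_pM2r// lerD2l.
have /andP[t0 tpi] := Dt i.
have hd : d < `|t ord0 i - pi|.
  rewrite ltNge; apply/negP => h; apply: hi; move: h; rewrite ler_norml => /andP[? ?].
  by apply/andP; split; lra.
have -> : - cos (t ord0 i) = cos `|t ord0 i - pi|.
  have -> : cos `|t ord0 i - pi| = cos (t ord0 i - pi).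
    by case: (ger0P (t ord0 i - pi)) => // _; rewrite cosN.
  by rewrite cosB cospi sinpi mulrN1 mulr0 addr0.
apply: ltW; rewrite ltr_cos ?in_itv/= ?(ltW d0)//.
by rewrite normr_ge0/= ler_norml; apply/andP; split; lra.
Qed.

(** If g does not vanish at the centre, the real function [h] exceeds m > 0 around it, and the
    vanishing of the averages of h kern^N bounds m times the average of kern^N by (M + m) rho^N. But
    kern >= r > rho on a small box makes this average at least a constant times r^N, a contradiction
    for N large. *)
Lemma fourier_unique_center (g : V -> R[i]) : fvanish g -> g (const_mx pi) = 0.
Proof.
move=> vg; apply/eqP; rewrite -[_ == _]negbK; apply/negP => gc0.
have [cg _] := vg; pose c := (g (const_mx pi))^*.
pose h t := Re (c * g t).
have ch : continuous h by have [] := ccontZ c cg.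
have hc : 0 < h (const_mx pi).
  rewrite /h /c mulJc/= exprn_gt0// lt_neqAle cmod_ge0 andbT eq_sym.
  by apply: contra gc0 => /eqP/cmod0_eq0/eqP.
set m := h (const_mx pi) / 2.
have m0 : 0 < m by rewrite divr_gt0.
have [M M0 hM] := continuous_bounded_on (@compact_fdomain R n (2 * pi)) ch.
have near_box (f : V -> R) (e : R) : continuous f -> e < f (const_mx pi) ->
    exists2 d : R, 0 < d <= pi & forall t, bounds (const_mx (pi - d)) (d + d) t -> e <= f t.
  move=> cf ef; have := cf (const_mx pi).
  move/cvgrPdist_le/(_ (f (const_mx pi) - e)); rewrite subr_gt0 => /(_ ef).
  move/nbhs_ballP => [d /= d0 hd]; exists (Num.min pi (d / 2)).
    by rewrite lt_min pi_gt0 divr_gt0//= ge_min lexx.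
  move=> t Bt; suff : `|f (const_mx pi) - f t| <= f (const_mx pi) - e.
    by rewrite ler_norml => /andP[_]; lra.
  apply: hd; rewrite -ball_normE/=.
  apply: (@le_lt_trans _ _ (d / 2)); last by rewrite ltr_pdivrMr// mulr_natr mulr2n ltrDl.
  apply: ler_norm_row; first by rewrite divr_ge0// ltW.
  move=> i; have := Bt i; rewrite !mxE; set d' := Num.min _ _ => /andP[h1 h2].
  have d'd : d' <= d / 2 by rewrite ge_min lexx orbT.
  by rewrite ler_norml; apply/andP; split; lra.
have [|d /andP[d0 dpi] hd] := near_box h m ch; first by rewrite /m; lra.
have [rho /andP[rho0 rho1] hrho] := kern_far d0 dpi.
(* A rate strictly between rho and 1, the value of [kern] at the centre. *)
have [r rE] : exists r, r = (1 + rho) / 2 by eexists.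
have [|b /andP[b0 bpi] hb] := near_box kern r ct_kern.
  by rewrite kern_center rE; lra.
have cN N : continuous (fun t => kern t ^+ N).
  elim: N => [|N IH]; first exact: ct_cst.
  by under eq_fun do rewrite exprS; apply: ctM => //; exact: ct_kern.
have key N : m * ravg (2 * pi) (fun t => kern t ^+ N) <= (M + m) * rho ^+ N.
  (* This vanishing average is added on the right; then pointwise m kern^N <= h kern^N + (M + m)
     rho^N, both near the centre and away from it. *)
  have int0 : ravg (2 * pi) (fun t => h t * kern t ^+ N) = 0.
    have := (fvanish_kern N vg).2 0; rewrite /fourier_coef oppr0.
    move=> e; have : c * avg (2 * pi) (fun t => (kern t ^+ N)%:C * g t) = 0.
      rewrite -[avg _ _](_ : avg (2 * pi) (fun t => echar 0 t * ((kern t ^+ N)%:C * g t)) = _).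
        by rewrite e mulr0.
      by congr avg; apply/funext => t; rewrite echar0 mul1r.
    rewrite -avgZ ?pi2_gt0//; last exact: (fvanish_kern N vg).1.
    move/(congr1 (@complex.Re R)) => /= <-; congr ravg; apply/funext => t.
    by rewrite /h mulrCA [in RHS]ReM /= mul0r subr0 mulrC.
  rewrite -[leRHS]add0r -{1}int0 -(@ravg_cst R n (2 * pi) pi2_gt0 ((M + m) * _)).
  have cm : continuous (fun t : V => m * kern t ^+ N) by apply: ctM => //; exact: ct_cst.
  have chk : continuous (fun t : V => h t * kern t ^+ N) by exact: ctM.
  rewrite -ravgZ ?pi2_gt0// -ravgD ?pi2_gt0//; last exact: ct_cst.
  apply: ler_ravg => //; first exact: pi2_gt0.
    by apply: ctD => //; exact: ct_cst.
  move=> t Dt; have k0 : 0 <= kern t ^+ N by rewrite exprn_ge0 ?kern_ge0.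
  have rN0 : 0 <= rho ^+ N by rewrite exprn_ge0.
  have [/hd mh|/(hrho _ Dt) kr] := pselect (bounds (const_mx (pi - d)) (d + d) t).
    by rewrite ler_wpDr ?mulr_ge0 ?addr_ge0 ?(ltW m0)// ler_wpM2r.
  have kN : kern t ^+ N <= rho ^+ N by rewrite lerXn2r ?nnegrE ?kern_ge0.
  have hMt : - M <= h t by have := hM t Dt; rewrite ler_norml => /andP[].
  by nra.
pose K := (2 * pi) ^- n * (b + b) ^+ n.
have K0 : 0 < K by rewrite mulr_gt0 ?invr_gt0 ?exprn_gt0 ?addr_gt0 ?pi2_gt0.
have r0 : 0 < r by rewrite rE; lra.
have low N : m * K * r ^+ N <= (M + m) * rho ^+ N.
  apply: le_trans (key N); rewrite -mulrA ler_wpM2l ?(ltW m0)//.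
  rewrite /K -mulrA [_ * r ^+ N]mulrC.
  apply: (@ravg_ge_box _ _ _ _ _ (const_mx (pi - b))) => //.
  - exact: pi2_gt0.
  - by move=> t; rewrite exprn_ge0 ?kern_ge0.
  - by rewrite addr_ge0// ltW.
  move=> t Bt; split; last by rewrite lerXn2r ?nnegrE ?kern_ge0 ?(ltW r0)// hb.
  apply/fdomainP => i; have := Bt i; rewrite mxE => /andP[? ?].
  by apply/andP; split; lra.
have x1 : `|rho / r| < 1.
  have xr : rho / r < 1 by rewrite ltr_pdivrMr// mul1r rE; lra.
  by rewrite ger0_norm// divr_ge0// ltW.
have M1 : 0 < M + m + 1 by rewrite ltr_wpDl// addr_ge0// ltW.
have e0 : 0 < m * K / (M + m + 1) by rewrite divr_gt0// mulr_gt0.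
have /cvgrPdist_lt/(_ _ e0)[N0 _ hN0] := cvg_expr x1.
have := hN0 N0 (leqnn _); rewrite sub0r normrN normrX ger0_norm ?divr_ge0 ?(ltW r0)//.
rewrite ltr_pdivlMr//.
have := low N0; rewrite -ler_pdivlMr ?exprn_gt0//.
rewrite (_ : (M + m) * rho ^+ N0 / r ^+ N0 = (M + m) * (rho / r) ^+ N0); last first.
  by rewrite expr_div_n mulrA.
have : 0 <= (rho / r) ^+ N0 by rewrite exprn_ge0// divr_ge0// ltW.
move: ((rho / r) ^+ N0) (m * K) => y z y0 h1 h2.
have : y * (M + m + 1) = (M + m) * y + y by ring.
by clear -y0 h1 h2; lra.
Qed.

(** Vanishing of all coefficients is invariant under translation, which brings any point to the
    centre of the cube. *)
Theorem fourier_unique (g : V -> R[i]) : ccont g -> lattice_periodic (2 * pi) g ->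
  (forall l, fourier_coef g l = 0) -> forall t, g t = 0.
Proof.
move=> cg pg g0 t; have := @fourier_unique_center (fun s => g (s + (t - const_mx pi))).
have -> : const_mx pi + (t - const_mx pi) = t by rewrite addrC subrK.
apply; split.
  by apply: (ccont_comp _ cg); exact: ct_shift.
by move=> l; rewrite fourier_coef_shift// g0 mulr0.
Qed.

End FourierUniqueness.

Section FourierSeries.
Context {R : realType} {n : nat}.
Local Notation V := 'rV[R]_n.
Implicit Types (c : 'rV[int]_n -> R[i]) (g : V -> R[i]) (l m : 'rV[int]_n) (t : V).

Definition fourier_series c t : R[i] := csum (fun l => c l * echar l t).

Lemma sum_bounded_wtZ (C : R) : 0 <= C ->
  sum_bounded (fun l : 'rV[int]_n => C * wt R l) (C * 6 ^+ n).
Proof. by move=> C0; apply: sum_bounded_scale => //; exact: sum_bounded_wt. Qed.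

Lemma wt_bound_ge0 c (C : R) : (forall l, cmod (c l) <= C * wt R l) -> 0 <= C.
Proof.
move=> /(_ 0) h; have := le_trans (cmod_ge0 _) h.
rewrite pmulr_lge0// /wt prodr_gt0// => i _.
by rewrite invr_gt0 ltr_wpDr// sqr_ge0.
Qed.

Context (c : 'rV[int]_n -> R[i]) (C : R).
Hypothesis cC : forall l, cmod (c l) <= C * wt R l.

Let C0 : 0 <= C := wt_bound_ge0 cC.

Let term_le l t : cmod (c l * echar l t) <= C * wt R l.
Proof. by rewrite cmodM cmod_echar mulr1. Qed.

Lemma fourier_series_has_sum t : has_sum (fun l => c l * echar l t) (fourier_series c t).
Proof.
apply: (@csumP _ _ _ (C * 6 ^+ n)).
exact: sum_bounded_le (fun l => term_le l t) (sum_bounded_wtZ C0).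
Qed.

Lemma ccont_fourier_series : ccont (fourier_series c).
Proof.
apply: ccont_uniform_limit => p e e0.
have [A hA] := has_sum_uniform (sum_bounded_wtZ C0) (fun t l => term_le l t) fourier_series_has_sum e0.
exists (fun t => \sum_(l <- A) c l * echar l t); split.
  by apply: ccont_sum => l; apply: ccontZ; exact: ccont_echar.
by near=> t; exact: hA.
Unshelve. all: by end_near.
Qed.

Lemma fourier_series_periodic : lattice_periodic (2 * pi) (fourier_series c).
Proof.
by move=> m t; congr csum; apply/funext => l; rewrite echar_periodic.
Qed.

Lemma has_sum_avg_fourier_series g (M : R) : ccont g -> (forall t, cmod (g t) <= M) ->
  has_sum (fun l => c l * avg (2 * pi) (fun t => g t * echar l t))
          (avg (2 * pi) (fun t => g t * fourier_series c t)).
Proof.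
move=> cg gM; have M0 : 0 <= M := le_trans (cmod_ge0 _) (gM 0).
have MC0 : 0 <= M * C by rewrite mulr_ge0.
have := @has_sum_avg R n (2 * pi) pi2_gt0 _ (fun l t => c l * (g t * echar l t))
  (fun t => g t * fourier_series c t) _ _ (sum_bounded_wtZ MC0) _ _ _ _.
move=> h; apply: eq_has_sum (h _ _ _ _).
- move=> l; rewrite avgZ ?pi2_gt0//.
  by apply: ccontM => //; exact: ccont_echar.
- by move=> l; apply: ccontZ; apply: ccontM => //; exact: ccont_echar.
- by apply: ccontM => //; exact: ccont_fourier_series.
- move=> t _ l; rewrite mulrCA cmodM -mulrA.
  by apply: ler_pM; rewrite ?cmod_ge0.
- move=> t _; apply: eq_has_sum (has_sumZ (g t) (fourier_series_has_sum t)) => l.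
  by rewrite mulrCA.
Qed.

Lemma fourier_coef_fourier_series m : fourier_coef (fourier_series c) m = c m.
Proof.
have gM t : cmod (echar (- m) t) <= 1 :> R by rewrite cmod_echar.
have h := has_sum_avg_fourier_series (ccont_echar (- m)) gM.
apply: has_sum_uniq h _.
apply: eq_has_sum (_ : has_sum (fun l => if l == m then c m else 0) _).
  move=> l; rewrite (_ : avg _ _ = fourier_coef (echar l) m)//.
  by rewrite fourier_coef_echar eq_sym; case: eqP => [->|_]; rewrite ?mulr1 ?mulr0.
have := @has_sum_fin R _ (fun l => if l == m then c m else 0) [fset m]%fset.
rewrite big_seq_fset1 eqxx; apply => l; rewrite inE => /negPf ->.
by [].
Qed.

End FourierSeries.

Section FourierInversion.
Context {R : realType} {n : nat}.
Local Notation V := 'rV[R]_n.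

(** The decay makes the series uniformly convergent; its sum is then continuous with the same
    coefficients as g, and uniqueness concludes. *)
Lemma fourier_inversion (g : V -> R[i]) (C : R) : ccont g ->
  lattice_periodic (2 * pi) g -> (forall l, cmod (fourier_coef g l) <= C * wt R l) ->
  forall t, fourier_series (fourier_coef g) t = g t.
Proof.
move=> cg pg gC t; apply/eqP; rewrite -subr_eq0; apply/eqP.
have cs := ccont_fourier_series gC.
apply: (@fourier_unique _ _ (fun t => fourier_series (fourier_coef g) t - g t)).
- exact: ccontB.
- by move=> m s; rewrite pg (fourier_series_periodic _ m).
- move=> l; rewrite (_ : (fun t => _) = fun t => fourier_series (fourier_coef g) t + (-1) * g t); last first.
    by apply/funext => s; rewrite mulN1r.
  by rewrite fourier_coefD// ?fourier_coefZ// ?(fourier_coef_fourier_series gC) ?mulN1r ?subrr//; exact: ccontZ.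
Qed.

End FourierInversion.

(** * Fourier coefficients along the fibers *)

Section ParametricCoefficients.
Context {R : realType} {n : nat}.
Local Notation V := 'rV[R]_n.
Local Notation E := (V * V)%type.
Implicit Types (f : E -> R[i]) (l m : 'rV[int]_n) (x t w v : V).

Lemma pairD x t y s : (x, t) + (y, s) = (x + y, t + s) :> E.
Proof. by []. Qed.

Lemma pairZ (h : R) x t : h *: (x, t) = (h *: x, h *: t) :> E.
Proof. by []. Qed.

Lemma ccont_slice f x : ccont f -> ccont (fun t => f (x, t)).
Proof.
by move=> cf; apply: (ccont_comp _ cf); apply: ct_pair; [exact: ct_const|exact: ct_id].
Qed.

Definition fiber_coef f l x : R[i] := fourier_coef (fun t => f (x, t)) l.

Lemma slice_compact x : compact ([set x] `*` fdomain (2 * pi) : set E).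
Proof. by apply: compact_setX; [exact: compact_set1|exact: compact_fdomain]. Qed.

(** The Taylor remainder is uniform over the fiber, by compactness, and can therefore be
    averaged. *)
Lemma avg_cder f x w : smooth f ->
  is_cder (fun x => avg (2 * pi) (fun t => f (x, t))) x w
    (avg (2 * pi) (fun t => cderive f (x, t) (w, 0))).
Proof.
move=> sf; have cf := smooth_ccont sf.
have cdf := smooth_ccont (smooth_cderive (w, 0) sf).
have [M M0 hM] := smooth_taylor2 (w, 0) sf (@slice_compact x).
apply: (@is_cder_quad _ _ _ _ _ _ (2 * M) 1) => // h h1.
have cx y : ccont (fun t => f (y, t)) by exact: ccont_slice.
have cd : ccont (fun t => cderive f (x, t) (w, 0)) by exact: (ccont_slice x cdf).
rewrite -avgZ ?pi2_gt0// -avgB ?pi2_gt0// -avgB ?pi2_gt0//; last 2 first.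
- exact: ccontB.
- exact: ccontZ.
rewrite -mulrA; apply: ler_cmod_avg_cst; first exact: pi2_gt0.
  by apply: ccontB; [exact: ccontB|exact: ccontZ].
move=> t Dt; have := hM (x, t) h (conj erefl Dt) h1.
by rewrite pairZ scaler0 pairD addr0.
Qed.

(** A substitute for the fundamental theorem of calculus: f and its translate by h v have the same
    average, so that h times the average of the derivative is O(h^2). *)
Lemma avg_cderive_angle f x v : smooth f ->
  lattice_periodic (2 * pi) (fun t => f (x, t)) ->
  avg (2 * pi) (fun t => cderive f (x, t) (0, v)) = 0.
Proof.
move=> sf pf; have cf := smooth_ccont sf.
have cdf := smooth_ccont (smooth_cderive (0, v) sf).
have [M M0 hM] := smooth_taylor2 (0, v) sf (@slice_compact x).
have cx y : ccont (fun t => f (y, t)) by exact: ccont_slice.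
have cd : ccont (fun t => cderive f (x, t) (0, v)) by exact: (ccont_slice x cdf).
set D := avg _ _.
have bound h : 0 < h -> h <= 1 -> cmod D <= 2 * M * h.
  move=> h0 h1.
  have cs : ccont (fun t => f (x, t + h *: v)).
    by apply: (@ccont_comp _ _ _ (fun t => f (x, t)) (fun t : V => t + h *: v)) => //; exact: ct_shift.
  suff : cmod (h%:C * D) <= 2 * (M * h ^+ 2).
    rewrite cmodM cmod_real gtr0_norm// => le.
    by rewrite -(ler_pM2l h0) (le_trans le)// expr2; lra.
  rewrite -cmodN -[- _]add0r -(subrr (avg (2 * pi) (fun t => f (x, t)))).
  rewrite -{1}(avg_shift pi2_gt0 (h *: v) (cx x) pf).
  rewrite -avgZ ?pi2_gt0// -avgB ?pi2_gt0// -avgB ?pi2_gt0//; last 2 first.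
  - exact: ccontB.
  - exact: ccontZ.
  apply: ler_cmod_avg_cst; first exact: pi2_gt0.
    by apply: ccontB; [exact: ccontB|exact: ccontZ].
  move=> t Dt; have := hM (x, t) h (conj erefl Dt).
  rewrite pairZ scaler0 pairD addr0.
  by apply; rewrite ger0_norm// ltW.
apply: cmod0_eq0; apply/eqP; rewrite eq_le cmod_ge0 andbT.
apply/ler_addgt0Pl => e e0; rewrite addr0.
have M1 : 0 < 2 * M + 1 by rewrite ltr_wpDl// mulr_ge0.
have h0 : 0 < Num.min 1 (e / (2 * M + 1)) by rewrite lt_min ltr01 divr_gt0.
apply: (le_trans (bound _ h0 _)); first by rewrite ge_min lexx.
apply: (@le_trans _ _ ((2 * M + 1) * Num.min 1 (e / (2 * M + 1)))).
  by rewrite ler_wpM2r ?(ltW h0)// lerDl.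
by rewrite mulrC -ler_pdivlMr// ge_min lexx orbT.
Qed.

Lemma smooth_echarM f l : smooth f -> smooth (fun p : E => echar l p.2 * f p).
Proof. by move=> sf; apply: smoothM => //; exact: smooth_echar2. Qed.

Lemma cderive_echarM f l (p v : E) : smooth f ->
  cderive (fun p : E => echar l p.2 * f p) p v =
  'i * (dot (of_lattice R l) v.2)%:C * (echar l p.2 * f p) + echar l p.2 * cderive f p v.
Proof.
move=> sf; rewrite (is_cder_cderive (is_cderM (echar_cder2 l p v) (smooth_cder sf p v))).
by ring.
Qed.

(** Integration by parts: the angular derivative of the product of f with the conjugate character
    has average 0. *)
Lemma fiber_coef_cderive_angle f l x v : smooth f ->
  lattice_periodic (2 * pi) (fun t => f (x, t)) ->
  fiber_coef (fun p => cderive f p (0, v)) l x = 'i * (dot (of_lattice R l) v)%:C * fiber_coef f l x.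
Proof.
move=> sf pf; have cf := smooth_ccont sf.
have cdf := smooth_ccont (smooth_cderive (0, v) sf).
have pe : lattice_periodic (2 * pi) (fun t => echar (- l) (x, t).2 * f (x, t)).
  by move=> m t /=; rewrite pf echar_periodic.
have := avg_cderive_angle v (smooth_echarM (- l) sf) pe.
rewrite (_ : (fun t => _) = fun t => 'i * (dot (of_lattice R (- l)) v)%:C *
  (echar (- l) t * f (x, t)) + echar (- l) t * cderive f (x, t) (0, v)); last first.
  by apply/funext => t; rewrite cderive_echarM.
have ce g : ccont g -> ccont (fun t => echar (- l) t * g (x, t)).
  by move=> cg; apply: ccontM; [exact: ccont_echar|exact: ccont_slice].
have c1 := ce _ cf; have c2 : ccont (fun t => echar (- l) t * cderive f (x, t) (0, v)).
  exact: (ce _ cdf).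
rewrite avgD ?avgZ ?pi2_gt0//; last exact: ccontZ.
move=> /eqP; rewrite addrC addr_eq0 => /eqP; rewrite /fiber_coef /fourier_coef => ->.
by rewrite of_latticeN dotNl rcN; ring.
Qed.

Lemma fiber_coef_cder f l x w : smooth f ->
  is_cder (fiber_coef f l) x w (fiber_coef (fun p => cderive f p (w, 0)) l x).
Proof.
move=> sf; have := avg_cder x w (smooth_echarM (- l) sf).
rewrite (_ : (fun t => cderive _ _ _) = fun t => echar (- l) t * cderive f (x, t) (w, 0))//.
by apply/funext => t; rewrite cderive_echarM//= dot0r mulr0 mul0r add0r.
Qed.

Definition angle_periodic f := forall x, lattice_periodic (2 * pi) (fun t => f (x, t)).

Definition base_periodic f := forall t, lattice_periodic 1 (fun x => f (x, t)).

Lemma cderive_shift (W : normedModType R) (g : W -> R[i]) (s p v : W) :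
  (forall q, g (q + s) = g q) -> cderive g (p + s) v = cderive g p v.
Proof.
move=> gs; rewrite /cderive /derive.
have e (F : R[i] -> R) : (fun h => h^-1 *: (((fun q => F (g q)) \o shift (p + s)) (h *: v) - F (g (p + s)))) =
    (fun h => h^-1 *: (((fun q => F (g q)) \o shift p) (h *: v) - F (g p))).
  by apply/funext => h /=; rewrite addrA !gs.
by rewrite (e (@complex.Re R)) (e (@complex.Im R)).
Qed.

Lemma cderive_angle_periodic f (v : E) : angle_periodic f ->
  angle_periodic (fun p => cderive f p v).
Proof.
move=> pf x m t.
have := @cderive_shift _ f (0, (2 * pi) *: of_lattice R m) (x, t) v.
by rewrite pairD addr0; apply=> -[y s]; rewrite pairD addr0 (pf y).
Qed.

Lemma cderive_base_periodic f (v : E) : base_periodic f ->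
  base_periodic (fun p => cderive f p v).
Proof.
move=> pf t m x.
have := @cderive_shift _ f (1 *: of_lattice R m, 0) (x, t) v.
by rewrite pairD addr0; apply=> -[y s]; rewrite pairD addr0 (pf s).
Qed.

Lemma reduce_fdomain (a : R) x : 0 < a -> exists m, fdomain a (x + a *: of_lattice R m).
Proof.
move=> a0; exists (\row_i - Num.floor (x ord0 i / a)).
apply/fdomainP => i; rewrite !mxE mulrNz mulrN.
have /andP[h1 h2] := floor_itv (x ord0 i / a).
apply/andP; split; first by rewrite subr_ge0 mulrC -ler_pdivlMr.
move: h2; rewrite intrD ltr_pdivrMr// mulrDl mul1r => h2.
by rewrite lerBlDr [a * _]mulrC addrC ltW.
Qed.

Lemma periodic_bounded f : ccont f -> angle_periodic f -> base_periodic f ->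
  exists2 M : R, 0 <= M & forall p, cmod (f p) <= M.
Proof.
move=> cf af bf.
have cK : compact (fdomain 1 `*` fdomain (2 * pi) : set E).
  by apply: compact_setX; exact: compact_fdomain.
have [M M0 hM] := continuous_bounded_on cK (ccont_cmod cf).
exists M => // -[x t].
have [m Dx] := reduce_fdomain x (@ltr01 R); have [m' Dt] := reduce_fdomain t (@pi2_gt0 R).
rewrite -(bf t m) -(af _ m').
by have := hM (_, _) (conj Dx Dt); rewrite ger0_norm ?cmod_ge0.
Qed.

Definition helm (i : 'I_n) f (p : E) : R[i] :=
  f p - cderive (fun p => cderive f p (d_theta R i)) p (d_theta R i).

Lemma helm_smooth i f : smooth f -> smooth (helm i f).
Proof.
move=> sf; rewrite /helm; under eq_fun do rewrite -mulN1r.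
by apply: smoothD => //; apply: smoothZ; do 2!apply: smooth_cderive.
Qed.

Lemma helm_angle i f : angle_periodic f -> angle_periodic (helm i f).
Proof.
move=> af x m t; rewrite /helm (af x).
by rewrite (cderive_angle_periodic _ (cderive_angle_periodic _ af) x).
Qed.

Lemma helm_base i f : base_periodic f -> base_periodic (helm i f).
Proof.
move=> bf t m x; rewrite /helm (bf t).
by rewrite (cderive_base_periodic _ (cderive_base_periodic _ bf) t).
Qed.

Lemma fiber_coef_helm i f l x : smooth f -> angle_periodic f ->
  fiber_coef (helm i f) l x = (1 + (l ord0 i)%:~R ^+ 2)%:C * fiber_coef f l x.
Proof.
move=> sf af; have sd := smooth_cderive (d_theta R i) sf.
have sdd := smooth_cderive (d_theta R i) sd.
rewrite /helm /fiber_coef.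
rewrite (_ : (fun t => _) = fun t => f (x, t) + (-1) *
  cderive (fun p => cderive f p (d_theta R i)) (x, t) (d_theta R i)); last first.
  by apply/funext => t; rewrite mulN1r.
have c1 : ccont (fun t => f (x, t)) by apply: ccont_slice; exact: smooth_ccont.
have c2 : ccont (fun t => cderive (fun p => cderive f p (d_theta R i)) (x, t) (d_theta R i)).
  exact: (ccont_slice x (smooth_ccont sdd)).
rewrite fourier_coefD ?fourier_coefZ//; last exact: ccontZ.
rewrite -[fourier_coef (fun t => cderive _ _ _) l]/(fiber_coef (fun p => cderive (fun p => cderive f p (d_theta R i)) p (d_theta R i)) l x).
rewrite (fiber_coef_cderive_angle l _ sd (cderive_angle_periodic _ af x)).
rewrite (fiber_coef_cderive_angle l _ sf (af x)).
rewrite dot_delta mxE rcD rcX.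
rewrite (_ : _ * (_ * (_ * fiber_coef f l x)) = - ('i ^+ 2) * ((l ord0 i)%:~R%:C ^+ 2) * fiber_coef f l x); last by ring.
by rewrite sqr_i opprK; rewrite -[fourier_coef _ l]/(fiber_coef f l x); ring.
Qed.

(** Applying 1 - d^2/dtheta_i^2 once for each i divides the coefficient of index l by [wt l]. The
    function obtained is still periodic, hence bounded on all of R^n x R^n, which gives a constant
    independent of x. *)
Theorem fiber_coef_decay f : smooth f -> angle_periodic f -> base_periodic f ->
  exists2 C : R, 0 <= C & forall l x, cmod (fiber_coef f l x) <= C * wt R l.
Proof.
move=> sf af bf.
pose L (s : seq 'I_n) := foldr helm f s.
have LP s : [/\ smooth (L s), angle_periodic (L s) & base_periodic (L s)].
  elim: s => [|i s [h1 h2 h3]]; first by split.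
  by split; [exact: helm_smooth|exact: helm_angle|exact: helm_base].
have fL s l x : fiber_coef (L s) l x = (\prod_(i <- s) (1 + (l ord0 i)%:~R ^+ 2))%:C * fiber_coef f l x.
  elim: s => [|i s IH]; first by rewrite big_nil mul1r.
  by have [h1 h2 h3] := LP s; rewrite /= fiber_coef_helm// -/(L s) IH big_cons rcM mulrA.
have [h1 h2 h3] := LP (index_enum _).
have [M M0 hM] := periodic_bounded (smooth_ccont h1) h2 h3.
exists (2 * M); first by rewrite mulr_ge0.
move=> l x; have := ler_cmod_fourier_coef l (ccont_slice x (smooth_ccont h1)) (fun t => hM (x, t)).
rewrite -[fourier_coef _ l]/(fiber_coef _ l x) fL cmodM cmod_real.
have p0 : 0 < \prod_i (1 + (l ord0 i)%:~R ^+ 2) :> R.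
  by apply: prodr_gt0 => i _; rewrite ltr_wpDr// sqr_ge0.
by rewrite gtr0_norm// /wt prodfV ler_pdivlMr// mulrC.
Qed.

Lemma fiber_coef_inversion f (C : R) x t : ccont f -> angle_periodic f ->
  (forall l x, cmod (fiber_coef f l x) <= C * wt R l) ->
  has_sum (fun l => fiber_coef f l x * echar l t) (f (x, t)).
Proof.
move=> cf af fC; rewrite -(fourier_inversion (ccont_slice x cf) (af x) (fun l => fC l x) t).
exact: (fourier_series_has_sum (fun l => fC l x)).
Qed.

Lemma ccont_fiber_coef f l : ccont f -> ccont (fiber_coef f l).
Proof.
move=> cf; apply: (@ccont_avg_param _ _ _ pi2_gt0 _ (fun p : E => echar (- l) p.2 * f p)).
by apply: ccontM => //; exact: ccont_echar2.
Qed.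

End ParametricCoefficients.

(** * The points of B_k *)

Section Classes.
Context {R : realType} {n : nat}.
Local Notation V := 'rV[R]_n.
Local Notation lattice := 'rV[int]_n.
Implicit Types (x y : V) (l m r : lattice).

Lemma prP x y : pr x = pr y <-> exists m, x = y + of_lattice R m.
Proof.
have h : pr x = pr y <-> lattice_eqv x y.
  split=> e; first by apply/(@eqmodP _ (lattice_equiv R n)); exact: e.
  exact: (elimT (@eqmodP _ (lattice_equiv R n) x y) e).
rewrite h; split=> [/forallP {}h|[m ->]].
  exists (\row_i Num.floor (x ord0 i - y ord0 i)); apply/rowP => i; rewrite !mxE.
  by rewrite floorK// addrC subrK.
by apply/forallP => i; rewrite !mxE addrAC subrr add0r intr_int.
Qed.

Lemma pr_add x m : pr (x + of_lattice R m) = pr x.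
Proof. by apply/prP; exists m. Qed.

Lemma of_latticeZ (z : int) l : of_lattice R (z *: l) = z%:~R *: of_lattice R l.
Proof. by apply/rowP => i; rewrite !mxE intrM. Qed.

Lemma of_lattice_inj : injective (@of_lattice R n).
Proof.
move=> l m /rowP h; apply/rowP => i; have := h i; rewrite !mxE.
exact: intr_inj.
Qed.

Context (k : nat).
Hypothesis k0 : (0 < k)%N.

Let kR : k%:R != 0 :> R. Proof. by rewrite pnatr_eq0 -lt0n. Qed.

Definition scaled l : V := k%:R^-1 *: of_lattice R l.

Lemma scaledD l m : scaled (l + m) = scaled l + scaled m.
Proof. by rewrite /scaled of_latticeD scalerDr. Qed.

Lemma scaled_mul r : scaled (Posz k *: r) = of_lattice R r.
Proof. by rewrite /scaled of_latticeZ scalerA mulVf// scale1r. Qed.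

Definition rep (b : Bk n k) : lattice := \row_i Posz (b i).

Lemma bs_liftE b : bs_lift R b = scaled (rep b).
Proof. by apply/rowP => i; rewrite !mxE mulrC. Qed.

(** The residue class modulo k that b stands for, stated on the torus so as to be literally the
    condition in the definition of [Theta]. *)
Definition inclass (b : Bk n k) l : bool := `[< pr (scaled l) = bs_point R b >].

Lemma inclassP b l : inclass b l <-> exists r, l = rep b + Posz k *: r.
Proof.
rewrite /inclass /bs_point bs_liftE; split=> [/asboolP/prP[m e]|[r ->]].
  exists m; apply: of_lattice_inj; apply: (scalerI (a := k%:R^-1)).
    by rewrite invr_eq0.
  by rewrite -/(scaled _) e -[RHS]/(scaled _) scaledD scaled_mul.
by apply/asboolP; rewrite scaledD scaled_mul pr_add.
Qed.

Lemma inclass_rep b : inclass b (rep b).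
Proof. by apply/inclassP; exists 0; rewrite scaler0 addr0. Qed.

Lemma inclass_mul b l r : inclass b (l + Posz k *: r) = inclass b l.
Proof. by rewrite /inclass scaledD scaled_mul pr_add. Qed.

Lemma rep_unique b b' r : rep b = rep b' + Posz k *: r -> b = b'.
Proof.
move=> /rowP e; apply/ffunP => i; apply: val_inj => /=.
have := e i; rewrite !mxE => h.
have b1 := ltn_ord (b i); have b2 := ltn_ord (b' i).
have : (Posz (b i) %% Posz k)%Z = (Posz (b' i) %% Posz k)%Z.
  by rewrite h addrC mulrC modzMDl.
by rewrite !modz_small; [move=> [->]|lia|lia].
Qed.

Lemma inclass_inj b b' l : inclass b l -> inclass b' l -> b = b'.
Proof.
move=> /inclassP[r ->] /inclassP[r' e]; apply: (@rep_unique _ _ (r' - r)).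
by apply/eqP; rewrite scalerBr addrA -e addrK.
Qed.

Lemma bs_point_inj : injective (@bs_point R n k).
Proof.
move=> b b' e; apply: (inclass_inj (inclass_rep b)).
by apply/asboolP; rewrite -e /bs_point bs_liftE.
Qed.

Lemma inclass_ex l : exists b, inclass b l.
Proof.
have kz : Posz k != 0 by rewrite eqz_nat -lt0n.
have kz0 : 0 < Posz k by rewrite ltz_nat.
have h i : (`|(l ord0 i %% Posz k)%Z| < k)%N.
  by have := ltz_pmod (l ord0 i) kz0; have := modz_ge0 (l ord0 i) kz; lia.
exists [ffun i => Ordinal (h i)]; apply/inclassP.
exists (\row_i (l ord0 i %/ Posz k)%Z); apply/rowP => i; rewrite !mxE ffunE /=.
rewrite gez0_abs ?modz_ge0// [RHS]addrC [Posz k * _]mulrC.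
exact: divz_eq.
Qed.

End Classes.

(** * Quadratic forms *)

Section QuadraticForms.
Context {R : realType} {n : nat}.
Local Notation V := 'rV[R]_n.
Implicit Types (A : 'M[R]_n) (x y : V).

Lemma qformE A x : qform A x = dot (x *m A) x.
Proof.
rewrite /qform exchange_big; apply: eq_bigr => j _.
by rewrite mxE mulr_suml; apply: eq_bigr.
Qed.

Lemma dot_mulmxC A x y : A^T = A -> dot (x *m A) y = dot (y *m A) x.
Proof.
move=> As; rewrite /dot.
under eq_bigr => j _ do rewrite mxE mulr_suml.
rewrite exchange_big; apply: eq_bigr => i _.
rewrite mxE mulr_suml; apply: eq_bigr => j _.
by rewrite -{1}As mxE; ring.
Qed.

Lemma qformD A x y : A^T = A ->
  qform A (x + y) = qform A x + 2 * dot (x *m A) y + qform A y.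
Proof.
move=> As; rewrite !qformE mulmxDl !dotDl !dotDr (dot_mulmxC y x As); ring.
Qed.

Lemma qformZ A (c : R) x : qform A (c *: x) = c ^+ 2 * qform A x.
Proof. by rewrite !qformE -scalemxAl dotZl dotZr mulrA expr2. Qed.

Lemma qformN A x : qform A (- x) = qform A x.
Proof. by rewrite -scaleN1r qformZ sqrrN expr1n mul1r. Qed.

Lemma ct_mulmx A : continuous (fun x : V => x *m A).
Proof.
apply: continuous_row => j; rewrite (_ : (fun _ => _) = fun x : V => \sum_i x ord0 i * A i j).
  by apply: ct_sum => i; apply: ctM; [exact: coord_cont|exact: ct_cst].
by apply/funext => x; rewrite mxE.
Qed.

Lemma ct_qform A : continuous (qform A).
Proof.
rewrite (_ : qform A = fun x => dot (x *m A) x); last by apply/funext => x; exact: qformE.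
by apply: ct_dot; [exact: ct_mulmx|exact: ct_id].
Qed.

Definition mxsum A : R := \sum_i \sum_j `|A i j|.

Lemma mxsum_ge0 A : 0 <= mxsum A.
Proof. by apply: sumr_ge0 => i _; exact: sumr_ge0. Qed.

Lemma ler_norm_mulmx A x : `|x *m A| <= mxsum A * `|x|.
Proof.
apply: ler_norm_row; first by rewrite mulr_ge0 ?mxsum_ge0.
move=> j; rewrite mxE; apply: (le_trans (ler_norm_sum _ _ _)).
rewrite /mxsum mulr_suml; apply: ler_sum => i _; rewrite normrM mulrC.
apply: ler_pM => //; last exact: ler_coord_norm.
by rewrite (bigD1 j)//= lerDl sumr_ge0.
Qed.

Lemma ler_lat1 (l : 'rV[int]_n) : lat1 l <= n%:R * `|of_lattice R l|.
Proof.
rewrite /lat1 -[n in n%:R]card_ord -sum1_card natr_sum mulr_suml.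
apply: ler_sum => i _; rewrite mul1r.
by have := ler_coord_norm (of_lattice R l) i; rewrite mxE.
Qed.

Lemma ler_norm_dot x y : `|dot x y| <= n%:R * (`|x| * `|y|).
Proof.
apply: (le_trans (ler_norm_sum _ _ _)).
rewrite -[n in n%:R]card_ord -sum1_card natr_sum mulr_suml; apply: ler_sum => i _.
by rewrite mul1r normrM ler_pM// ler_coord_norm.
Qed.

Lemma ler_qform A x : qform A x <= n%:R * mxsum A * `|x| ^+ 2.
Proof.
rewrite qformE; apply: (le_trans (ler_norm _)); apply: (le_trans (ler_norm_dot _ _)).
by rewrite -mulrA ler_wpM2l// expr2 mulrA ler_wpM2r// ler_norm_mulmx.
Qed.

(** q is the minimum of the form on the compact unit sphere; homogeneity of degree 2 does the
    rest. *)
Lemma qform_coercive (Q : 'M[R]_n) : pos_def Q ->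
  exists2 q : R, 0 < q & forall x, q * `|x| ^+ 2 <= qform Q x.
Proof.
move=> Qp; pose S : set V := [set x | `|x| = 1].
have cS : compact S.
  apply: bounded_closed_compact.
    by exists 1; split; [exact: num_real|move=> M M1 x /= ->; exact: ltW].
  apply: (@preimage_closed _ _ (fun x : V => `|x|) [set 1]).
    by move=> x _; exact: norm_continuous.
  exact: closed_eq.
(* The sphere is empty exactly when 0 is the only vector, that is for n = 0. *)
have [[x0 x01]|noS] := pselect (S !=set0); last first.
  exists 1 => // x; have -> : x = 0.
    apply: contrapT => x0; apply: noS; exists (`|x|^-1 *: x).
    rewrite /S/= normrZ normfV normr_id mulVf// normr_eq0; exact/eqP.
  by rewrite normr0 expr0n mulr0 qformE dot0r.
have [x1 x11 hmin] := @compact_EVT_min _ _ (qform Q) S (ex_intro _ x0 x01) cS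
  (continuous_subspaceT (@ct_qform Q)).
have x10 : x1 != 0.
  apply/eqP => x10; move: x11; rewrite inE /S/= x10 normr0 => /eqP.
  by rewrite eq_sym oner_eq0.
exists (qform Q x1); first exact: Qp.
move=> x; have [->|xn0] := eqVneq x 0.
  by rewrite normr0 expr0n mulr0 qformE dot0r.
have nx : 0 < `|x| by rewrite normr_gt0.
have /hmin : (`|x|^-1 *: x) \in S.
  by rewrite inE /S/= normrZ normfV normr_id mulVf// gt_eqF.
by rewrite qformZ exprVn ler_pdivlMl ?exprn_gt0// mulrC.
Qed.

End QuadraticForms.

(** * Gaussian densities *)

Section Gaussians.
Context {R : realType} {n : nat} (Q : 'M[R]_n).
Hypothesis Q_pos : pos_def Q.
Local Notation V := 'rV[R]_n.
Local Notation lattice := 'rV[int]_n.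
Implicit Types (x y v : V) (l r : lattice) (kap : R).

Definition gauss kap x : R := expR (- (kap * qform Q x)).

Lemma gauss_ge0 kap x : 0 <= gauss kap x. Proof. exact: expR_ge0. Qed.

Lemma ct_gauss kap : continuous (gauss kap).
Proof.
apply: (@ct_comp V R R expR (fun x => - (kap * qform Q x))).
  by apply: ctN; apply: ctM; [exact: ct_cst|exact: ct_qform].
exact: continuous_expR.
Qed.

Lemma gauss_rapid kap (rho s : R) : 0 < kap -> 0 <= rho -> exists2 C : R, 0 <= C &
  forall v l, `|v| <= rho -> gauss kap (v - of_lattice R l) * expR (s * lat1 l) <= C.
Proof.
move=> kap0 rho0; have [q q0 hq] := qform_coercive Q_pos.
pose A := kap * q; have A0 : 0 < A by rewrite mulr_gt0.
pose B := `|s| * n%:R; have B0 : 0 <= B by rewrite mulr_ge0.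
(* B^2 / (4 A) is the maximum of B d - A d^2 over the distance d, and B rho pays for replacing |l|
   by d + |v|. *)
exists (expR (B ^+ 2 / (4 * A) + B * rho)); first exact: expR_ge0.
move=> v l vr; rewrite /gauss -expRD ler_expR.
set d := `|v - of_lattice R l|.
have d0 : 0 <= d by rewrite /d normr_ge0.
have h1 : A * d ^+ 2 <= kap * qform Q (v - of_lattice R l).
  by rewrite /A -mulrA; apply: ler_wpM2l; [exact: ltW|exact: hq].
have h2 : s * lat1 l <= B * (d + rho).
  apply: (@le_trans _ _ (`|s| * lat1 l)).
    by rewrite ler_wpM2r ?lat1_ge0// ler_norm.
  rewrite /B -mulrA ler_wpM2l//; apply: (le_trans (ler_lat1 l)); rewrite ler_wpM2l//.
  rewrite -[of_lattice R l]opprK -[- - _](subrK v) addrC.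
  apply: (le_trans (ler_normD _ _)); rewrite addrC lerD// /d -normrN.
  by rewrite opprK opprD opprK addrC.
have h3 : B * d - A * d ^+ 2 <= B ^+ 2 / (4 * A).
  rewrite ler_pdivlMr ?mulr_gt0//; have : 0 <= (B - 2 * A * d) ^+ 2 by exact: sqr_ge0.
  by nra.
by lra.
Qed.

Lemma gauss_wt kap (rho : R) : 0 < kap -> 0 <= rho -> exists2 C : R, 0 <= C &
  forall v l, `|v| <= rho -> gauss kap (v - of_lattice R l) <= C * wt R l.
Proof.
move=> kap0 rho0; have [C C0 hC] := gauss_rapid 1 kap0 rho0.
exists (C * 4 ^+ n); first by rewrite mulr_ge0// exprn_ge0.
move=> v l vr; rewrite -mulrA; apply: le_trans (ler_wpM2l C0 (expRN_lat1_wt l)).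
by have := hC v l vr; rewrite mul1r expRN -ler_pdivlMr ?expR_gt0.
Qed.

Definition gmass kap : R :=
  Rintegral (lebesgue_tuple R n) setT (fun u => gauss kap (vec_of_tuple u)).

Lemma ravg1E (h : V -> R) : ravg 1 h = bint 0 1 h.
Proof. by rewrite /ravg expr1n invr1 mul1r. Qed.

Lemma fdomain_norm (a : R) x : 0 <= a -> fdomain a x -> `|x| <= a.
Proof.
move=> a0 /fdomainP h; apply: ler_norm_row => // i; have /andP[h0 h1] := h i.
by rewrite ger0_norm.
Qed.

Lemma ct_gauss_shift kap v : continuous (fun x => gauss kap (x + v)).
Proof. by apply: ct_comp; [exact: ct_shift|exact: ct_gauss]. Qed.

Lemma gauss_avg_bounded kap v : 0 < kap -> exists C : R,
  sum_bounded (fun r => ravg 1 (fun x => gauss kap (x - v - of_lattice R r))) C.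
Proof.
move=> kap0; have [C C0 hC] := gauss_wt kap0 (addr_ge0 ler01 (normr_ge0 v)).
exists (C * 6 ^+ n); apply: sum_bounded_le (sum_bounded_wtZ C0) => r /=.
rewrite -[leRHS](@ravg_cst R n 1 ltr01); apply: ler_ravg; first exact: ltr01.
- by under eq_fun do rewrite -addrA; exact: ct_gauss_shift.
- exact: ct_cst.
- move=> x Dx; apply: hC; rewrite (le_trans (ler_normB _ _))// lerD2r.
  exact: fdomain_norm.
Qed.

(* Unfolding: the translates of the unit cube tile the whole space. *)
Lemma gauss_avg_sum kap v : 0 < kap ->
  has_sum (fun r => (ravg 1 (fun x => gauss kap (x - v - of_lattice R r)))%:C)
    (gmass kap)%:C.
Proof.
move=> kap0; have [C hC] := gauss_avg_bounded v kap0.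
have e r : ravg 1 (fun x => gauss kap (x - v - of_lattice R r)) =
    bint 0 1 (fun x => gauss kap (x + (- v + of_lattice R (- r)))).
  by rewrite ravg1E; congr bint; apply/funext => x; rewrite of_latticeN addrA.
have h : has_sum (fun r => (bint 0 1 (fun x => gauss kap (x + (- v + of_lattice R r))))%:C)
    (gmass kap)%:C.
  apply: (@has_sum_unfold _ _ _ _ C); [exact: ct_gauss|exact: gauss_ge0|].
  move=> A; apply: le_trans (hC [fset - r | r in A]%fset).
  rewrite big_imfset/=; last by move=> r r' _ _; exact: oppr_inj.
  by apply: ler_sum => r _; rewrite e opprK.
have := (has_sum_reindex (f := fun r => (bint 0 1 (fun x => gauss kap (x + (- v + of_lattice R r))))%:C)
  (h := -%R) (gmass kap)%:C (@oppr_inj _) (fun r _ => ex_intro _ (- r) (esym (opprK r)))).2 h.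
by apply: eq_has_sum => r /=; rewrite e.
Qed.

(** Of the unfolded mass only the cube r = 0 is kept, and of this cube the box [0, e]^n, on which Q
    is at most n (mxsum Q) e^2. *)
Lemma gmass_ge kap (e : R) : 0 < kap -> 0 <= e <= 1 ->
  expR (- (kap * (n%:R * mxsum Q * e ^+ 2))) * e ^+ n <= gmass kap.
Proof.
move=> kap0 /andP[e0 e1].
have h := gauss_avg_sum 0 kap0.
have b0 r : 0 <= ravg 1 (fun x => gauss kap (x - 0 - of_lattice R r)).
  by rewrite ravg1E; apply: Rintegral_ge0 => u _; exact: gauss_ge0.
have le0 : ravg 1 (fun x => gauss kap (x - 0 - of_lattice R (0 : lattice))) <= gmass kap.
  apply/ler_addgt0Pr => d d0; have [A hA] := h d d0.
  have := hA (0 |` A)%fset (fsubsetUr _ _); rewrite -rc_sum -rcB cmod_real ler_norml.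
  move=> /andP[_]; rewrite lerBlDr addrC => /(le_trans _); apply.
  apply: (@le_trans _ _ (\sum_(r <- [fset (0 : lattice)]%fset)
    ravg 1 (fun x => gauss kap (x - 0 - of_lattice R r)))).
    by rewrite big_seq_fset1.
  by apply: ler_sum_fsub => //; exact: fsubsetUl.
apply: le_trans le0.
have := @ravg_ge_box R n 1 ltr01 (fun x => gauss kap (x - 0 - of_lattice R (0 : lattice))) 0 e
  (expR (- (kap * (n%:R * mxsum Q * e ^+ 2)))).
rewrite expr1n invr1 mul1r; apply => //.
- by under eq_fun do rewrite -addrA; exact: ct_gauss_shift.
- by move=> x; exact: gauss_ge0.
- move=> x Bx; have De : fdomain e x by [].
  split; first by apply/fdomainP => i; have := Bx i; rewrite mxE add0r => /andP[-> /le_trans]; exact.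
  rewrite of_lattice0 !subr0 ler_expR lerN2 ler_wpM2l ?(ltW kap0)//.
  apply: (le_trans (ler_qform _ _)); rewrite ler_wpM2l ?mulr_ge0 ?mxsum_ge0//.
  by rewrite lerXn2r ?nnegrE// fdomain_norm.
Qed.

Lemma gmass_gt0 kap : 0 < kap -> 0 < gmass kap.
Proof.
move=> kap0; apply: lt_le_trans (gmass_ge kap0 (_ : 0 <= 1 <= 1)).
  by rewrite mulr_gt0 ?expR_gt0// exprn_gt0.
by rewrite ler01 lexx.
Qed.

(* Concentration: beyond radius delta the density of parameter k is at most
   expR (- (k - 1) q delta^2) times that of parameter 1, while the total mass
   decays with an arbitrarily small rate. *)
Lemma gauss_concentration (delta q e : R) : 0 < delta -> 0 < q -> 0 < e ->
  exists N : nat, forall k, (N <= k)%N -> (0 < k)%N ->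
  expR (- ((k%:R - 1) * (q * delta ^+ 2))) * gmass 1 <= e * gmass k%:R.
Proof.
move=> d0 q0 e0; pose x := q * delta ^+ 2.
have x0 : 0 < x by rewrite mulr_gt0 ?exprn_gt0.
pose M := n%:R * mxsum Q + 1.
have M0 : 0 < M by rewrite ltr_wpDl ?mulr_ge0 ?mxsum_ge0.
(* With such an eta the mass of parameter k is at least exp(-k x / 2) eta^n, which leaves a spare
   factor exp(-k x / 2) in the tail exp(-(k - 1) x). *)
have [eta /andP[eta0 eta1] hM] : exists2 eta : R, 0 < eta <= 1 &
    n%:R * mxsum Q * eta ^+ 2 <= x / 2.
  exists (Num.min 1 (x / (2 * M))).
    by rewrite lt_min ltr01 divr_gt0 ?mulr_gt0//= ge_min lexx.
  set eta := Num.min _ _; have eta0 : 0 <= eta by rewrite le_min ler01 divr_ge0 ?mulr_ge0 ?ltW.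
  have eta1 : eta <= 1 by rewrite ge_min lexx.
  have eta2 : eta <= x / (2 * M) by rewrite ge_min lexx orbT.
  apply: (@le_trans _ _ (M * eta)).
    apply: ler_pM; rewrite ?mulr_ge0 ?mxsum_ge0 ?sqr_ge0//; first by rewrite /M lerDl.
    by rewrite expr2 ler_piMl.
  apply: (le_trans (ler_wpM2l (ltW M0) eta2)).
  rewrite (_ : M * _ = x / 2)//; field; exact: lt0r_neq0.
have Z0 : 0 < gmass 1 by exact: gmass_gt0.
pose c := e * eta ^+ n / (gmass 1 * expR x).
have c0 : 0 < c by rewrite divr_gt0 ?mulr_gt0 ?exprn_gt0 ?expR_gt0.
(* For these k, 1 / c <= k x / 2 <= exp(k x / 2), so that the spare factor is at most c. *)
exists (Num.bound (c^-1 / (x / 2))) => k Nk k0.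
have kR : 0 < k%:R :> R by rewrite ltr0n.
have hk : c^-1 <= k%:R * (x / 2).
  rewrite -ler_pdivrMr ?divr_gt0//; apply: (@le_trans _ _ (Num.bound (c^-1 / (x / 2)))%:R).
    by apply: ltW; apply: archi_boundP; rewrite ltW// divr_gt0 ?invr_gt0// divr_gt0.
  by rewrite ler_nat.
have eta01 : 0 <= eta <= 1 by rewrite ltW.
have := gmass_ge kR eta01 => hZ.
apply: (@le_trans _ _ (e * (expR (- (k%:R * (x / 2))) * eta ^+ n))); last first.
  rewrite ler_wpM2l ?(ltW e0)//; apply: le_trans hZ.
  rewrite ler_wpM2r ?exprn_ge0 ?(ltW eta0)// ler_expR lerN2.
  by rewrite ler_wpM2l// ltW.
rewrite (_ : - ((k%:R - 1) * _) = x - k%:R * (x / 2) - k%:R * (x / 2)); last first.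
  by rewrite /x; field.
rewrite !expRD [leRHS](_ : _ = c * (gmass 1 * expR x) * expR (- (k%:R * (x / 2)))); last first.
  by rewrite /c divfK ?mulf_neq0 ?gt_eqF ?expR_gt0//; ring.
set E := expR (- _).
rewrite (_ : _ * gmass 1 = E * (expR x * E * gmass 1)); last by ring.
rewrite (_ : c * _ * _ = c * (expR x * E * gmass 1)); last by ring.
apply: ler_wpM2r; first by rewrite ltW// !mulr_gt0 ?expR_gt0.
rewrite /E.
rewrite expRN invf_ple ?posrE ?expR_gt0//.
apply: (le_trans hk); apply: le_trans (expR_ge1Dx _).
by rewrite lerDr.
Qed.

End Gaussians.

(** * Theta functions *)

Section SmoothExtra.
Context {R : realType} {W : normedModType R}.

Lemma smooth_affine (s : W -> R[i]) (d : W -> R[i]) : ccont s ->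
  (forall p v, is_cder s p v (d v)) -> smooth s.
Proof.
move=> cs ds m; case: m => [|m]; first by case: cs => ? ?; split; split.
by apply: (@cCm_der _ _ m s (fun v _ => d v)) => // v; exact: cCm_cst.
Qed.

Lemma smooth_exp_der (s : W -> R[i]) (c : W -> W -> R[i]) : ccont s ->
  (forall v, smooth (c v)) -> (forall p v, is_cder s p v (c v p * s p)) -> smooth s.
Proof.
move=> cs cc ds m; elim: m => [|m IH]; first by case: cs => ? ?; split; split.
apply: (@cCm_der _ _ m s (fun v p => c v p * s p)) => // v.
by apply: cCmM => //; exact: cc.
Qed.

End SmoothExtra.

Section HasSumFinite.
Context {R : realType} {I : choiceType}.

Lemma has_sum_sum (J : Type) (r : seq J) (f : J -> I -> R[i]) (S : J -> R[i]) :
  (forall j, has_sum (f j) (S j)) ->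
  has_sum (fun i => \sum_(j <- r) f j i) (\sum_(j <- r) S j).
Proof.
move=> fS; elim: r => [|j r IH].
  have := @has_sum_fin R I (fun=> 0) fset0 (fun _ _ => erefl).
  by rewrite big_seq_fset0 big_nil; apply: eq_has_sum => i; rewrite big_nil.
by rewrite big_cons; apply: eq_has_sum (has_sumD (fS j) IH) => i; rewrite big_cons.
Qed.

End HasSumFinite.

Section ThetaFunctions.
Context {R : realType} {n : nat} (k : nat) (P Q : 'M[R]_n).
Hypothesis k0 : (0 < k)%N.
Hypothesis P_sym : P^T = P.
Hypothesis Q_sym : Q^T = Q.
Hypothesis Q_pos : pos_def Q.
Local Notation V := 'rV[R]_n.
Local Notation E := (V * V)%type.
Local Notation lattice := 'rV[int]_n.
Local Notation L := (of_lattice R).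
Local Notation incl := (@inclass R n k).
Implicit Types (x y v t : V) (l m r : lattice) (b c : Bk n k) (p : E).

Let kR : (k%:R : R) != 0. Proof. by rewrite pnatr_eq0 -lt0n. Qed.
Let kR0 : 0 < (k%:R : R). Proof. by rewrite ltr0n. Qed.

(** The exponent (i k / 2) v Omega v^T of [Psi], with the contributions of P and Q separated. *)
Definition gauss_exp v : R[i] := 'i * (k%:R / 2 * qform P v)%:C - (k%:R / 2 * qform Q v)%:C.

Definition gauss_scale : R := (Num.sqrt (2 * pi)) ^- n * a_coef k Q.

Definition gauss_term l x : R[i] := gauss_scale%:C * cexp (gauss_exp (x - scaled k l)).

Lemma gauss_scale_ge0 : 0 <= gauss_scale.
Proof. by rewrite mulr_ge0// ?invr_ge0 ?exprn_ge0 ?sqrtr_ge0. Qed.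

Lemma qform_Omega v : qform (Omega P Q) (map_mx (fun a => a%:C) v) =
  (qform P v)%:C + 'i * (qform Q v)%:C.
Proof.
rewrite /qform !rc_sum mulr_sumr -big_split; apply: eq_bigr => i _ /=.
rewrite !rc_sum mulr_sumr -big_split; apply: eq_bigr => j _ /=.
by rewrite !mxE !rcM; rewrite [(_ +i* _)](_ : _ = (P i j)%:C + 'i * (Q i j)%:C); [ring|simpc].
Qed.

Lemma PsiE l x t : Psi k P Q l (x, t) = gauss_term l x * echar l t.
Proof.
rewrite /Psi /gauss_term /= qform_Omega; congr (_ * cexp _ * _).
have e : k%:R = (k%:R : R)%:C :> R[i] by rewrite rmorph_nat.
have e2 : 2%:R = (2%:R : R)%:C :> R[i] by rewrite rmorph_nat.
rewrite /gauss_exp /scaled e e2 !rcM rcV -/(L l).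
rewrite [RHS](_ : _ = 'i * (k%:R)%:C * (2%:R)%:C^-1 * (qform P (x - k%:R^-1 *: L l))%:C
  + ('i ^+ 2) * (k%:R)%:C * (2%:R)%:C^-1 * (qform Q (x - k%:R^-1 *: L l))%:C).
  by ring.
by rewrite sqr_i; ring.
Qed.

Lemma cmod_cexp_gauss_exp v : cmod (cexp (gauss_exp v)) = gauss Q (k%:R / 2) v.
Proof. by rewrite cmod_cexp /gauss /gauss_exp ReD ReN ReM /=; congr expR; rewrite mulr0 mul0r; ring. Qed.

Lemma gauss_exp_half_scale v l : gauss Q (k%:R / 2) (v - scaled k l) =
  gauss Q (2 * k%:R)^-1 (k%:R *: v - L l).
Proof.
rewrite /gauss -[k%:R *: v - L l](_ : k%:R *: (v - scaled k l) = _).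
  by rewrite qformZ; congr expR; field.
by rewrite scalerBr scalerA mulfV// scale1r.
Qed.

Lemma gauss_term_decay (rho : R) : 0 <= rho -> exists2 C : R, 0 <= C &
  forall x l, `|x| <= rho -> cmod (gauss_term l x) <= C * wt R l.
Proof.
move=> rho0; have h0 : 0 < (2 * k%:R)^-1 :> R by rewrite invr_gt0 mulr_gt0.
have [C C0 hC] := gauss_wt Q_pos h0 (mulr_ge0 (ltW kR0) rho0).
exists (gauss_scale * C); first by rewrite mulr_ge0// gauss_scale_ge0.
move=> x l xr; rewrite cmodM cmod_real ger0_norm ?gauss_scale_ge0// -mulrA ler_wpM2l ?gauss_scale_ge0//.
rewrite cmod_cexp_gauss_exp gauss_exp_half_scale; apply: hC.
by rewrite normrZ ger0_norm ?ler_wpM2l// ltW.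
Qed.

Lemma gauss_term_shift l m x : gauss_term (l + Posz k *: m) (x + L m) = gauss_term l x.
Proof.
rewrite /gauss_term scaledD scaled_mul//; congr (_ * cexp (gauss_exp _)).
by rewrite opprD addrACA subrr addr0.
Qed.

Lemma ccont_gauss_exp : ccont gauss_exp.
Proof.
apply: ccontB; first apply: ccontZ; apply: ccont_real; apply: ctM; try exact: ct_cst; exact: ct_qform.
Qed.

Lemma ccont_gauss_term l : ccont (gauss_term l).
Proof.
apply: ccontZ; apply: ccont_cexp; apply: (ccont_comp _ ccont_gauss_exp).
exact: ct_shift.
Qed.

(** When the quadratic exponent of a term is expanded, the square in x factors out of the whole sum
    and the square in l / k is a coefficient; what depends on both is this form, linear in p. A
    theta function is thus a Gaussian in x times a series of exponentials of linear forms, to which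
    the general results apply. *)
Definition theta_exp l (p : E) : R[i] :=
  'i * (dot (L l) (p.2 - p.1 *m P))%:C + (dot (L l) (p.1 *m Q))%:C.

Definition theta_expK : R := 1 + mxsum P + mxsum Q.

Lemma theta_expK_ge0 : 0 <= theta_expK.
Proof. by rewrite !addr_ge0 ?mxsum_ge0. Qed.

Lemma theta_expD l p (h : R) (v : E) : theta_exp l (p + h *: v) = theta_exp l p + h%:C * theta_exp l v.
Proof.
case: p v => [x t] [y s]; rewrite /theta_exp /= !mulmxDl -!scalemxAl.
rewrite !dotDr !dotNr !dotDr !dotZr !rcD !rcN !rcD !rcM; ring.
Qed.

Lemma theta_exp_le l p : cmod (theta_exp l p) <= theta_expK * lat1 l * `|p|.
Proof.
have x1 : `|p.1| <= `|p| by rewrite prod_normE le_max lexx.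
have x2 : `|p.2| <= `|p| by rewrite prod_normE le_max lexx orbT.
apply: (le_trans (ler_cmodD _ _)); rewrite cmodM cmodi mul1r !cmod_real.
have h1 := ler_dot_lattice l (p.2 - p.1 *m P); have h2 := ler_dot_lattice l (p.1 *m Q).
apply: (le_trans (lerD h1 h2)); rewrite -mulrDr [theta_expK * _]mulrC -mulrA ler_wpM2l ?lat1_ge0//.
rewrite /theta_expK !mulrDl mul1r; apply: lerD.
  apply: (le_trans (ler_normB _ _)); apply: lerD => //.
  by apply: (le_trans (ler_norm_mulmx _ _)); rewrite ler_wpM2l ?mxsum_ge0.
by apply: (le_trans (ler_norm_mulmx _ _)); rewrite ler_wpM2l ?mxsum_ge0.
Qed.

Lemma gauss_expD x y : gauss_exp (x + y) = gauss_exp x + gauss_exp y + ('i * (k%:R * dot (x *m P) y)%:C - (k%:R * dot (x *m Q) y)%:C).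
Proof.
rewrite /gauss_exp !qformD// !rcM !rcD !rcM rcV; field.
by [].
Qed.

Lemma gauss_expN x : gauss_exp (- x) = gauss_exp x.
Proof. by rewrite /gauss_exp !qformN. Qed.

Lemma gauss_term_echarE l p : gauss_term l p.1 * echar l p.2 =
  gauss_scale%:C * cexp (gauss_exp p.1) * (cexp (gauss_exp (scaled k l)) * cexp (theta_exp l p)).
Proof.
have e : cexp (gauss_exp (p.1 - scaled k l)) * echar l p.2 =
  cexp (gauss_exp p.1) * (cexp (gauss_exp (scaled k l)) * cexp (theta_exp l p)); last first.
  by rewrite /gauss_term -[LHS]mulrA e -[RHS]mulrA.
rewrite /echar -!cexpD; congr cexp.
rewrite gauss_expD gauss_expN !dotNr /scaled !dotZr !mulrN !(mulrA k%:R) !mulfV//.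
rewrite /theta_exp dotDr dotNr !mul1r ![dot (_ *m _) _]dotC !rcD !rcN.
ring.
Qed.

Definition theta_amp b l : R[i] := if incl b l then cexp (gauss_exp (scaled k l)) else 0.

Lemma rapid_theta_amp b : rapid (theta_amp b).
Proof.
move=> s; have h0 : 0 < (2 * k%:R)^-1 :> R by rewrite invr_gt0 mulr_gt0.
have [C C0 hC] := gauss_rapid Q_pos s h0 (lexx 0).
exists C => l; apply: le_trans (hC 0 l _); last by rewrite normr0.
rewrite ler_wpM2r ?expR_ge0// /theta_amp; case: ifP => _; last by rewrite cmod0 expR_ge0.
by rewrite cmod_cexp_gauss_exp -[in leRHS](scaler0 _ k%:R) -gauss_exp_half_scale sub0r /gauss qformN.
Qed.

Definition theta_series b p : R[i] := exp_series theta_exp (theta_amp b) p.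

Lemma Theta_term b l p : (if incl b l then gauss_term l p.1 else 0) * echar l p.2 =
  gauss_scale%:C * cexp (gauss_exp p.1) * (theta_amp b l * cexp (theta_exp l p)).
Proof. by rewrite /theta_amp; case: ifP => _; [rewrite gauss_term_echarE|rewrite !mul0r mulr0]. Qed.

Definition theta_coef b x l : R[i] := if incl b l then gauss_term l x else 0.

Lemma Theta_has_sum_series b p :
  has_sum (fun l => theta_coef b p.1 l * echar l p.2)
    (gauss_scale%:C * cexp (gauss_exp p.1) * theta_series b p).
Proof.
apply: eq_has_sum (has_sumZ (gauss_scale%:C * cexp (gauss_exp p.1))
  (exp_series_has_sum theta_expK_ge0 theta_exp_le p (rapid_theta_amp b))) => l.
by rewrite -Theta_term.
Qed.

Lemma ThetaE b p : Theta P Q b p = gauss_scale%:C * cexp (gauss_exp p.1) * theta_series b p.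
Proof.
rewrite /Theta; apply: library_sumE; apply: eq_has_sum (Theta_has_sum_series b p) => l.
rewrite /theta_coef /inclass -/(scaled k l); case: p => x t /=.
by case: asboolP => _; rewrite ?PsiE ?mul0r.
Qed.

Lemma Theta_has_sum b x t : has_sum (fun l => theta_coef b x l * echar l t) (Theta P Q b (x, t)).
Proof. by rewrite ThetaE; exact: (Theta_has_sum_series b (x, t)). Qed.

Lemma theta_coef_decay b x : exists2 C : R, 0 <= C & forall l, cmod (theta_coef b x l) <= C * wt R l.
Proof.
have [C C0 hC] := gauss_term_decay (normr_ge0 x); exists C => // l.
by rewrite /theta_coef; case: ifP => _; [exact: hC|rewrite cmod0 mulr_ge0 ?wt_ge0].
Qed.

Lemma Theta_fourier_series b x : (fun t => Theta P Q b (x, t)) = fourier_series (theta_coef b x).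
Proof.
have [C C0 hC] := theta_coef_decay b x; apply/funext => t.
exact: has_sum_uniq (Theta_has_sum b x t) (fourier_series_has_sum hC t).
Qed.

Lemma gauss_exp_cder (p v : E) : is_cder (fun p : E => gauss_exp p.1) p v
  ('i * (k%:R * dot (v.1 *m P) p.1)%:C - (k%:R * dot (v.1 *m Q) p.1)%:C).
Proof.
apply: (@is_cder_poly2 _ _ _ _ _ _ (gauss_exp v.1)) => h /=.
rewrite gauss_expD (_ : gauss_exp (h *: v.1) = (h ^+ 2)%:C * gauss_exp v.1); last first.
  by rewrite /gauss_exp !qformZ; move: (h ^+ 2) => a; rewrite !rcM; ring.
by rewrite (dot_mulmxC _ _ P_sym) (dot_mulmxC _ _ Q_sym) -!scalemxAl !dotZl !rcM; ring.
Qed.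

Lemma ccont_gauss_exp1 : ccont (fun p : E => gauss_exp p.1).
Proof. exact: (ccont_comp (@ct_fst _ _) ccont_gauss_exp). Qed.

Lemma smooth_prefactor : smooth (fun p : E => cexp (gauss_exp p.1)).
Proof.
apply: (@smooth_exp_der _ _ _ (fun v p : E =>
  'i * (k%:R * dot (v.1 *m P) p.1)%:C - (k%:R * dot (v.1 *m Q) p.1)%:C)).
- by apply: ccont_cexp; exact: ccont_gauss_exp1.
- move=> v; apply: (@smooth_affine _ _ _ (fun w : E =>
    'i * (k%:R * dot (v.1 *m P) w.1)%:C - (k%:R * dot (v.1 *m Q) w.1)%:C)).
    by apply: ccontB; first apply: ccontZ; apply: ccont_real; apply: ctM;
      [exact: ct_cst| |exact: ct_cst|]; apply: ct_dot; [exact: ct_const|exact: (@ct_fst V V)|exact: ct_const|exact: (@ct_fst V V)].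
  move=> p w; apply: (@is_cder_poly2 _ _ _ _ _ _ 0) => h /=.
  by rewrite !dotDr !dotZr !rcM !rcD !rcM; ring.
- by move=> p v; apply: is_cder_cexp; exact: gauss_exp_cder.
Qed.

Lemma ThetaF b : Theta P Q b = fun p => gauss_scale%:C * cexp (gauss_exp p.1) * theta_series b p.
Proof. by apply/funext => p; exact: ThetaE. Qed.

Lemma smooth_Theta b : smooth (Theta P Q b).
Proof.
rewrite ThetaF; apply: smoothM; first by apply: smoothZ; exact: smooth_prefactor.
by apply: (exp_series_smooth theta_expK_ge0 theta_expD theta_exp_le); exact: rapid_theta_amp.
Qed.

(** Translating x by m permutes the terms, l becoming l + k m within its residue class, and the
    change of character is the multiplier of L^k. *)
Lemma Theta_section b : is_section k (Theta P Q b).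
Proof.
split=> m x t; last first.
  apply: has_sum_uniq (Theta_has_sum b _ _) _.
  by apply: eq_has_sum (Theta_has_sum b x t) => l; rewrite echar_periodic.
apply: has_sum_uniq (Theta_has_sum b _ _) _.
apply: (has_sum_reindex (h := fun l => l + Posz k *: m) _ (@addIr _ _) _).1.
  by move=> l _; exists (l - Posz k *: m); rewrite subrK.
apply: eq_has_sum (has_sumZ _ (Theta_has_sum b x t)) => l /=.
rewrite /theta_coef inclass_mul// gauss_term_shift echarD mulrC -mulrA; congr (_ * _).
congr (_ * _).
by rewrite /echar of_latticeZ dotZl.
Qed.

Lemma Theta_cder b p (v : E) : cderive (Theta P Q b) p v =
  gauss_scale%:C * cexp (gauss_exp p.1) * (('i * (k%:R * dot (v.1 *m P) p.1)%:C - (k%:R * dot (v.1 *m Q) p.1)%:C) *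
    theta_series b p + exp_series theta_exp (fun l => theta_amp b l * theta_exp l v) p).
Proof.
have h1 : is_cder (fun p : E => gauss_scale%:C * cexp (gauss_exp p.1)) p v
    (gauss_scale%:C * (('i * (k%:R * dot (v.1 *m P) p.1)%:C - (k%:R * dot (v.1 *m Q) p.1)%:C) * cexp (gauss_exp p.1))).
  by apply: is_cderZ; apply: is_cder_cexp; exact: gauss_exp_cder.
have h2 := exp_series_cder theta_expK_ge0 theta_expD theta_exp_le p v (rapid_theta_amp b).
by rewrite ThetaF (is_cder_cderive (is_cderM h1 h2)) -/(theta_series b p); ring.
Qed.

Lemma delta_mulmx (A : 'M[R]_n) (i : 'I_n) x : A^T = A ->
  dot (delta_mx ord0 i *m A) x = (x *m A) ord0 i.
Proof. by move=> As; rewrite (dot_mulmxC _ _ As) dot_delta. Qed.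

Lemma Omega_row i (x : V) : \sum_(j < n) Omega P Q i j * (x ord0 j)%:C =
  ((x *m P) ord0 i)%:C + 'i * ((x *m Q) ord0 i)%:C.
Proof.
rewrite !mxE !rc_sum mulr_sumr -big_split; apply: eq_bigr => j _ /=.
rewrite mxE !rcM -{2}P_sym -{2}Q_sym !mxE.
by rewrite [(_ +i* _)](_ : _ = (P i j)%:C + 'i * (Q i j)%:C); [ring|simpc].
Qed.

(** Two separate cancellations, each from 1 + i^2 = 0: the linear exponents are annihilated by the
    vectors of type (0,1) term by term, and the x-derivative of the Gaussian prefactor compensates
    the connection form. *)
Lemma Theta_nabla b i p : nabla k (d_x R i) (Theta P Q b) p +
  \sum_(j < n) Omega P Q i j * nabla k (d_theta R j) (Theta P Q b) p = 0.
Proof.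
case: p => x t.
pose F := gauss_scale%:C * cexp (gauss_exp x).
pose Ev (v : E) := exp_series theta_exp (fun l => theta_amp b l * theta_exp l v) (x, t).
have e1 : nabla k (d_x R i) (Theta P Q b) (x, t) =
    F * (('i * (k%:R * (x *m P) ord0 i)%:C - (k%:R * (x *m Q) ord0 i)%:C) * theta_series b (x, t) + Ev (d_x R i)).
  by rewrite /nabla Theta_cder /= dot0r mulr0 mulr0 mul0r subr0 !delta_mulmx.
have e2 j : nabla k (d_theta R j) (Theta P Q b) (x, t) =
    F * (Ev (d_theta R j) - 'i * k%:R%:C * (x ord0 j)%:C * theta_series b (x, t)).
  rewrite /nabla Theta_cder /= !mul0mx !dot0l !mulr0 subrr mul0r add0r dot_delta ThetaE /=.
  by rewrite (rcM k%:R) /F /Ev; ring.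
have e3 : Ev (d_x R i) + \sum_(j < n) Omega P Q i j * Ev (d_theta R j) = 0.
  have hs (v : E) := exp_series_has_sum theta_expK_ge0 theta_exp_le (x, t) (rapid_lam theta_expK_ge0 theta_exp_le v (rapid_theta_amp b)).
  have h := has_sumD (hs (d_x R i)) (has_sum_sum (index_enum 'I_n) (fun j => has_sumZ (Omega P Q i j) (hs (d_theta R j)))).
  apply: (has_sum_uniq h).
  have := has_sumZ 0 h; rewrite mul0r; apply: eq_has_sum => l; rewrite mul0r /=.
  rewrite (eq_bigr (fun j => theta_amp b l * 'i * cexp (theta_exp l (x, t)) * (Omega P Q i j * (L l ord0 j)%:C))); last first.
    by move=> j _; rewrite {1}/theta_exp /= mul0mx subr0 mul0mx dot0r addr0 dot_delta; ring.
  rewrite -mulr_sumr Omega_row {1}/theta_exp /= sub0r dotNr ![dot (L l) _]dotC !delta_mulmx// rcN.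
  rewrite [RHS](_ : _ = (1 + 'i ^+ 2) * ((L l *m Q) ord0 i)%:C * theta_amp b l * cexp (theta_exp l (x, t))); last by ring.
  by rewrite sqr_i subrr !mul0r.
rewrite e1 (eq_bigr (fun j => F * (Omega P Q i j * Ev (d_theta R j)) +
   (- F * 'i * k%:R%:C * theta_series b (x, t)) * (Omega P Q i j * (x ord0 j)%:C))); last first.
  by move=> j _; rewrite e2; ring.
rewrite big_split /= -!mulr_sumr Omega_row.
move/eqP: e3; rewrite addrC addr_eq0 => /eqP ->.
rewrite !(rcM k%:R).
rewrite [LHS](_ : _ = - (1 + 'i ^+ 2) * F * k%:R%:C * theta_series b (x, t) * ((x *m Q) ord0 i)%:C); last by ring.
by rewrite sqr_i subrr oppr0 !mul0r.
Qed.

Lemma Theta_H0 b : H0 k (Omega P Q) (Theta P Q b).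
Proof. by split; [exact: smooth_Theta|exact: Theta_section|exact: Theta_nabla]. Qed.

End ThetaFunctions.

Lemma is_cder0_line {R : realType} (W : normedModType R) (F : W -> R[i]) (v : W) :
  (forall x, is_cder F x v 0) -> forall x (h : R), F (x + h *: v) = F x.
Proof.
move=> dF x h.
have st (G : W -> R) : (forall y, is_derive y v G 0) -> G (x + h *: v) = G x.
  move=> dG; have d1 (s : R) : is_derive s 1 (fun s : R => G (x + s *: v)) 0.
    exact: (proj1 (is_derive_line G x v 0 s) (dG (x + s *: v))).
  by have := @is_derive_0_is_cst R (fun s => G (x + s *: v)) h 0 d1; rewrite scale0r addr0.
have := st (fun y => complex.Im (F y)) (fun y => (dF y).2).
have := st (fun y => complex.Re (F y)) (fun y => (dF y).1).
by case: (F (x + h *: v)) (F x) => [a b] [c d] /= -> ->.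
Qed.

(** * Holomorphic sections are combinations of theta functions *)

Section Holomorphic.
Context {R : realType} {n : nat} (k : nat) (P Q : 'M[R]_n).
Hypothesis k0 : (0 < k)%N.
Hypothesis P_sym : P^T = P.
Hypothesis Q_sym : Q^T = Q.
Hypothesis Q_pos : pos_def Q.
Local Notation V := 'rV[R]_n.
Local Notation E := (V * V)%type.
Local Notation lattice := 'rV[int]_n.
Local Notation L := (of_lattice R).
Local Notation incl := (@inclass R n k).
Local Notation Om := (Omega P Q).
Local Notation Th := (Theta P Q).
Implicit Types (x y t : V) (l m r : lattice) (b c : Bk n k) (p : E) (u : E -> R[i]).

Let kR0 : 0 < (k%:R : R). Proof. by rewrite ltr0n. Qed.

Lemma gauss_scale_gt0 : 0 < gauss_scale k Q.
Proof.
rewrite mulr_gt0// invr_gt0.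
  by rewrite exprn_gt0// sqrtr_gt0 pi2_gt0.
by rewrite sqrtr_gt0; exact: (gmass_gt0 Q_pos kR0).
Qed.

Lemma flat_cst (F : V -> R[i]) : (forall x i, is_cder F x (delta_mx ord0 i) 0) ->
  forall x, F x = F 0.
Proof.
move=> dF.
have step x i (h : R) : F (x + h *: delta_mx ord0 i) = F x.
  exact: (@is_cder0_line _ _ F (delta_mx ord0 i) (fun y => dF y i)).
have steps x y (s : seq 'I_n) : F (y + \sum_(i <- s) x ord0 i *: delta_mx ord0 i) = F y.
  elim: s => [|i s IH]; first by rewrite big_nil addr0.
  by rewrite big_cons addrCA addrC step.
by move=> x; rewrite {1}[x]row_sum_delta -[X in F X = _]add0r steps.
Qed.

Definition section_coef u l : R[i] := fiber_coef u l 0 * cexp (- gauss_exp k P Q (- scaled k l)).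

(** The holomorphy equation trades the derivative in x for angular derivatives, which act on Fourier
    coefficients by multiplication. *)
Lemma fiber_coef_H0_cder u l x i : H0 k Om u ->
  is_cder (fiber_coef u l) x (delta_mx ord0 i) (('i * (k%:R * ((x - scaled k l) *m P) ord0 i)%:C
     - (k%:R * ((x - scaled k l) *m Q) ord0 i)%:C) * fiber_coef u l x).
Proof.
move=> [su [_ au] nu]; have pu : angle_periodic u by move=> y m t; rewrite au.
apply: is_cder_eq (fiber_coef_cder l x (delta_mx ord0 i) su) _.
have e t : cderive u (x, t) (delta_mx ord0 i, 0) = \sum_(j < n) (- Om i j) *
    (cderive u (x, t) (d_theta R j) + (- ('i * k%:R%:C * (x ord0 j)%:C)) * u (x, t)).
  have := nu i (x, t); rewrite {1}/nabla /= dot0r mulr0 mulr0 mul0r subr0.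
  move/eqP; rewrite addr_eq0 => /eqP ->; rewrite -sumrN; apply: eq_bigr => j _.
  by rewrite /nabla /= dot_delta (rcM k%:R); ring.
have cu : ccont (fun t => u (x, t)) by apply: ccont_slice; exact: smooth_ccont.
have cd j : ccont (fun t => cderive u (x, t) (d_theta R j)).
  exact: (ccont_slice x (smooth_ccont (smooth_cderive (d_theta R j) su))).
rewrite /fiber_coef (_ : (fun t => _) = fun t => \sum_(j < n) (- Om i j) *
  (cderive u (x, t) (d_theta R j) + (- ('i * k%:R%:C * (x ord0 j)%:C)) * u (x, t))); last first.
  by apply/funext => t; rewrite e.
rewrite fourier_coef_sum; last first.
  by move=> j; apply: ccontZ; apply: ccontD => //; exact: ccontZ.
rewrite (eq_bigr (fun j => 'i * k%:R%:C * fiber_coef u l x * (Om i j * ((x - scaled k l) ord0 j)%:C))); last first.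
  move=> j _; rewrite fourier_coefZ; last by apply: ccontD => //; exact: ccontZ.
  rewrite fourier_coefD//; last exact: ccontZ.
  rewrite fourier_coefZ// -[fourier_coef (fun t => cderive _ _ _) l]/(fiber_coef (fun p => cderive u p (d_theta R j)) l x).
  rewrite fiber_coef_cderive_angle// dot_delta -[fourier_coef _ l]/(fiber_coef u l x).
  rewrite !mxE rcB rcM rcV; field.
  by rewrite -(rmorph_nat (real_complex R)) fmorph_eq0 gt_eqF.
rewrite -mulr_sumr Omega_row// -[fourier_coef _ l]/(fiber_coef u l x) !(rcM k%:R).
rewrite [LHS](_ : _ = ('i * (k%:R%:C * (((x - scaled k l) *m P) ord0 i)%:C) +
   'i ^+ 2 * (k%:R%:C * (((x - scaled k l) *m Q) ord0 i)%:C)) * fiber_coef u l x); last by ring.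
by rewrite sqr_i mulN1r.
Qed.

(** Divided by the Gaussian centred at l / k, which satisfies the same first order equation, the
    coefficient has zero derivative. *)
Lemma fiber_coef_H0 u l x : H0 k Om u -> fiber_coef u l x = section_coef u l * cexp (gauss_exp k P Q (x - scaled k l)).
Proof.
move=> Hu; pose F x := fiber_coef u l x * cexp (- gauss_exp k P Q (x - scaled k l)).
have FE : F x = F 0.
  apply: flat_cst => y i.
  have h1 := fiber_coef_H0_cder l y i Hu.
  have h2 : is_cder (fun z => - gauss_exp k P Q (z - scaled k l)) y (delta_mx ord0 i)
     (- ('i * (k%:R * ((y - scaled k l) *m P) ord0 i)%:C - (k%:R * ((y - scaled k l) *m Q) ord0 i)%:C)).
    apply: (@is_cder_poly2 _ _ _ _ _ _ (- gauss_exp k P Q (delta_mx ord0 i))) => h.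
    rewrite addrAC gauss_expD// dotZr dotZr !dot_delta.
    rewrite (_ : gauss_exp k P Q (h *: _) = (h ^+ 2)%:C * gauss_exp k P Q (delta_mx ord0 i)); last first.
      by rewrite /gauss_exp !qformZ; move: (h ^+ 2) => a; rewrite !rcM; ring.
    move: (h ^+ 2) (gauss_exp _ _ _ _) (gauss_exp _ _ _ _) => a A B; rewrite !(rcM k%:R) !(rcM h); ring.
  by apply: is_cder_eq (is_cderM h1 (is_cder_cexp h2)) _; ring.
have e : cexp (- gauss_exp k P Q (x - scaled k l)) * cexp (gauss_exp k P Q (x - scaled k l)) = 1.
  by rewrite -cexpD addNr cexp0.
transitivity (F x * cexp (gauss_exp k P Q (x - scaled k l))); first by rewrite /F -mulrA e mulr1.
by rewrite FE /F sub0r.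
Qed.

(** Quasi-periodicity makes the multiples of the Gaussians constant on residue classes modulo k,
    leaving one parameter for each point of B_k. *)
Lemma section_coef_shift u l m : H0 k Om u -> section_coef u (l + Posz k *: m) = section_coef u l.
Proof.
move=> Hu; have [su [qu au] nu] := Hu.
have h : fiber_coef u (l + Posz k *: m) (L m) = fiber_coef u l 0.
  rewrite /fiber_coef -[L m]add0r (_ : (fun t => _) = fun t => echar (Posz k *: m) t * u (0, t)).
    by rewrite fourier_coef_echarM addrK.
  by apply/funext => t; rewrite qu /echar of_latticeZ dotZl.
move: h; rewrite !fiber_coef_H0// scaledD scaled_mul//.
rewrite [scaled k l + _]addrC opprD addrA subrr.
by apply: mulIf; exact: cexp_neq0.
Qed.

Lemma H0_span u : H0 k Om u ->
  exists al : Bk n k -> R[i], u = fun p => \sum_(b : Bk n k) al b * Th b p.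
Proof.
move=> Hu; have [su [qu au] nu] := Hu.
pose al b := section_coef u (rep b) / (gauss_scale k Q)%:C.
exists al; apply/funext => -[x t].
have cu : ccont (fun t => u (x, t)) by apply: ccont_slice; exact: smooth_ccont.
have cT b : ccont (fun t => Th b (x, t)).
  by apply: ccont_slice; apply: smooth_ccont; exact: smooth_Theta.
have cS : ccont (fun t => \sum_b al b * Th b (x, t)).
  by apply: ccont_sum => b; exact: ccontZ.
apply/eqP; rewrite -subr_eq0; apply/eqP.
(* Equality on the fiber over x is tested on Fourier coefficients; to the one of index l only the
   class of l contributes. *)
apply: (@fourier_unique _ _ (fun t => u (x, t) - \sum_b al b * Th b (x, t))).
- exact: ccontB.
- move=> m s; rewrite au; congr (_ - _); apply: eq_bigr => b _.
  by rewrite (Theta_section k0 P_sym Q_sym Q_pos b).2.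
move=> l; rewrite (_ : (fun t => _) = fun t => u (x, t) + (-1) * \sum_b al b * Th b (x, t)); last first.
  by apply/funext => s; rewrite mulN1r.
rewrite fourier_coefD// ?fourier_coefZ//; last exact: ccontZ.
rewrite fourier_coef_sum; last by move=> b; exact: ccontZ.
rewrite mulN1r; apply/eqP; rewrite subr_eq0; apply/eqP.
rewrite (eq_bigr (fun b => al b * theta_coef P Q b x l)); last first.
  move=> b _; rewrite fourier_coefZ// Theta_fourier_series//.
  by have [C C0 hC] := theta_coef_decay P k0 Q_pos b x; rewrite (fourier_coef_fourier_series hC).
have [b lb] := @inclass_ex R n k k0 l.
rewrite (bigD1 b)//= [X in _ + X]big1 ?addr0; last first.
  move=> c cb; rewrite /theta_coef ifF ?mulr0//; apply: contraNF cb => lc.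
  by rewrite (inclass_inj k0 lc lb).
rewrite -[LHS]/(fiber_coef u l x) fiber_coef_H0// /theta_coef lb /gauss_term /al.
have /(inclassP k0)[r ->] := lb; rewrite section_coef_shift//.
by field; rewrite fmorph_eq0 gt_eqF ?gauss_scale_gt0.
Qed.

Lemma nabla_sum (I : Type) (s : seq I) (al : I -> R[i]) (T : I -> E -> R[i]) v p :
  (forall i, smooth (T i)) ->
  nabla k v (fun q => \sum_(i <- s) al i * T i q) p = \sum_(i <- s) al i * nabla k v (T i) p.
Proof.
move=> sT; rewrite /nabla (is_cder_cderive (is_cder_sum s (fun i => is_cderZ (al i) (smooth_cder (sT i) p v)))).
by rewrite mulr_sumr -sumrB; apply: eq_bigr => i _; ring.
Qed.

Lemma comb_H0 (al : Bk n k -> R[i]) : H0 k Om (fun p => \sum_(b : Bk n k) al b * Th b p).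
Proof.
have sT b : smooth (Th b) by exact: smooth_Theta.
split.
- by apply: smooth_sum => b; exact: smoothZ.
- have st b := Theta_section k0 P_sym Q_sym Q_pos b.
  split=> m x t.
    by rewrite mulr_sumr; apply: eq_bigr => b _; rewrite (st b).1; ring.
  by apply: eq_bigr => b _; rewrite (st b).2.
- move=> i p; rewrite nabla_sum//.
  under [X in _ + X]eq_bigr => j _ do rewrite nabla_sum// mulr_sumr.
  rewrite exchange_big -big_split big1//= => b _.
  have := congr1 (fun z => al b * z) (Theta_nabla k0 P_sym Q_sym Q_pos b i p).
  rewrite mulr0 mulrDr mulr_sumr => h; apply: etrans h.
  by congr (_ + _); apply: eq_bigr => j _; ring.
Qed.

End Holomorphic.

(** * Inner products of theta functions *)

(* Below a product, z^* denotes the conjugation of a numClosedFieldType;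
   elsewhere it is conjc. *)
Lemma conjE {R : realType} (z : R[i]) : (z^*)%R = z^*.
Proof. by []. Qed.

Section InnerProducts.
Context {R : realType} {n : nat} (k : nat) (P Q : 'M[R]_n).
Hypothesis k0 : (0 < k)%N.
Hypothesis P_sym : P^T = P.
Hypothesis Q_sym : Q^T = Q.
Hypothesis Q_pos : pos_def Q.
Local Notation V := 'rV[R]_n.
Local Notation E := (V * V)%type.
Local Notation lattice := 'rV[int]_n.
Local Notation L := (of_lattice R).
Local Notation incl := (@inclass R n k).
Local Notation Th := (Theta P Q).
Implicit Types (x y z t : V) (l m r p : lattice) (b c : Bk n k).

Let kR0 : 0 < (k%:R : R). Proof. by rewrite ltr0n. Qed.
Let kRn : (k%:R : R) != 0. Proof. by rewrite gt_eqF. Qed.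

Local Notation Z := (gmass Q k%:R).

Let Z0 : 0 < Z. Proof. exact: gmass_gt0. Qed.

(** What two Gaussians with centres p / k apart leave besides a density, at the point z seen from
    the midpoint: the cross term of P, and the loss of overlap exp(-Q(p) / (4 k)). For p fixed it
    tends to 1 as z goes to 0 and k to infinity. *)
Definition phase p z : R[i] :=
  cexp ('i * (dot (z *m P) (L p))%:C - (qform Q (L p) / (4 * k%:R))%:C).

Definition density z : R := gauss Q k%:R z / Z.

Lemma density_ge0 z : 0 <= density z.
Proof. by rewrite divr_ge0 ?gauss_ge0 ?ltW. Qed.

Lemma ct_density : continuous density.
Proof. by apply: ctM; [exact: ct_gauss|exact: ct_cst]. Qed.

Lemma gauss_scale_sqr : gauss_scale k Q ^+ 2 = (2 * pi) ^- n / Z.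
Proof.
have eA : a_coef k Q = (Num.sqrt Z)^-1 by [].
rewrite /gauss_scale eA exprMn !exprVn sqr_sqrtr ?(ltW Z0)//.
by rewrite -exprM mulnC exprM sqr_sqrtr// ltW// pi2_gt0.
Qed.

Lemma gauss_expJ z : (gauss_exp k P Q z)^* = - ('i * (k%:R / 2 * qform P z)%:C) - (k%:R / 2 * qform Q z)%:C.
Proof. by rewrite /gauss_exp; simpc. Qed.

Lemma conjcM (v w : R[i]) : (v * w)^* = v^* * w^*. Proof. exact: rmorphM. Qed.

Lemma conjc_zero : (0 : R[i])^* = 0. Proof. exact: rmorph0. Qed.

Definition midpt l p : V := scaled k l + 2^-1 *: scaled k p.

(** From the midpoint the two arguments are z - e and z + e with e = p / (2 k). Because of the
    conjugation, the squares cancel for P and the cross terms cancel for Q. *)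
Lemma gauss_term_pair l p x : (gauss_term k P Q (l + p) x)^* * gauss_term k P Q l x =
  ((2 * pi) ^- n)%:C * ((density (x - midpt l p))%:C * phase p (x - midpt l p)).
Proof.
have [z ez] : exists z : V, z = x - midpt l p by eexists.
have [e ee] : exists e : V, e = 2^-1 *: scaled k p by eexists.
have ep : scaled k p = e + e by rewrite ee -scalerDl (_ : 2^-1 + 2^-1 = 1) ?scale1r//; field.
have e1 : x - scaled k (l + p) = z - e.
  by rewrite scaledD ep ez /midpt -ee !opprD !addrA.
have e2 : x - scaled k l = z + e by rewrite ez /midpt -ee opprD addrA subrK.
have eL : L p = (2 * k%:R) *: e.
  rewrite ee scalerA (_ : 2 * k%:R * 2^-1 = k%:R); last by field.
  by rewrite /scaled scalerA mulfV// scale1r.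
rewrite -ez /gauss_term e1 e2.
rewrite conjE conjcM !conjE cexpJ conjc_real.
rewrite [LHS](_ : _ = (gauss_scale k Q)%:C ^+ 2 * (cexp (conjc (gauss_exp k P Q (z - e))) * cexp (gauss_exp k P Q (z + e)))); last by ring.
have e3 : cexp (conjc (gauss_exp k P Q (z - e))) * cexp (gauss_exp k P Q (z + e)) = (gauss Q k%:R z)%:C * phase p z.
  rewrite /gauss -cexp_real /phase -!cexpD; congr cexp.
  rewrite gauss_expJ /gauss_exp !qformD// !qformN !dotNr eL dotZr qformZ.
  rewrite (_ : (2 * k%:R) ^+ 2 * qform Q e / (4 * k%:R) = k%:R * qform Q e); last by field.
  rewrite !(rcN, rcM, rcD) rcV; field.
  by [].
rewrite e3 -rcX gauss_scale_sqr /density !(rcM _ Z^-1).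
by move: (phase p z) => u; ring.
Qed.

Lemma midptD l r p : midpt (l + Posz k *: r) p = midpt l p + L r.
Proof. by rewrite /midpt scaledD scaled_mul// addrAC. Qed.

Lemma wt_le1 l : wt R l <= 1.
Proof.
apply: numdomain.Num.Theory.prodr_ile1 => i _.
rewrite invr_ge0 addr_ge0 ?sqr_ge0//= invf_le1 ?lerDl ?sqr_ge0//.
by rewrite ltr_wpDr// sqr_ge0.
Qed.

Lemma fourier_series_bound (c : lattice -> R[i]) (C : R) t : (forall l, cmod (c l) <= C * wt R l) ->
  cmod (fourier_series c t) <= C * 6 ^+ n.
Proof.
move=> cC; apply: (has_sum_bounded_le (fourier_series_has_sum cC t)).
apply: sum_bounded_le (sum_bounded_wtZ (wt_bound_ge0 cC)) => l.
by rewrite cmodM cmod_echar mulr1.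
Qed.

Lemma ccont_Theta b : ccont (Th b).
Proof. by apply: smooth_ccont; exact: smooth_Theta. Qed.

(** Parseval's formula on a fiber: the series of the second factor is integrated termwise against
    the first, and each term is a coefficient of the first. *)
Lemma avg_angle_Theta b c p x :
  has_sum (fun l => theta_coef P Q c x l * (theta_coef P Q b x (l + p))^*)
    (avg (2 * pi) (fun t => (Th b (x, t))^* * (echar p t * Th c (x, t)))).
Proof.
have [Cb Cb0 hb] := theta_coef_decay P k0 Q_pos b x; have [Cc Cc0 hc] := theta_coef_decay P k0 Q_pos c x.
have cb : ccont (fun t => Th b (x, t)) by apply: ccont_slice; exact: ccont_Theta.
have cg : ccont (fun t => (Th b (x, t))^* * echar p t).
  by apply: ccontM; [exact: ccontJ|exact: ccont_echar].
have bg t : cmod ((Th b (x, t))^* * echar p t) <= Cb * 6 ^+ n.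
  rewrite cmodM cmod_echar mulr1 cmodJ.
  have -> : Th b (x, t) = fourier_series (theta_coef P Q b x) t by rewrite -Theta_fourier_series.
  exact: fourier_series_bound.
have := has_sum_avg_fourier_series hc cg bg; rewrite -Theta_fourier_series//.
rewrite (_ : (fun t => _ * Th c (x, t)) = fun t => (Th b (x, t))^* * (echar p t * Th c (x, t))); last first.
  by apply/funext => t; rewrite -mulrA.
apply: eq_has_sum => l; congr (_ * _).
transitivity ((fourier_coef (fun t => Th b (x, t)) (l + p))^*); last by rewrite Theta_fourier_series// (fourier_coef_fourier_series hb).
rewrite -avgJ ?pi2_gt0//; last first.
  by apply: ccontM => //; exact: ccont_echar.
congr avg; apply/funext => t.
by rewrite -mulrA -echarD conjcM !conjE -echarN opprK [l + p]addrC mulrC.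
Qed.

Section Matrix.
Variables (b c : Bk n k) (p : lattice) (h : V -> R[i]).
Hypothesis ch : ccont h.

Definition theta_pairing : R[i] :=
  integral_X (fun z : E => (Th b z)^* * (h z.1 * echar p z.2 * Th c z)).

Let F l x := h x * (theta_coef P Q c x l * (theta_coef P Q b x (l + p))^*).

Let ccont_theta_coef c' l : ccont (fun x => theta_coef P Q c' x l).
Proof. by rewrite /theta_coef; case: (incl c' l); [exact: ccont_gauss_term|exact: ccont_cst]. Qed.

Let ccF l : ccont (F l).
Proof. by apply: ccontM => //; apply: ccontM; [|apply: ccontJ]; exact: ccont_theta_coef. Qed.

Lemma theta_pairing_sum : has_sum (fun l => ((2 * pi) ^+ n)%:C * avg 1 (F l)) theta_pairing.
Proof.
have cT b' : ccont (Th b') by exact: ccont_Theta.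
have ch1 : ccont (fun z : E => h z.1) by exact: (ccont_comp (@ct_fst _ _) ch).
have cG : ccont (fun z : E => (Th b z)^* * (echar p z.2 * Th c z)).
  by apply: ccontM; [exact: ccontJ|apply: ccontM => //; exact: ccont_echar2].
have e (z : E) : (Th b z)^* * (h z.1 * echar p z.2 * Th c z) = h z.1 * ((Th b z)^* * (echar p z.2 * Th c z)).
  by ring.
rewrite /theta_pairing (_ : (fun z : E => _) = fun z : E => h z.1 * ((Th b z)^* * (echar p z.2 * Th c z))); last first.
  by apply/funext => z; exact: e.
rewrite integral_XE; last exact: ccontM.
apply: has_sumZ.
have [M M0 hM] := @ccont_bounded R n 1 _ ch.
have [C C0 hC] := gauss_term_decay P k0 Q_pos (@ler01 R).
have Cw : 0 <= M * (C * C) by rewrite !mulr_ge0.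
have Tb b' x l : fdomain 1 x -> cmod (theta_coef P Q b' x l) <= C * wt R l.
  move=> Dx; rewrite /theta_coef; case: ifP => _; last by rewrite cmod0 mulr_ge0 ?wt_ge0.
  by apply: hC; exact: fdomain_norm.
apply: (@has_sum_avg R n 1 ltr01 _ _ _ _ _ (sum_bounded_wtZ Cw)).
- exact: ccF.
- rewrite (_ : (fun x => _) = fun x => h x * avg (2 * pi) (fun t => (Th b (x, t))^* * (echar p t * Th c (x, t)))).
    by apply: ccontM => //; exact: (ccont_avg_param pi2_gt0 cG).
  apply/funext => x; rewrite /= avgZ ?pi2_gt0//.
  exact: (ccont_slice x cG).
- move=> x Dx l; rewrite /F !cmodM cmodJ -!mulrA.
  apply: ler_pM; rewrite ?cmod_ge0 ?mulr_ge0 ?cmod_ge0//; first exact: hM.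
  (* Of the two weights the one at l is kept for summability; the one at l + p is bounded by 1. *)
  rewrite [leRHS]mulrCA [leRHS]mulrC; apply: ler_pM; rewrite ?cmod_ge0//; first exact: Tb.
  by apply: (le_trans (Tb _ _ _ Dx)); rewrite ler_piMr// wt_le1.
- move=> x Dx /=; rewrite avgZ ?pi2_gt0//; last exact: (ccont_slice x cG).
  by apply: has_sumZ; exact: avg_angle_Theta.
Qed.

Lemma theta_pairing0 : ~~ incl b (rep c + p) -> theta_pairing = 0.
Proof.
move=> nb; apply: (has_sum_uniq theta_pairing_sum).
have := @has_sum_fin R _ (fun l => ((2 * pi) ^+ n)%:C * avg 1 (F l)) fset0.
rewrite big_seq_fset0; apply => l _.
rewrite (_ : F l = fun=> 0) ?avg_cst ?mulr0//; apply/funext => x; rewrite /F /theta_coef.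
case: ifP => [lc|_]; last by rewrite mul0r mulr0.
have -> : incl b (l + p) = false.
  apply: contraNF nb; have /(inclassP k0)[r ->] := lc.
  by rewrite addrAC inclass_mul.
by rewrite conjE conjc_zero !mulr0.
Qed.

(** Only the l = rep c + k r survive, and such an l moves the centre to the midpoint translated by
    r. The sum over l thus unfolds one density over R^n. *)
Lemma theta_pairing1 : incl b (rep c + p) ->
  has_sum (fun r => avg 1 (fun x => h x *
    ((density (x - midpt (rep c) p - L r))%:C * phase p (x - midpt (rep c) p - L r)))) theta_pairing.
Proof.
move=> bc; have hinj : injective (fun r => rep c + Posz k *: r).
  move=> r r' /addrI e; apply: (@of_lattice_inj R n).
  by rewrite -(@scaled_mul R n k k0) e scaled_mul.
have h0 l : ((2 * pi) ^+ n)%:C * avg 1 (F l) != 0 -> exists r, l = rep c + Posz k *: r.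
  move=> hl; apply/(@inclassP R n k k0); apply: contraNT hl => nl.
  rewrite (_ : F l = fun=> 0) ?avg_cst ?mulr0//; apply/funext => x.
  by rewrite /F /theta_coef (negPf nl) mul0r mulr0.
have := (has_sum_reindex (f := fun l => ((2 * pi) ^+ n)%:C * avg 1 (F l)) _ hinj h0).2 theta_pairing_sum.
apply: eq_has_sum => r /=; rewrite -avgZ ?ltr01//; congr avg; apply/funext => x.
rewrite /F /theta_coef inclass_mul// inclass_rep// addrAC inclass_mul// bc.
rewrite [gauss_term _ _ _ _ _ * _]mulrC addrAC gauss_term_pair midptD opprD addrA.
rewrite mulrCA; congr (h x * _).
rewrite [LHS]mulrA -rcM mulfV ?mul1r//.
by rewrite expf_neq0// gt_eqF// pi2_gt0.
Qed.

End Matrix.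

Lemma phase0 z : phase 0 z = 1.
Proof.
by rewrite /phase of_lattice0 qformE mul0mx !dot0r mul0r mulr0 subr0 cexp0.
Qed.

Lemma ccont_phase p : ccont (phase p).
Proof.
apply: ccont_cexp; apply: ccontB; last exact: ccont_cst.
apply: ccontZ; apply: ccont_real; apply: ct_dot; [exact: ct_mulmx|exact: ct_const].
Qed.

Lemma density_sum v :
  has_sum (fun r => (ravg 1 (fun x => density (x - v - L r)))%:C) 1.
Proof.
have := has_sumZ (Z^-1)%:C (gauss_avg_sum Q_pos v kR0).
rewrite -rcM mulVf ?gt_eqF//; apply: eq_has_sum => r.
rewrite -rcM -ravgZ ?ltr01//; last first.
  by under eq_fun do rewrite -addrA; exact: ct_gauss_shift.
by congr (_%:C); congr ravg; apply/funext => x; rewrite mulrC.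
Qed.

(** The case p = 0, h = 1 of the pairing: the phase is 1 and the density has mass 1. *)
Lemma Theta_orthonormal b c : ip_X (Th b) (Th c) = (b == c)%:R.
Proof.
have e : ip_X (Th b) (Th c) = theta_pairing b c 0 (fun=> 1).
  rewrite /ip_X /theta_pairing; congr integral_X; apply/funext => z.
  by rewrite echar0 !mul1r.
rewrite e; have [->|bc] := eqVneq b c; last first.
  apply: theta_pairing0; first exact: ccont_cst.
  rewrite addr0; apply: contraNN bc => bc.
  by rewrite (inclass_inj k0 bc (@inclass_rep R n k k0 c)).
have := theta_pairing1 (ccont_cst 1) (_ : incl c (rep c + 0)).
rewrite addr0 => /(_ (@inclass_rep R n k k0 c)) h; apply: (has_sum_uniq h).
apply: eq_has_sum (density_sum (midpt (rep c) 0)) => r.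
by rewrite -avg_real//; apply: eq_avg => x _; rewrite phase0 mulr1 mul1r.
Qed.

End InnerProducts.

(** * Uniformity, and the limit of the Toeplitz entries *)

Section UniformOnCompacts.
Context {R : realType} {V : normedModType R}.

(** A Lebesgue number argument for an arbitrary relation, so as to serve both for uniform continuity
    and for short segments inside a member of the covering. *)
Lemma compact_uniform (K : set V) (Rel : V -> V -> Prop) : compact K ->
  (forall x, K x -> exists2 d : R, 0 < d &
     forall y z, `|x - y| < d -> `|x - z| < d -> Rel y z) ->
  exists2 d : R, 0 < d & forall x y, K x -> `|x - y| < d -> Rel x y.
Proof.
move=> /compact_near_coveringP cK loc.
have := cK R (at_right 0) (fun d x => forall y, `|x - y| < d -> Rel x y) _.
case.
  move=> x Kx; have [d d0 hd] := loc x Kx.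
  have d20 : 0 < d / 2 by rewrite divr_gt0.
  exists (ball x (d / 2), [set t | t < d / 2]).
    by split; [exact: nbhsx_ballx|exact: nbhs_right_lt].
  move=> [x' t] [/=]; rewrite -ball_normE /= => xx' td y x'y; apply: hd.
    by apply: (lt_trans xx'); rewrite ltr_pdivrMr// ltr_pMr// ltr1n.
  rewrite -(subrKA x') (le_lt_trans (ler_normD _ _))// [d]splitr ltrD//.
  exact: lt_trans td.
move=> e /= e0 he; exists (e / 2); first by rewrite divr_gt0.
move=> x y Kx xy; apply: (he (e / 2)) => //=.
  by rewrite sub0r normrN gtr0_norm ?divr_gt0// ltr_pdivrMr// ltr_pMr// ltr1n.
by rewrite divr_gt0.
Qed.

End UniformOnCompacts.

Section PeriodicFunctions.
Context {R : realType} {n : nat}.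
Local Notation V := 'rV[R]_n.

Lemma periodic1 (h : V -> R[i]) (m : 'rV[int]_n) (x : V) : lattice_periodic 1 h ->
  h (x + of_lattice R m) = h x.
Proof. by move=> /(_ m x); rewrite scale1r. Qed.

Lemma periodic1_unif (h : V -> R[i]) (e : R) : ccont h -> lattice_periodic 1 h -> 0 < e ->
  exists2 d : R, 0 < d & forall x y, `|x - y| < d -> cmod (h x - h y) <= e.
Proof.
move=> ch ph e0; have e20 : 0 < e / 2 by rewrite divr_gt0.
have [|d d0 hd] := @compact_uniform R V (fdomain 1) (fun x y => cmod (h x - h y) <= e)
  (@compact_fdomain R n 1).
  move=> x _; have /ccontP/(_ x _ e20)/nbhs_ballP[d d0 hd] := ch.
  exists d => // y z xy xz; rewrite -(subrKA (h x)) (le_trans (ler_cmodD _ _))// [e]splitr.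
  apply: lerD; last by apply: hd; rewrite -ball_normE.
  by rewrite cmodBC; apply: hd; rewrite -ball_normE.
exists d => // x y xy; have [m Dm] := reduce_fdomain x (@ltr01 R).
rewrite -(ph m x) -(ph m y); apply: hd => //.
by rewrite opprD addrACA subrr addr0.
Qed.

Lemma periodic1_bounded (h : V -> R[i]) : ccont h -> lattice_periodic 1 h ->
  exists2 M : R, 0 <= M & forall x, cmod (h x) <= M.
Proof.
move=> ch ph; have [M M0 hM] := @ccont_bounded R n 1 _ ch.
exists M => // x; have [m Dm] := reduce_fdomain x (@ltr01 R).
by rewrite -(ph m x); exact: hM.
Qed.

End PeriodicFunctions.

Lemma ler_cmod_avg_sub {R : realType} {n : nat} (u : 'rV[R]_n -> R[i]) (v g : 'rV[R]_n -> R)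
    (c : R[i]) : ccont u -> continuous v -> continuous g ->
  (forall x, cmod (u x + c * (v x)%:C) <= g x) ->
  cmod (avg 1 u + c * (ravg 1 v)%:C) <= 2 * ravg 1 g.
Proof.
move=> cu cv cg ug; have cv' : ccont (fun x => (v x)%:C) by exact: ccont_real.
have -> : c * (ravg 1 v)%:C = avg 1 (fun x => c * (v x)%:C) by rewrite avgZ ?ltr01// avg_real.
rewrite -avgD ?ltr01//; last exact: ccontZ.
by apply: ler_cmod_avg => //; apply: ccontD => //; exact: ccontZ.
Qed.

Section SymbolLimit.
Context {R : realType} {n : nat} (P Q : 'M[R]_n).
Hypothesis P_sym : P^T = P.
Hypothesis Q_sym : Q^T = Q.
Hypothesis Q_pos : pos_def Q.
Local Notation V := 'rV[R]_n.
Local Notation L := (of_lattice R).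
Implicit Types (x y z t : V) (l m r p : 'rV[int]_n) (k : nat).

Lemma qform_ge0 x : 0 <= qform Q x.
Proof.
have [->|x0] := eqVneq x 0; first by rewrite qformE dot0r.
by rewrite ltW// Q_pos.
Qed.

Lemma cmod_phase k p z : cmod (phase k P Q p z) <= 1.
Proof.
rewrite /phase cmod_cexp -[leRHS](@expR0 R) ler_expR ReD ReN ReM /= mul0r mul1r subr0 add0r.
by rewrite oppr_le0 divr_ge0 ?qform_ge0// mulr_ge0.
Qed.

Lemma phase_close p (e : R) : 0 < e -> exists2 eta : R, 0 < eta &
  forall k z, (0 < k)%N -> `|z| <= eta -> k%:R^-1 <= eta -> cmod (phase k P Q p z - 1) <= e.
Proof.
(* The exponent is at most A eta in modulus, since 1 / (4 k) <= 1 / k <= eta; as eta <= 1,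
   [cexp_order1] gives 2 A eta exp(A). *)
move=> e0; pose A := n%:R * (mxsum P * `|L p|) + qform Q (L p).
have A0 : 0 <= A by rewrite addr_ge0 ?qform_ge0// !mulr_ge0 ?mxsum_ge0.
pose D := 2 * A * expR A + 1.
have D0 : 0 < D by rewrite ltr_wpDl// !mulr_ge0// expR_ge0.
exists (Num.min 1 (e / D)); first by rewrite lt_min ltr01 divr_gt0.
move=> k z k0; set eta := Num.min _ _ => ze ke.
have kR : 0 < k%:R :> R by rewrite ltr0n.
have eta0 : 0 <= eta by exact: le_trans ze.
have eta1 : eta <= 1 by rewrite ge_min lexx.
have eta2 : eta * D <= e by rewrite -ler_pdivlMr// ge_min lexx orbT.
rewrite /phase; set w := ('i * _ - _).
have wA : cmod w <= A * eta.
  rewrite (le_trans (ler_cmodB _ _))// cmodM cmodi mul1r !cmod_real /A [leRHS]mulrDl; apply: lerD.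
    apply: (le_trans (ler_norm_dot _ _)); rewrite -mulrA ler_wpM2l//.
    rewrite mulrAC ler_wpM2r//; apply: (le_trans (ler_norm_mulmx _ _)).
    by rewrite ler_wpM2l ?mxsum_ge0.
  rewrite ger0_norm; last by rewrite divr_ge0 ?qform_ge0 ?mulr_ge0.
  rewrite ler_wpM2l ?qform_ge0//; apply: le_trans ke.
  by rewrite lef_pV2 ?posrE ?mulr_gt0// ler_peMl// ler1n.
rewrite (le_trans (cexp_order1 w))//; apply: le_trans eta2.
apply: (@le_trans _ _ (2 * (A * eta) * expR A)).
  apply: ler_pM; rewrite ?mulr_ge0 ?cmod_ge0 ?expR_ge0 ?ler_wpM2l//.
  by rewrite ler_expR (le_trans wA)// ler_piMr.
by rewrite /D mulrDr mulr1 -[leLHS]addr0 lerD// le_eqVlt; apply/orP; left; apply/eqP; ring.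
Qed.

Section Fixed.
Variables (p : 'rV[int]_n) (h : V -> R[i]).
Hypothesis ch : ccont h.
Hypothesis ph : lattice_periodic 1 h.

(** As the density has mass 1, the difference is the integral of h times the phase, minus the value
    of h at the midpoint, against it. Within d of the midpoint this integrand is small; beyond d the
    density of parameter k is a vanishing multiple of the Gaussian of parameter 1. Nothing depends
    on b and c, which only move the midpoint. *)
Lemma theta_pairing_limit (e : R) : 0 < e -> exists N : nat, forall k, (N <= k)%N -> (0 < k)%N ->
  forall b c : Bk n k, @inclass R n k b (rep c + p) ->
  cmod (theta_pairing P Q b c p h - h (midpt k (rep c) p)) <= e.
Proof.
move=> e0; have [M M0 hM] := periodic1_bounded ch ph.
have [q q0 hq] := qform_coercive Q_pos.
(* 8 = 2 (2 + 2): the outer 2 is that of [ler_cmod_avg], and the near and the far zone contribute 2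
   e1 each. *)
pose e1 := e / 8; have e10 : 0 < e1 by rewrite divr_gt0.
have M1 : 0 < M + 1 by rewrite ltr_wpDl.
have e30 : 0 < e1 / (M + 1) by rewrite divr_gt0.
have [d1 d10 hd1] := periodic1_unif ch ph e10.
have [eta eta0 heta] := phase_close p e30.
pose d := Num.min (d1 / 2) eta.
have d0 : 0 < d by rewrite lt_min divr_gt0.
have [N1 hN1] := gauss_concentration Q_pos d0 q0 e30.
exists (maxn N1 (Num.bound eta^-1)) => k; rewrite geq_max => /andP[kN1 kN2] k0 b c bc.
have kR : 0 < k%:R :> R by rewrite ltr0n.
have k1 : 1 <= k%:R :> R by rewrite ler1n.
have keta : k%:R^-1 <= eta.
  rewrite invf_ple ?posrE//; apply: (@le_trans _ _ (Num.bound eta^-1)%:R); last by rewrite ler_nat.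
  by apply: ltW; apply: archi_boundP; rewrite invr_ge0 ltW.
have [Ek EkE] : exists Ek : R, Ek = expR (- ((k%:R - 1) * (q * d ^+ 2))) by eexists.
have [Zk ZkE] : exists Zk : R, Zk = gmass Q k%:R by eexists.
have conc := hN1 k kN1 k0; rewrite -EkE -ZkE in conc.
have Z0 : 0 < Zk by rewrite ZkE; exact: gmass_gt0.
have Ek0 : 0 <= Ek by rewrite EkE; exact: expR_ge0.
set mid := midpt k (rep c) p.
pose A z := h (z + mid) * phase k P Q p z - h mid.
(* The first term dominates near the midpoint, the second away from it; unlike a case distinction,
   their sum is continuous and unfolds to known masses. *)
pose g z : R := 2 * e1 * density k Q z + 2 * M * (Ek / Zk) * gauss Q 1 z.
have cg : continuous g.
  apply: ctD; (apply: ctM; first exact: ct_cst); [exact: ct_density|exact: ct_gauss].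
have A2M z : cmod (A z) <= 2 * M.
  rewrite (le_trans (ler_cmodB _ _))// mulr_natl mulr2n lerD// cmodM -[leRHS]mulr1.
  by rewrite ler_pM ?cmod_ge0// cmod_phase.
have Aclose z : `|z| <= d -> cmod (A z) <= 2 * e1.
  rewrite le_min => /andP[zd ze].
  have -> : A z = (h (z + mid) - h mid) * phase k P Q p z + h mid * (phase k P Q p z - 1).
    by rewrite /A; ring.
  rewrite (le_trans (ler_cmodD _ _))// mulr_natl mulr2n lerD// cmodM.
    rewrite -[leRHS]mulr1 ler_pM ?cmod_ge0// ?cmod_phase//; apply: hd1.
    by rewrite addrK (le_lt_trans zd)// ltr_pdivrMr// ltr_pMr// ltr1n.
  apply: (@le_trans _ _ (M * (e1 / (M + 1)))).
    by rewrite ler_pM ?cmod_ge0//; exact: heta.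
  by rewrite mulrCA ler_piMr ?(ltW e10)// ler_pdivrMr// mul1r lerDl.
have Ag z : cmod ((density k Q z)%:C * A z) <= g z.
  have dz := density_ge0 k0 Q_pos z.
  rewrite cmodM cmod_real ger0_norm//.
  have t0 : 0 <= 2 * M * (Ek / Zk) * gauss Q 1 z.
    apply: mulr_ge0 (gauss_ge0 _ _ _); apply: mulr_ge0; first exact: mulr_ge0.
    exact: divr_ge0 Ek0 (ltW Z0).
  have [zd|zd] := lerP `|z| d.
    rewrite /g mulrC -[leLHS]addr0 lerD// ler_wpM2r//; exact: Aclose.
  rewrite /g -[leLHS]add0r; apply: lerD.
    by apply: mulr_ge0 dz; apply: mulr_ge0 => //; exact: ltW.
  apply: (le_trans (ler_wpM2l dz (A2M z))).
  rewrite mulrC -[leRHS]mulrA; apply: ler_wpM2l; first exact: mulr_ge0.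
  rewrite /density -ZkE [leRHS]mulrAC; apply: ler_wpM2r; first by rewrite invr_ge0 ltW.
  rewrite /gauss EkE -expRD ler_expR.
  have h1 : q * d ^+ 2 <= qform Q z.
    apply: le_trans (hq z); rewrite ler_wpM2l ?(ltW q0)//.
    by apply: lerXn2r; rewrite ?nnegrE ?(ltW d0) ?(ltW zd).
  have h2 : (k%:R - 1) * (q * d ^+ 2) <= (k%:R - 1) * qform Q z.
    by rewrite ler_wpM2l// subr_ge0.
  by move: h2; move: (q * d ^+ 2) (qform Q z) => u v; lra.
have ts := theta_pairing1 k0 P_sym Q_sym Q_pos ch bc.
have ds := density_sum k0 Q_pos mid.
have := has_sumD ts (has_sumZ (- h mid) ds).
rewrite mulr1 => hs.
have W1 : has_sum (fun r => (2 * ravg 1 (fun x => g (x - mid - L r)))%:C)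
   (2 * (2 * e1 + 2 * M * (Ek / Zk) * gmass Q 1))%:C.
  have := has_sumZ 2%:C (has_sumD (has_sumZ (2 * e1)%:C ds)
    (has_sumZ (2 * M * (Ek / Zk))%:C (gauss_avg_sum Q_pos mid (@ltr01 R)))).
  rewrite mulr1 -rcM -rcD -rcM; apply: eq_has_sum => r.
  rewrite -!rcM -rcD -rcM; congr ((2 * _)%:C).
  have cs (u : V -> R) : continuous u -> continuous (fun x => u (x - mid - L r)).
    by move=> cu; under eq_fun do rewrite -addrA; apply: ct_comp; [exact: ct_shift|].
  have c1 := cs _ (@ct_density R n k Q); have c2 := cs _ (@ct_gauss R n Q 1).
  rewrite -!ravgZ ?ltr01// -ravgD ?ltr01//; by apply: ctM; first exact: ct_cst.
apply: (le_trans (has_sum_le hs W1 _)).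
  move=> r; have [w wE] : exists w : V, w = - mid - L r by eexists.
  have ew (x : V) : x - mid - L r = x + w by rewrite wE addrA.
  apply: ler_cmod_avg_sub.
  - under eq_fun do rewrite -/mid ew.
    have cs : continuous (fun x : V => x + w) by exact: ct_shift.
    apply: ccontM => //; apply: ccontM; last exact: (ccont_comp cs (@ccont_phase R n k P Q p)).
    by apply: ccont_real; exact: (ct_comp cs (@ct_density R n k Q)).
  - under eq_fun do rewrite ew.
    exact: (ct_comp (@ct_shift _ _ w) (@ct_density R n k Q)).
  - under eq_fun do rewrite ew.
    exact: (ct_comp (@ct_shift _ _ w) cg).
  - move=> x; apply: le_trans (Ag _); rewrite le_eqVlt; apply/orP; left; apply/eqP.
    congr cmod; rewrite /A -/mid.
    (* Periodicity of h removes the translation by r, so that every cell of the unfolding compares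
       with the same value at the midpoint. *)
    have -> : h (x - mid - L r + mid) = h x.
      rewrite addrAC subrK -{2}(subrK (L r) x); exact/esym/periodic1.
    by ring.
have b1 : 2 * M * (Ek / Zk) * gmass Q 1 <= 2 * M * (e1 / (M + 1)).
  rewrite -mulrA ler_wpM2l ?mulr_ge0// mulrAC ler_pdivrMr//.
have b2 : M * (e1 / (M + 1)) <= e1.
  by rewrite mulrCA ler_piMr ?(ltW e10)// ler_pdivrMr// mul1r lerDl.
have e8 : e = 8 * e1 by rewrite /e1; field.
move: b1 b2; move: (2 * M * (Ek / _) * _) (e1 / (M + 1)) => u v b1 b2.
rewrite e8; nra.
Qed.

End Fixed.
End SymbolLimit.

(** * Affine coverings *)

Section LocallyAffine.
Context {R : realType} {n : nat}.
Local Notation V := 'rV[R]_n.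
Implicit Types (F G : R -> V) (s t : R).

Lemma locally_constant_real (G : R -> R) :
  (forall t, exists2 r : R, 0 < r & forall s, `|s - t| < r -> G s = G t) ->
  forall s t, G s = G t.
Proof.
move=> lc s t; apply: is_derive_0_is_cst => x.
have [r r0 hr] := lc x; have r20 : 0 < r / 2 by rewrite divr_gt0.
apply: (@is_derive_quad _ _ G x 1 0 0 (r / 2) r20) => h hr2.
rewrite mulr0 mul0r subr0 hr ?subrr ?normr0// addrAC subrr add0r scaler1.
by rewrite (le_lt_trans hr2)// ltr_pdivrMr// ltr_pMr// ltr1n.
Qed.

(** The retraction of the line onto [0, 1]. It turns maps on the segment into maps on the line, and
    local constancy is preserved because it is 1-Lipschitz. *)
Definition clamp t : R := Num.max 0 (Num.min 1 t).

Lemma clamp01 t : 0 <= clamp t <= 1.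
Proof. by rewrite /clamp le_max lexx/= ge_max ler01 ge_min lexx. Qed.

Lemma clamp_id t : 0 <= t <= 1 -> clamp t = t.
Proof. by move=> /andP[t0 t1]; rewrite /clamp min_r// max_r. Qed.

Lemma clamp_lip s t : `|clamp s - clamp t| <= `|s - t|.
Proof.
have h1 := ler_norm (s - t); have h2 := ler_norm (t - s); rewrite distrC in h2.
rewrite /clamp /Num.max /Num.min /Order.min /Order.max ler_norml.
by case: (ltP 1 s) => ?; case: (ltP 1 t) => ?; case: ltP => ?; case: ltP => ?; lra.
Qed.

Lemma locally_constant G :
  (forall t, 0 <= t <= 1 -> exists2 r : R, 0 < r &
    forall s, 0 <= s <= 1 -> `|s - t| < r -> G s = G t) ->
  forall t, 0 <= t <= 1 -> G t = G 0.
Proof.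
move=> lc t t01; apply/rowP => j.
have h : forall s t, G (clamp s) ord0 j = G (clamp t) ord0 j.
  apply: (@locally_constant_real (fun t => G (clamp t) ord0 j)) => u.
  have [r r0 hr] := lc _ (clamp01 u); exists r => // s su.
  by rewrite hr ?clamp01//; exact: le_lt_trans (clamp_lip s u) su.
have := h t 0; rewrite !clamp_id// lexx ler01//.
Qed.

Definition affine_near F t (u w : V) := exists2 r : R, 0 < r &
  forall s, 0 <= s <= 1 -> `|s - t| < r -> F s = u + s *: w.

(** Neighbouring local slopes agree because they are compared at two distinct points of an overlap;
    a single slope therefore serves, and F minus the corresponding linear map is locally
    constant. *)
Lemma locally_affine F :
  (forall t, 0 <= t <= 1 -> exists u w, affine_near F t u w) ->
  forall t, 0 <= t <= 1 -> F t = segment (F 0) (F 1) t.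
Proof.
move=> la.
have : forall t, exists w, 0 <= t <= 1 -> exists u, affine_near F t u w.
  move=> t; have [t01|nt] := boolP (0 <= t <= 1); last by exists 0.
  by have [u [w h]] := la t t01; exists w => _; exists u.
move=> /choice[W hW].
have WE t : 0 <= t <= 1 -> W t = W 0.
  apply: locally_constant => {}t t01; have [u [r r0 hr]] := hW t t01.
  exists r => // s s01 st; have [u' [r' r'0 hr']] := hW s s01.
  have [s' [s'01 s's ss' s't]] : exists s', [/\ 0 <= s' <= 1, s' != s, `|s' - s| < r' & `|s' - t| < r].
    (* d <= 1/2, so a step d to the right from s <= 1/2, or to the left otherwise, stays in [0, 1];
       the other two bounds keep the new point in both neighbourhoods. *)
    pose d := Num.min (r' / 2) (Num.min (r - `|s - t|) 1 / 2).
    have d0 : 0 < d by rewrite lt_min !divr_gt0// lt_min subr_gt0 st ltr01.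
    have d1 : d <= r' / 2 by rewrite ge_min lexx.
    have d2 : d <= Num.min (r - `|s - t|) 1 / 2 by rewrite ge_min lexx orbT.
    have d3 : Num.min (r - `|s - t|) 1 <= r - `|s - t| by rewrite ge_min lexx.
    have d4 : Num.min (r - `|s - t|) 1 <= 1 by rewrite ge_min lexx orbT.
    have [s12|s12] := lerP s (1 / 2).
      exists (s + d); split; [lra|by rewrite -subr_eq0 addrAC subrr add0r gt_eqF| |].
        by rewrite addrAC subrr add0r gtr0_norm//; lra.
      by rewrite addrAC (le_lt_trans (ler_normD _ _))// (gtr0_norm d0); lra.
    exists (s - d); split; [lra|by rewrite -subr_eq0 addrAC subrr add0r oppr_eq0 gt_eqF| |].
      by rewrite addrAC subrr add0r normrN gtr0_norm//; lra.
    by rewrite addrAC (le_lt_trans (ler_normB _ _))// (gtr0_norm d0); lra.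
  have e1 := hr s s01 st; have e2 := hr s' s'01 s't.
  have e3 : F s = u' + s *: W s by apply: hr'; rewrite ?subrr ?normr0.
  have e4 := hr' s' s'01 ss'.
  apply: (scalerI (a := s' - s)); first by rewrite subr_eq0.
  have f1 : F s' - F s = (s' - s) *: W t by rewrite e1 e2 scalerBl opprD addrACA subrr add0r.
  by rewrite -f1 e3 e4 scalerBl opprD addrACA subrr add0r.
have HE t : 0 <= t <= 1 -> F t - t *: W 0 = F 0 - 0 *: W 0.
  apply: (@locally_constant (fun t => F t - t *: W 0)) => {}t t01.
  have [u [r r0 hr]] := hW t t01; exists r => // s s01 st.
  by rewrite (hr s)// (hr t)// ?subrr ?normr0// WE// !addrK.
have F1 : F 1 = F 0 + W 0.
  have := HE 1; rewrite scale0r subr0 scale1r => <-; first by rewrite subrK.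
  by rewrite lexx ler01.
move=> t t01; have := HE t t01; rewrite scale0r subr0 => /eqP; rewrite subr_eq => /eqP ->.
by rewrite /segment F1 scalerDr addrA -scalerDl subrK scale1r.
Qed.

End LocallyAffine.

Section AffineCoverings.
Context {R : realType} {n : nat}.
Local Notation V := 'rV[R]_n.
Local Notation L := (of_lattice R).
Implicit Types (x y z u w : V) (U W : set (base R n)) (b c : base R n).

Lemma of_lattice_small (m : 'rV[int]_n) : `|L m| < 1 -> m = 0.
Proof.
move=> m1; apply/rowP => i; rewrite mxE; apply/eqP; apply: contraTT m1 => mi.
rewrite -leNgt; apply: le_trans (ler_coord_norm (L m) i).
by rewrite mxE -intr_norm -[1]/(1%:~R) ler_int -gtz0_ge1 normr_gt0.
Qed.

Lemma pr_inj_near z w : `|w| < 1 -> pr (z + w) = pr z -> w = 0.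
Proof.
move=> w1 /prP[m /(congr1 (fun v => v - z))]; rewrite addrAC subrr add0r addrAC subrr add0r => wm.
by move: w1; rewrite wm => /of_lattice_small ->; rewrite of_lattice0.
Qed.

Lemma segmentE x y (t : R) : segment x y t = x + t *: (y - x).
Proof. by rewrite /segment scalerBl scale1r scalerBr -!addrA [- _ + _]addrC. Qed.

Lemma segment_conv (A : set V) x y (t : R) : convex_set A -> A x -> A y -> 0 <= t <= 1 ->
  A (segment x y t).
Proof.
move=> cA Ax Ay /andP[t0 t1]; have := cA y x (Itv01 t0 t1) (mem_set Ay) (mem_set Ax).
by move/set_mem; rewrite /segment addrC.
Qed.

(* The linear part of an affine chart is invertible because both the chart and
   the covering map are locally injective. *)
Lemma chart_unitmx U (phi : base R n -> V) z (A : 'M[R]_n) v :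
  open U -> {in U &, injective phi} -> U (pr z) ->
  (\forall y \near z, phi (pr y) = y *m A + v) -> A \in unitmx.
Proof.
move=> oU phi_inj Uz near_z.
have near_U : \forall y \near z, U (pr y).
  by have := @pi_continuous _ _ z; apply; apply: open_nbhs_nbhs.
have /nbhs_ballP[r r0 hr] : \forall y \near z, phi (pr y) = y *m A + v /\ U (pr y).
  exact: filterI.
rewrite -row_free_unit -kermx_eq0; apply/rowV0P => u /sub_kermxP uA.
apply/eqP; apply: contraPT isT => u0 _.
have un0 : 0 < `|u| by rewrite normr_gt0.
pose d := Num.min 1 r / 2 / `|u|.
have d0 : 0 < d by rewrite !divr_gt0// lt_min ltr01.
have du : `|d *: u| = Num.min 1 r / 2 by rewrite normrZ gtr0_norm// divfK// gt_eqF.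
have m0 : 0 < Num.min 1 r by rewrite lt_min ltr01.
have m1 : Num.min 1 r <= 1 by rewrite ge_min lexx.
have m2 : Num.min 1 r <= r by rewrite ge_min lexx orbT.
have [p1 U1] := hr z (ballxx z r0).
have [p2 U2] : phi (pr (z + d *: u)) = (z + d *: u) *m A + v /\ U (pr (z + d *: u)).
  by apply: hr; rewrite -ball_normE /= opprD addrA subrr sub0r normrN du; lra.
have e : pr (z + d *: u) = pr z.
  by apply: phi_inj; rewrite ?inE// p1 p2 mulmxDl -scalemxAl uA scaler0 addr0.
have /eqP : d *: u = 0 by apply: (@pr_inj_near z) e; rewrite du; lra.
by rewrite scaler_eq0 gt_eqF//= => /eqP u00; rewrite u00 eqxx in u0.
Qed.

Lemma chart_near U (phi : base R n -> V) z : affine_on U phi -> U (pr z) ->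
  exists A v, exists2 r : R, 0 < r & forall y, `|z - y| < r -> phi (pr y) = y *m A + v.
Proof.
move=> aff Uz; have [A [v /nbhs_ballP[r r0 hr]]] := aff z Uz.
by exists A, v, r => // y zy; apply: hr; rewrite -ball_normE.
Qed.

(** The curve is only asked to lift locally to straight lines, since it will be applied to a curve
    constructed in a chart, for which no global lift is known. *)
Lemma chart_straight U (phi : base R n -> V) (sig : R -> base R n) : affine_on U phi ->
  (forall t, 0 <= t <= 1 -> U (sig t)) ->
  (forall t, 0 <= t <= 1 -> exists z w, exists2 r : R, 0 < r &
     forall s, 0 <= s <= 1 -> `|s - t| < r -> sig s = pr (z + (s - t) *: w)) ->
  forall t, 0 <= t <= 1 -> phi (sig t) = segment (phi (sig 0)) (phi (sig 1)) t.
Proof.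
move=> aff Usig lift; apply: (@locally_affine _ _ (phi \o sig)) => t t01 /=.
have [z [w [r r0 hr]]] := lift t t01.
have sz : sig t = pr z by rewrite hr ?subrr ?normr0// scale0r addr0.
have Uz : U (pr z) by rewrite -sz; exact: Usig.
have [A [v [r' r'0 hr']]] := chart_near aff Uz.
have w1 : 0 < `|w| + 1 by rewrite ltr_wpDl.
exists ((z - t *: w) *m A + v), (w *m A), (Num.min r (r' / (`|w| + 1))).
  by rewrite lt_min r0 divr_gt0.
move=> s s01; rewrite lt_min => /andP[s1 s2] /=; rewrite hr// hr'.
  rewrite mulmxDl -scalemxAl mulmxBl -scalemxAl; move: (z *m A) (w *m A) => a b.
  by apply/rowP => j; rewrite !mxE; ring.
rewrite opprD addrA subrr sub0r normrN normrZ.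
apply: (@le_lt_trans _ _ (`|s - t| * (`|w| + 1))); first by rewrite ler_wpM2l// lerDl.
by rewrite -ltr_pdivlMr.
Qed.

Lemma segment_lift x y (t : R) : exists z w, exists2 r : R, 0 < r &
  forall s, 0 <= s <= 1 -> `|s - t| < r -> pr (segment x y s) = pr (z + (s - t) *: w).
Proof.
exists (segment x y t), (y - x), 1 => // s _ _; congr pr; rewrite !segmentE.
by rewrite -addrA -scalerDl [t + _]addrC subrK.
Qed.

(* The segments in U from b to c all run along the straight line from b to c in
   a chart of any smaller affinely convex W containing b and c. *)
Lemma segment_in_chart U W (phi chi : base R n -> V) x y :
  affine_convex_embedding U phi -> open W -> affine_convex_embedding W chi -> W `<=` U ->
  segment_inside U x y -> W (pr x) -> W (pr y) ->
  forall t, 0 <= t <= 1 -> W (pr (segment x y t)) /\ 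
    chi (pr (segment x y t)) = segment (chi (pr x)) (chi (pr y)) t.
Proof.
move=> [phi_inj _ _ phi_aff _] oW [chi_inj _ _ chi_aff chi_cvx] WU sU Wx Wy.
pose g t := segment (chi (pr x)) (chi (pr y)) t.
(* The straight segment of the chart chi is pulled back to a curve in W; convexity of the image of
   chi provides its points. *)
have : forall t, exists b, 0 <= t <= 1 -> W b /\ chi b = g t.
  move=> t; have [t01|nt] := boolP (0 <= t <= 1); last by exists (pr x).
  have : (chi @` W) (g t) by apply: segment_conv.
  by move=> [b Wb bg]; exists b.
move=> /choice[sig hsig].
have seg0 u v : segment u v (0 : R) = u by rewrite segmentE scale0r addr0.
have seg1 u v : segment u v (1 : R) = v by rewrite segmentE scale1r addrC subrK.
have i0 : 0 <= (0 : R) <= 1 by rewrite lexx ler01.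
have i1 : 0 <= (1 : R) <= 1 by rewrite lexx ler01.
have s0 : sig 0 = pr x.
  have [W0 e0] := hsig 0 i0; apply: chi_inj; rewrite ?inE//.
  by rewrite e0 /g seg0.
have s1 : sig 1 = pr y.
  have [W1 e1] := hsig 1 i1; apply: chi_inj; rewrite ?inE//.
  by rewrite e1 /g seg1.
have lift_sig t : 0 <= t <= 1 -> exists z w, exists2 r : R, 0 < r &
     forall s, 0 <= s <= 1 -> `|s - t| < r -> sig s = pr (z + (s - t) *: w).
  move=> t01; have [Wt et] := hsig t t01; have [z ez] : exists z, sig t = pr z.
    exists (repr (sig t)); rewrite /pr; exact/esym/reprK.
  have Wz : W (pr z) by rewrite -ez.
  have [A [v near_z]] := chi_aff z Wz.
  have Au := chart_unitmx oW chi_inj Wz near_z.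
  have near_W : \forall y \near z, W (pr y).
    by have := @pi_continuous _ _ z; apply; apply: open_nbhs_nbhs.
  have /nbhs_ballP[r r0 hr] : \forall y \near z, chi (pr y) = y *m A + v /\ W (pr y).
    exact: filterI.
  (* The velocity in R^n of a local lift of the curve: the velocity in the chart, through the
     inverse of its linear part. *)
  pose w := (chi (pr y) - chi (pr x)) *m invmx A.
  have w1 : 0 < `|w| + 1 by rewrite ltr_wpDl.
  exists z, w, (r / (`|w| + 1)); first by rewrite divr_gt0.
  move=> s s01 st; have [Ws es] := hsig s s01.
  have [p1 p2] := hr z (ballxx z r0).
  have [q1 q2] : chi (pr (z + (s - t) *: w)) = (z + (s - t) *: w) *m A + v /\ W (pr (z + (s - t) *: w)).
    apply: hr; rewrite -ball_normE /= opprD addrA subrr sub0r normrN normrZ.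
    apply: (@le_lt_trans _ _ (`|s - t| * (`|w| + 1))); first by rewrite ler_wpM2l// lerDl.
    by rewrite -ltr_pdivlMr.
  apply: chi_inj; rewrite ?inE// es q1 mulmxDl -scalemxAl mulmxKV// addrAC -p1 -ez et /g !segmentE.
  by rewrite -addrA -scalerDl [t + _]addrC subrK.
have Usig t : 0 <= t <= 1 -> U (sig t) by move=> t01; apply: WU; have [] := hsig t t01.
(* Seen in the chart phi, both curves are straight with the same ends, hence equal by injectivity of
   phi on U. *)
have e1 := chart_straight phi_aff Usig lift_sig.
have e2 := @chart_straight U phi (fun t => pr (segment x y t)) phi_aff sU (fun t _ => segment_lift x y t).
have sE t : 0 <= t <= 1 -> pr (segment x y t) = sig t.
  move=> t01; apply: phi_inj; rewrite ?inE; [exact: sU|exact: Usig|].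
  by rewrite e1// e2// seg0 seg1 s0 s1.
by move=> t t01; rewrite sE//; exact: hsig.
Qed.

(** The difference of the two lifts is affine in t and lattice-valued, hence constant. *)
Lemma same_projection_diff x y x' y' :
  (forall t : R, 0 <= t <= 1 -> pr (segment x y t) = pr (segment x' y' t)) ->
  y - x = y' - x'.
Proof.
move=> e; pose D t := segment x y t - segment x' y' t.
have Dlat t : 0 <= t <= 1 -> exists m, D t = L m.
  by move=> /e/prP[m em]; exists m; rewrite /D em addrAC subrr add0r.
have DE t : D t = (x - x') + t *: ((y - x) - (y' - x')).
  by rewrite /D !segmentE opprD addrACA -scalerBr.
set w := (y - x) - (y' - x') in DE.
have w1 : 0 < `|w| + 1 by rewrite ltr_wpDl.
have Dc : forall t, 0 <= t <= 1 -> D t = D 0.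
  apply: locally_constant => t t01; exists (`|w| + 1)^-1; first by rewrite invr_gt0.
  move=> s s01 st; have [m em] := Dlat t t01; have [m' em'] := Dlat s s01.
  rewrite em em'; suff -> : m' = m by [].
  apply/eqP; rewrite -subr_eq0; apply/eqP; apply: of_lattice_small.
  rewrite of_latticeB -em -em' !DE opprD addrACA subrr add0r -scalerBl normrZ.
  apply: (@le_lt_trans _ _ (`|s - t| * (`|w| + 1))); first by rewrite ler_wpM2l// lerDl.
  by rewrite -ltr_pdivlMr// div1r.
have := Dc 1; rewrite lexx ler01 => /(_ isT); rewrite !DE scale0r addr0 scale1r.
move/eqP; rewrite -subr_eq0 addrAC subrr add0r => /eqP w0.
by apply/eqP; rewrite -subr_eq0; apply/eqP.
Qed.

Lemma close_lift_unique (C : set (set (base R n))) U U' x y x' y' :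
  open_covering C -> condU1 C -> condU2 C -> C U -> C U' ->
  segment_inside U x y -> segment_inside U' x' y' -> pr x = pr x' -> pr y = pr y' ->
  y - x = y' - x'.
Proof.
move=> [oC _] [_ U1] U2 CU CU' sU sU' ex ey.
have [phi hphi] := U1 U CU; have [phi' hphi'] := U1 U' CU'.
have [chi hchi] := U2 U U' CU CU'.
have oW : open (U `&` U') by apply: openI; exact: oC.
have i0 : 0 <= (0 : R) <= 1 by rewrite lexx ler01.
have i1 : 0 <= (1 : R) <= 1 by rewrite lexx ler01.
have Ux : U (pr x) by have := sU 0 i0; rewrite segmentE scale0r addr0.
have Uy : U (pr y) by have := sU 1 i1; rewrite segmentE scale1r addrC subrK.
have U'x : U' (pr x) by rewrite ex; have := sU' 0 i0; rewrite segmentE scale0r addr0.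
have U'y : U' (pr y) by rewrite ey; have := sU' 1 i1; rewrite segmentE scale1r addrC subrK.
have h1 := segment_in_chart hphi oW hchi (@subIsetl _ _ _) sU (conj Ux U'x) (conj Uy U'y).
have Wx' : (U `&` U') (pr x') by rewrite -ex.
have Wy' : (U `&` U') (pr y') by rewrite -ey.
have h2 := segment_in_chart hphi' oW hchi (@subIsetr _ _ _) sU' Wx' Wy'.
apply: same_projection_diff => t t01.
have [w1 e1] := h1 t t01; have [w2 e2] := h2 t t01.
have [chi_inj _ _ _ _] := hchi.
by apply: chi_inj; rewrite ?inE// e1 e2 ex ey.
Qed.

(** A small ball lies over a member of the covering and, being convex, contains the segments between
    its points. Compactness of the fundamental cube makes the radius uniform and periodicity extends
    it to R^n. *)
Lemma short_segment_inside (C : set (set (base R n))) : open_covering C ->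
  exists2 d : R, 0 < d & forall x y, `|x - y| < d -> exists2 U, C U & segment_inside U x y.
Proof.
move=> [oC cC].
have [|d d0 hd] := @compact_uniform R V (fdomain 1)
    (fun x y => exists2 U, C U & segment_inside U x y) (@compact_fdomain R n 1).
  move=> x _; have [U CU Ux] := cC (pr x).
  have /nbhs_ballP[d d0 hd] : \forall y \near x, U (pr y).
    by have := @pi_continuous _ _ x; apply; apply: open_nbhs_nbhs; split => //; exact: oC.
  exists d => // y z xy xz; exists U => // t /andP[t0 t1]; apply: hd; rewrite -ball_normE /=.
  have -> : x - segment y z t = (1 - t) *: (x - y) + t *: (x - z).
    by apply/rowP => j; rewrite /segment !mxE; ring.
  apply: (le_lt_trans (ler_normD _ _)); rewrite !normrZ !ger0_norm ?subr_ge0//.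
  pose a := Num.max `|x - y| `|x - z|.
  have ad : a < d by rewrite gt_max xy xz.
  have h1 : (1 - t) * `|x - y| <= (1 - t) * a.
    by rewrite ler_wpM2l ?subr_ge0// le_max lexx.
  have h2 : t * `|x - z| <= t * a by rewrite ler_wpM2l// le_max lexx orbT.
  by rewrite (le_lt_trans (lerD h1 h2))// -mulrDl subrK mul1r.
exists d => // x y xy; have [m Dm] := reduce_fdomain x (@ltr01 R).
have [|U CU hU] := hd _ (y + 1 *: L m) Dm.
  by rewrite opprD addrACA subrr addr0.
exists U => // t t01; have := hU t t01.
rewrite scale1r (_ : segment _ _ t = segment x y t + L m) ?pr_add//.
by apply/rowP => j; rewrite /segment !mxE; ring.
Qed.

End AffineCoverings.

(** * Parallel transport along segments *)

Section Transport.
Context {R : realType} {n : nat} (k : nat) (P : 'M[R]_n).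
Local Notation V := 'rV[R]_n.
Implicit Types (x y w a b theta : V) (t : R).

Lemma is_derive_lin (a b : R) t : is_derive t 1 (fun s : R => a + s * b) b.
Proof.
apply: (@is_derive_quad _ _ _ t 1 b 0 1 ltr01) => h _.
rewrite mul0r scaler1 mulrDl (_ : _ - _ - _ = 0) ?normr0//; ring.
Qed.

Lemma affine_derive a b t : derivable (fun s : R => a + s *: b) t 1 /\
  derive1 (fun s : R => a + s *: b) t = b.
Proof.
have cd j : is_derive t 1 (fun s : R => (a + s *: b) ord0 j) (b ord0 j).
  rewrite (_ : (fun s : R => _) = fun s : R => a ord0 j + s * b ord0 j).
    exact: is_derive_lin.
  by apply/funext => s; rewrite !mxE.
have d : derivable (fun s : R => a + s *: b) t 1.
  by apply/derivable_mxP => i j; rewrite ord1; have [] := cd j.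
split=> //; rewrite derive1E derive_mx//; apply/rowP => j; rewrite mxE.
by have [] := cd j.
Qed.

Lemma segment_fun x y : segment x y = fun t => x + t *: (y - x).
Proof. by apply/funext => t; rewrite segmentE. Qed.

Lemma derive0_ends (f : R -> R) : {within `[0, 1], continuous f} ->
  (forall t, 0 < t < 1 -> is_derive t 1 f 0) -> f 1 = f 0.
Proof.
move=> cf df; have dI t : t \in `]0, 1[ -> is_derive t 1 f 0.
  by rewrite in_itv /=; exact: df.
have [t _] := @MVT R f (fun=> 0) 0 1 ltr01 dI cf.
by rewrite mul0r => /eqP; rewrite subr_eq0 => /eqP.
Qed.

(** The lift minus its expected linear motion has zero derivative inside the interval, hence equal
    ends. This uniqueness, with the explicit lift [hlift], determines the values chosen by
    [xget]. *)
Lemma horizontal_ends x y (q : R -> V) : horizontal P (segment x y) q ->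
  q 0 = q 1 - (y - x) *m P.
Proof.
move=> [cq hq]; apply/eqP; rewrite eq_sym subr_eq; apply/eqP/rowP => j.
pose c := ((y - x) *m P) ord0 j.
suff e : q 1 ord0 j + 1 * (- c) = q 0 ord0 j + 0 * (- c).
  by move: e; rewrite mul0r addr0 mul1r mxE -/c => <-; rewrite subrK.
apply: (@derive0_ends (fun t => q t ord0 j + t * (- c))).
  have c1 : {within `[0, 1], continuous (fun t => q t ord0 j)}.
    exact: (@ct_comp (subspace `[(0 : R), 1]) V R (fun v : V => v ord0 j) q cq (@coord_cont _ _ j)).
  have c2 : {within `[0, 1], continuous (fun t : R => t * - c)}.
    by apply: continuous_subspaceT; apply: ctM; [exact: ct_id|exact: ct_cst].
  exact: (@ctD R (subspace `[(0 : R), 1]) _ _ c1 c2).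
move=> t t01; have [_ dq eq] := hq t t01.
have e1 : 'D_1 (fun t => q t ord0 j) t = c.
  have [_ eseg] := affine_derive x (y - x) t.
  have := congr1 (fun M : V => M ord0 j) eq.
  by rewrite derive1E derive_mx// mxE segment_fun eseg.
have d1 : is_derive t 1 (fun t => q t ord0 j) c.
  by rewrite -e1; apply: derivableP; move/derivable_mxP: dq => /(_ ord0 j).
have d2 := is_derive_lin 0 (- c) t.
have -> : (fun t => q t ord0 j + t * - c) = (fun t => q t ord0 j) \+ (fun s : R => 0 + s * - c).
  by apply/funext => s /=; rewrite add0r.
by apply: is_derive_eq (is_deriveD d1 d2) _; rewrite subrr.
Qed.

Definition hlift x y theta t : V := theta - (1 - t) *: ((y - x) *m P).

Lemma hliftE x y theta : hlift x y theta =
  fun t => (theta - (y - x) *m P) + t *: ((y - x) *m P).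
Proof.
by apply/funext => t; rewrite /hlift; apply/rowP => j; rewrite !mxE; ring.
Qed.

Lemma ct_affine a b : continuous (fun t : R => a + t *: b).
Proof.
apply: continuous_row => j; rewrite (_ : (fun t : R => _) = fun t : R => a ord0 j + t * b ord0 j).
  by apply: ctD; [exact: ct_cst|apply: ctM; [exact: ct_id|exact: ct_cst]].
by apply/funext => t; rewrite !mxE.
Qed.

Lemma hlift_horizontal x y theta : horizontal P (segment x y) (hlift x y theta).
Proof.
rewrite hliftE; split; first by apply: continuous_subspaceT; exact: ct_affine.
move=> t _; have [d1 e1] := affine_derive x (y - x) t.
have [d2 e2] := affine_derive (theta - (y - x) *m P) ((y - x) *m P) t.
by split; rewrite ?segment_fun ?e1 ?e2.
Qed.

Lemma hlift1 x y theta : hlift x y theta 1 = theta.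
Proof. by rewrite /hlift subrr scale0r subr0. Qed.

Lemma transport_funE x y (g : V -> R[i]) theta :
  transport_fun P (segment x y) g theta = g (theta - (y - x) *m P).
Proof.
rewrite /transport_fun; case: xgetP => [z _ [q [hq q1 ->]]|/(_ (g (hlift x y theta 0)))[]].
  by rewrite (horizontal_ends hq) q1.
by exists (hlift x y theta); split; [exact: hlift_horizontal|exact: hlift1|].
Qed.

(** i k times the integral over [0, t] of the connection form along a horizontal lift of the
    segment, whose angular velocity is (y - x) P; it is the same for all lifts. *)
Definition holonomy x y t : R[i] :=
  'i * (k%:R * (dot x ((y - x) *m P) * t + qform P (y - x) / 2 * t ^+ 2))%:C.

Lemma holonomy_cder x y t : is_cder (holonomy x y) t 1
  ('i * (k%:R * dot (segment x y t) ((y - x) *m P))%:C).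
Proof.
apply: (@is_cder_poly2 _ _ _ _ _ _ ('i * (k%:R * (qform P (y - x) / 2))%:C)) => h.
rewrite /holonomy scaler1 segmentE dotDl dotZl (dotC (y - x)) -qformE.
rewrite [k%:R * (_ * (t + h) + _)](_ : _ = k%:R * (dot x ((y - x) *m P) * t + qform P (y - x) / 2 * t ^+ 2)
  + h * (k%:R * (dot x ((y - x) *m P) + t * qform P (y - x)))
  + h ^+ 2 * (k%:R * (qform P (y - x) / 2))); last by field.
rewrite !rcD (rcM h) (rcM (h ^+ 2)); ring.
Qed.

Lemma ccont_holonomy x y : ccont (holonomy x y).
Proof.
apply: ccontZ; apply: ccont_real; apply: ctM; first exact: ct_cst.
apply: ctD; (apply: ctM; first exact: ct_cst); first exact: ct_id.
rewrite (_ : (fun t => t ^+ 2) = fun t : R => t * t); last by apply/funext => t; rewrite expr2.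
by apply: ctM; exact: ct_id.
Qed.

Lemma parallel_ends x y (q : R -> V) (v : R -> R[i]) : horizontal P (segment x y) q ->
  parallel k (segment x y) q v -> v 1 = cexp (holonomy x y 1) * v 0.
Proof.
move=> [_ hq] [cR cI hv]; pose F t := v t * cexp (- holonomy x y t).
have cF : ccont (F : subspace `[0, 1] -> R[i]).
  apply: ccontM; first by split.
  have [c1 c2] : ccont (fun t => cexp (- holonomy x y t)).
    by apply: ccont_cexp; apply: ccontN; exact: ccont_holonomy.
  by split; apply: continuous_subspaceT.
have dF t : 0 < t < 1 -> is_cder F t 1 0.
  move=> t01; have [d1 d2 e] := hv t t01; have [_ _ eq] := hq t t01.
  have [_ eseg] := affine_derive x (y - x) t.
  have dv : is_cder v t 1 (cderive v t 1) by split; exact: derivableP.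
  have dh : is_cder (fun t => - holonomy x y t) t 1 (- ('i * (k%:R * dot (segment x y t) ((y - x) *m P))%:C)).
    have := is_cderZ (-1) (holonomy_cder x y t); rewrite mulN1r.
    by rewrite (_ : (fun t => -1 * _) = fun t => - holonomy x y t)//; apply/funext => s; rewrite mulN1r.
  apply: is_cder_eq (is_cderM dv (is_cder_cexp dh)) _.
  move/eqP: e; rewrite subr_eq0 => /eqP ->; rewrite eq segment_fun eseg.
  by ring.
have F10 : F 1 = F 0.
  have r1 := @derive0_ends (fun t => complex.Re (F t)) cF.1 (fun t t01 => (dF t t01).1).
  have r2 := @derive0_ends (fun t => complex.Im (F t)) cF.2 (fun t t01 => (dF t t01).2).
  by move: r1 r2; case: (F 1) (F 0) => [a b] [c d] /= -> ->.
have h0 : holonomy x y 0 = 0.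
  by rewrite /holonomy expr0n mulr0 mulr0 addr0 !mulr0.
have F0 : F 0 = v 0 by rewrite /F h0 oppr0 cexp0 mulr1.
rewrite -F0 -F10 /F mulrC -mulrA -cexpD addNr cexp0 mulr1//.
Qed.

Lemma parallel_ex x y theta (z : R[i]) :
  parallel k (segment x y) (hlift x y theta) (fun t => z * cexp (holonomy x y t)).
Proof.
have [c1 c2] : ccont (fun t => z * cexp (holonomy x y t)).
  by apply: ccontZ; apply: ccont_cexp; exact: ccont_holonomy.
split; [exact: continuous_subspaceT|exact: continuous_subspaceT|] => t t01.
have d := is_cderZ z (is_cder_cexp (holonomy_cder x y t)).
split; [by case: d => -[]|by case: d => _ []|].
rewrite (is_cder_cderive d) hliftE.
have [_ ->] := affine_derive (theta - (y - x) *m P) ((y - x) *m P) t.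
by ring.
Qed.

Lemma transport_sectionE x y (s : V -> R[i]) theta :
  transport_section k P (segment x y) s theta =
  cexp (holonomy x y 1) * s (theta - (y - x) *m P).
Proof.
rewrite /transport_section; case: xgetP => [z _ [q [v [hq hv q1 v0 ->]]]|].
  by rewrite (parallel_ends hq hv) v0 (horizontal_ends hq) q1.
move=> /(_ (s (hlift x y theta 0) * cexp (holonomy x y 1)))[].
exists (hlift x y theta), (fun t => s (hlift x y theta 0) * cexp (holonomy x y t)).
split; [exact: hlift_horizontal|exact: parallel_ex|exact: hlift1| |by []].
by rewrite /holonomy expr0n /= !mulr0 addr0 !mulr0 cexp0 mulr1.
Qed.

End Transport.

(** * Matrix entries of the quantization map *)

Section PhiCoefficients.
Context {R : realType} {n : nat} (P : 'M[R]_n).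
Hypothesis P_sym : P^T = P.
Local Notation V := 'rV[R]_n.
Local Notation E := (V * V)%type.
Local Notation lattice := 'rV[int]_n.
Local Notation L := (of_lattice R).
Variable (f : E -> R[i]).
Hypothesis cf : ccont f.
Hypothesis af : angle_periodic f.
Hypothesis bf : base_periodic f.
Implicit Types (x y w : V) (l m p : lattice).

Lemma fiber_coef_base_periodic p : lattice_periodic 1 (fiber_coef f p).
Proof.
by move=> m x; rewrite /fiber_coef; congr fourier_coef; apply/funext => t; exact: (bf t m x).
Qed.

Section Level.
Variable k : nat.
Hypothesis k0 : (0 < k)%N.
Local Notation incl := (@inclass R n k).
Implicit Types (b c : Bk n k).

Let kRn : (k%:R : R) != 0. Proof. by rewrite pnatr_eq0 -lt0n. Qed.

Lemma psi_scaled l (theta : V) : psi k (scaled k l) theta = echar l theta.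
Proof. by rewrite /psi /echar /scaled dotZl mulrA mulfV// mul1r. Qed.

Lemma vartheta_scaled b l (theta : V) : incl b l -> vartheta b (scaled k l, theta) = echar l theta.
Proof. by rewrite /vartheta /= /inclass => ->; exact: psi_scaled. Qed.

Lemma segment_mid l m : segment (scaled k l : V) (scaled k m) 2^-1 = midpt k m (l - m).
Proof.
rewrite /segment /midpt scaledD.
have -> : scaled k (- m) = - scaled k m :> V by rewrite /scaled of_latticeN scalerN.
by apply/rowP => j; rewrite !mxE; field.
Qed.

(** With h half the transport (y - x) P, averaging in the variable of the fiber at the midpoint
    leaves the two characters at h, that is exp(i <l + m, h>). The holonomy is k <(x + y) / 2, (y -
    x) P>, the same phase, since a linear integrand is integrated exactly by its value at the
    midpoint; its conjugate cancels the characters. *)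
Lemma pairing_psi l m : let x := scaled k l in let y := scaled k m in
  let mid := segment x y 2^-1 in
  pairing k P (segment x y) (echar l)
    (fun theta => transport_fun P (segment mid y) (fun eta => f (mid, eta)) theta * echar m theta) =
  fiber_coef f (l - m) (midpt k m (l - m)).
Proof.
move=> x y mid; have midE : mid = midpt k m (l - m) by exact: segment_mid.
have [s sE] : exists s, s = (y - x) *m P by eexists.
have [h hE] : exists h : V, h = 2^-1 *: s by eexists.
have e1 : (y - mid) *m P = h.
  rewrite hE sE scalemxAl; congr (_ *m P).
  by rewrite /mid /segment; apply/rowP => j; rewrite !mxE; field.
have e2 : s = h + h by rewrite hE -scalerDl (_ : 2^-1 + 2^-1 = 1) ?scale1r//; field.
pose z := cexp (holonomy k P x y 1).
rewrite /pairing integral_TE.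
pose G t := z^* * (echar (- l) (t - h) * (f (mid, t) * echar m (t + h))).
rewrite (_ : (fun theta => _) = fun t => G (t - h)); last first.
  apply/funext => t; rewrite transport_sectionE transport_funE e1 -/z -sE e2.
  by rewrite /G !conjE conjcM !conjE -echarN subrK opprD addrA -mulrA.
have cG : ccont G.
  apply: ccontZ; apply: ccontM.
    exact: (@ccont_comp _ _ _ (echar (- l)) (fun t : V => t - h) (@ct_shift _ _ (- h)) (ccont_echar _)).
  apply: ccontM; first exact: ccont_slice.
  exact: (@ccont_comp _ _ _ (echar m) (fun t : V => t + h) (@ct_shift _ _ h) (ccont_echar _)).
have pG : lattice_periodic (2 * pi) G.
  move=> r t; rewrite /G (af mid r t); congr (_ * (_ * (_ * _))).
    by rewrite addrAC echar_periodic.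
  by rewrite addrAC echar_periodic.
rewrite (avg_shift pi2_gt0 (- h) cG pG).
rewrite /fiber_coef /fourier_coef -midE; congr avg; apply/funext => t; rewrite /G.
rewrite !echar_add opprB echarD.
rewrite [LHS](_ : _ = (z^* * (echar (- l) (- h) * echar m h)) * (echar m t * echar (- l) t * f (mid, t))); last by ring.
rewrite (_ : z^* * _ = 1) ?mul1r//.
have -> : echar (- l) (- h) = echar l h by rewrite /echar of_latticeN dotNl dotNr opprK.
rewrite conjE -echarD /z /echar.
rewrite (_ : holonomy k P x y 1 = 'i * (dot (L (l + m)) h)%:C).
  by rewrite -/(echar _ _) -echarN -echarD addNr echar0.
rewrite /holonomy; congr ('i * _%:C).
rewrite -sE qformE -sE hE dotZr of_latticeD expr1n !mulr1 (dotC s).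
have xk : k%:R *: x = L l by rewrite /x /scaled scalerA mulfV// scale1r.
have yk : k%:R *: y = L m by rewrite /y /scaled scalerA mulfV// scale1r.
rewrite -xk -yk !dotDl dotNl !dotZl; field.
exact: kRn.
Qed.

Lemma pr_class b x : pr x = bs_point R b -> exists2 l, x = scaled k l & incl b l.
Proof.
rewrite /bs_point bs_liftE => /prP[r ->]; exists (rep b + Posz k *: r).
  by rewrite scaledD scaled_mul.
by rewrite inclass_mul// inclass_rep.
Qed.

Lemma pairing0l x y (g : V -> R[i]) : pairing k P (segment x y) (fun=> 0) g = 0.
Proof.
rewrite /pairing integral_TE -[RHS](@avg_cst R n (2 * pi) pi2_gt0 0); congr avg.
by apply/funext => t; rewrite transport_sectionE mulr0 conjE conjc_zero mul0r.
Qed.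

Lemma pairing0r x y (s : V -> R[i]) : pairing k P (segment x y) s (fun=> 0) = 0.
Proof.
rewrite /pairing integral_TE -[RHS](@avg_cst R n (2 * pi) pi2_gt0 0); congr avg.
by apply/funext => t; rewrite mulr0.
Qed.

Definition is_lift (C : set (set (base R n))) b c l m :=
  [/\ incl b l, incl c m & exists2 U, C U & segment_inside U (scaled k l) (scaled k m)].

(** In the absence of a lift [close_lift] returns its default (0, 0). The pairing there vanishes
    unless b and c are both the class of 0, and in that case the constant segment would be a
    lift. *)
Lemma phi_coef_lift C b c : open_covering C ->
  (exists l m, is_lift C b c l m /\ phi_coef P C f b c = fiber_coef f (l - m) (midpt k m (l - m))) \/
  (phi_coef P C f b c = 0 /\ forall l m, ~ is_lift C b c l m).
Proof.
move=> [_ cC]; rewrite /phi_coef /close_lift; case: xgetP => [[x y] _ /= [ex ey hU]|nolift].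
  left; have [l xl bl] := pr_class ex; have [m ym cm] := pr_class ey.
  exists l, m; split; first by rewrite /is_lift -xl -ym.
  rewrite -(pairing_psi l m) xl ym; congr pairing.
    by apply/funext => t; exact: vartheta_scaled.
  by apply/funext => t; congr (_ * _); exact: vartheta_scaled.
right; split; last first.
  move=> l m [bl cm hU]; apply: (nolift (scaled k l, scaled k m)).
  by split=> //=; apply/asboolP.
have [b0|nb] := pselect (pr 0 = bs_point R b); last first.
  rewrite (_ : (fun theta => vartheta b _) = fun=> 0) ?pairing0l//.
  by apply/funext => t; rewrite /vartheta /=; case: asboolP.
have [c0|nc] := pselect (pr 0 = bs_point R c); last first.
  rewrite (_ : (fun theta => transport_fun _ _ _ _ * _) = fun=> 0) ?pairing0r//.
  by apply/funext => t; rewrite /vartheta /=; case: asboolP => // _; rewrite mulr0.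
exfalso; have [U CU U0] := cC (pr 0); apply: (nolift (0, 0)); split=> //=.
by exists U => // t _; rewrite segmentE subrr scaler0 addr0.
Qed.

Lemma midpt_class c m p : incl c m -> exists r, midpt k m p = midpt k (rep c) p + L r.
Proof. by move=> /(inclassP k0)[r ->]; exists r; rewrite midptD. Qed.

Definition displacement C b c p := exists l m, is_lift C b c l m /\ l - m = p.

Lemma displacement_class C b c p : displacement C b c p -> incl b (rep c + p).
Proof.
move=> [l [m [[bl /(inclassP k0)[r mr] _] <-]]].
by rewrite -(@inclass_mul R n k k0 b _ r) addrAC -mr addrC subrK.
Qed.

Lemma phi_coef_cases C b c : open_covering C ->
  (phi_coef P C f b c = 0 /\ forall p, ~ displacement C b c p) \/
  exists2 p, displacement C b c p & phi_coef P C f b c = fiber_coef f p (midpt k (rep c) p).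
Proof.
move=> /(phi_coef_lift b c)[[l [m [lm ->]]]|[-> nl]]; [right|left].
  exists (l - m); first by exists l, m.
  have [_ cm _] := lm; have [r ->] := midpt_class (l - m) cm.
  by rewrite periodic1//; exact: fiber_coef_base_periodic.
by split=> // p [l [m [lm _]]]; exact: (nl l m).
Qed.

Lemma short_displacement C b c p (d : R) : open_covering C -> condU1 C -> condU2 C ->
  (forall x y, `|x - y| < d -> exists2 U, C U & segment_inside U x y) ->
  incl b (rep c + p) -> `|scaled k p : V| < d ->
  [/\ close_in C (bs_point R b) (bs_point R c), displacement C b c p &
     forall p', displacement C b c p' -> p' = p].
Proof.
move=> oC U1 U2 hd bp pd.
have sb : pr (scaled k (rep c + p)) = bs_point R b by apply/asboolP.
have cc : incl c (rep c) by exact: (@inclass_rep R n k k0 c).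
have sc : pr (scaled k (rep c)) = bs_point R c by apply/asboolP.
have [|U CU hU] := hd (scaled k (rep c + p)) (scaled k (rep c)).
  by rewrite scaledD addrAC subrr add0r.
split.
- exists U => //; split.
    by rewrite -sb; have := hU 0; rewrite segmentE scale0r addr0 lexx ler01; apply.
  by rewrite -sc; have := hU 1; rewrite segmentE scale1r addrC subrK lexx ler01; apply.
- exists (rep c + p), (rep c); split; last by rewrite addrAC subrr add0r.
  by split=> //; exists U.
move=> p' [l [m [[bl cm [U' CU' hU']] <-]]].
have := @close_lift_unique R n C U' U (scaled k l) (scaled k m) (scaled k (rep c + p)) (scaled k (rep c))
  oC U1 U2 CU' CU hU' hU.
rewrite sb sc => /(_ (asboolW bl) (asboolW cm)) e.
apply: (@of_lattice_inj R n); apply: (scalerI (a := k%:R^-1)); first by rewrite invr_eq0.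
move: e; rewrite /scaled !of_latticeD of_latticeN !scalerDr scalerN opprD addrA subrr add0r.
by move=> /(congr1 -%R); rewrite opprB opprK.
Qed.

End Level.
End PhiCoefficients.

(** * Comparison of the two operators *)

Section IntegralLinear.
Context {R : realType} {n : nat}.
Local Notation V := 'rV[R]_n.
Local Notation E := (V * V)%type.

Lemma integral_X_sum (I : Type) (s : seq I) (a : I -> R[i]) (g : I -> E -> R[i]) :
  (forall i, ccont (g i)) ->
  integral_X (fun z => \sum_(i <- s) a i * g i z) = \sum_(i <- s) a i * integral_X (g i).
Proof.
move=> cg; rewrite integral_XE; last by apply: ccont_sum => i; exact: ccontZ.
have ca i : ccont (fun x => avg (2 * pi) (fun t => g i (x, t))).
  exact: (ccont_avg_param pi2_gt0 (cg i)).
rewrite (_ : (fun x => avg (2 * pi) _) = fun x => \sum_(i <- s) a i * avg (2 * pi) (fun t => g i (x, t))).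
  rewrite avg_sum ?ltr01//; last by move=> i; exact: ccontZ.
  rewrite mulr_sumr; apply: eq_bigr => i _; rewrite avgZ ?ltr01// integral_XE//.
  by rewrite mulrCA.
apply/funext => x; rewrite avg_sum ?pi2_gt0//; last first.
  by move=> i; apply: ccontZ; exact: ccont_slice.
by apply: eq_bigr => i _; rewrite avgZ ?pi2_gt0//; exact: ccont_slice.
Qed.

Lemma ip_X_sumr (I : Type) (s : seq I) (a : I -> R[i]) (g : I -> E -> R[i]) u :
  ccont u -> (forall i, ccont (g i)) ->
  ip_X u (fun z => \sum_(i <- s) a i * g i z) = \sum_(i <- s) a i * ip_X u (g i).
Proof.
move=> cu cg; rewrite /ip_X -integral_X_sum; last by move=> i; apply: ccontM => //; exact: ccontJ.
congr integral_X; apply/funext => z; rewrite mulr_sumr; apply: eq_bigr => i _.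
by rewrite mulrCA.
Qed.

Lemma ip_X_suml (I : Type) (s : seq I) (a : I -> R[i]) (g : I -> E -> R[i]) u :
  ccont u -> (forall i, ccont (g i)) ->
  ip_X (fun z => \sum_(i <- s) a i * g i z) u = \sum_(i <- s) (a i)^* * ip_X (g i) u.
Proof.
move=> cu cg; rewrite /ip_X -integral_X_sum; last by move=> i; apply: ccontM => //; exact: ccontJ.
congr integral_X; apply/funext => z; rewrite rmorph_sum mulr_suml; apply: eq_bigr => i _.
by rewrite rmorphM mulrA.
Qed.

Lemma ip_X_subr (u g h : E -> R[i]) : ccont u -> ccont g -> ccont h ->
  ip_X u (fun z => g z - h z) = ip_X u g - ip_X u h.
Proof.
move=> cu cg ch.
have := @ip_X_sumr bool [:: true; false] (fun i => if i then 1 else -1) (fun i => if i then g else h) u cu.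
rewrite !big_cons big_nil addr0 mul1r mulN1r => <-; last by case.
congr ip_X; apply/funext => z; rewrite !big_cons big_nil addr0 mul1r mulN1r //.
Qed.

End IntegralLinear.

(** * Matrix entries of the Toeplitz operator *)

Section ToeplitzMatrix.
Context {R : realType} {n : nat} (P Q : 'M[R]_n).
Hypothesis P_sym : P^T = P.
Hypothesis Q_sym : Q^T = Q.
Hypothesis Q_pos : pos_def Q.
Variable k : nat.
Hypothesis k0 : (0 < k)%N.
Local Notation V := 'rV[R]_n.
Local Notation E := (V * V)%type.
Local Notation L := (of_lattice R).
Local Notation incl := (@inclass R n k).
Local Notation Th := (Theta P Q).
Local Notation Om := (Omega P Q).
Implicit Types (b c : Bk n k) (p : 'rV[int]_n) (h : E -> R[i]).

Let cT b : ccont (Th b). Proof. exact: ccont_Theta. Qed.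

Let orth b c : ip_X (Th b) (Th c) = (b == c)%:R.
Proof. exact: Theta_orthonormal. Qed.

Let ccomb (d : Bk n k -> R[i]) : ccont (fun z => \sum_(b : Bk n k) d b * Th b z).
Proof. by apply: ccont_sum => b; exact: ccontZ. Qed.

Lemma ip_Theta_comb b (d : Bk n k -> R[i]) :
  ip_X (Th b) (fun z => \sum_(c : Bk n k) d c * Th c z) = d b.
Proof.
rewrite ip_X_sumr// (bigD1 b)//= orth eqxx mulr1 big1 ?addr0// => c cb.
by rewrite orth eq_sym (negPf cb) mulr0.
Qed.

Lemma norm_comb (d : Bk n k -> R[i]) :
  norm_X (fun z => \sum_(b : Bk n k) d b * Th b z) = Num.sqrt (\sum_(b : Bk n k) cmod (d b) ^+ 2).
Proof.
rewrite /norm_X ip_X_suml//.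
under eq_bigr do rewrite ip_Theta_comb mulJc.
by rewrite -rc_sum.
Qed.

(** Since the theta functions are orthonormal and span H^0, the defining property fixes the
    coefficients of the projection; conversely their sum has that property, so that [xget] does not
    fall back to its default. *)
Lemma proj_H0E h : ccont h ->
  proj_H0 k Om h = fun z => \sum_(b : Bk n k) ip_X (Th b) h * Th b z.
Proof.
move=> ch; rewrite /proj_H0; case: xgetP => [t _ [Ht ot]|].
  have [be tE] := H0_span k0 P_sym Q_sym Q_pos Ht.
  rewrite tE; apply/funext => z; apply: eq_bigr => b _; congr (_ * _).
  have := ot _ (Theta_H0 k0 P_sym Q_sym Q_pos b).
  by rewrite ip_X_subr// tE ?ip_Theta_comb// => /eqP; rewrite subr_eq0 => /eqP.
move=> /(_ (fun z => \sum_(b : Bk n k) ip_X (Th b) h * Th b z))[]; split.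
  exact: comb_H0.
move=> u Hu; have [ga ->] := H0_span k0 P_sym Q_sym Q_pos Hu.
rewrite ip_X_suml//; last exact: ccontB.
by rewrite big1// => b _; rewrite ip_X_subr// ip_Theta_comb subrr mulr0.
Qed.

Lemma toeplitz_comb (f : E -> R[i]) (a : Bk n k -> R[i]) : ccont f ->
  toeplitz k Om f (fun z => \sum_(c : Bk n k) a c * Th c z) =
  fun z => \sum_(b : Bk n k)
    (\sum_(c : Bk n k) a c * ip_X (Th b) (fun z => f z * Th c z)) * Th b z.
Proof.
move=> cf; rewrite /toeplitz proj_H0E; last exact: ccontM.
apply/funext => z; apply: eq_bigr => b _; congr (_ * _).
rewrite -ip_X_sumr//; last by move=> c; exact: ccontM.
congr ip_X; apply/funext => w; rewrite mulr_sumr; apply: eq_bigr => c _.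
by rewrite mulrCA.
Qed.

(** Uniform in k because the density has mass 1 and the phase has modulus at most 1; the 2 is that
    of [ler_cmod_avg]. *)
Lemma theta_pairing_bound b c p (h : V -> R[i]) (M : R) : ccont h -> (forall x, cmod (h x) <= M) ->
  cmod (theta_pairing P Q b c p h) <= 2 * M.
Proof.
move=> ch hM; have M0 : 0 <= M := le_trans (cmod_ge0 _) (hM 0).
have [bc|nbc] := boolP (incl b (rep c + p)); last first.
  by rewrite theta_pairing0// cmod0 mulr_ge0.
have ts := theta_pairing1 k0 P_sym Q_sym Q_pos ch bc.
have ds := has_sumZ (2 * M)%:C (density_sum k0 Q_pos (midpt k (rep c) p)).
rewrite mulr1 in ds; apply: (has_sum_le ts) => [|r].
  by apply: eq_has_sum ds => r; rewrite -rcM.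
set mid := midpt k (rep c) p.
have cs : continuous (fun x : V => x - mid - L r).
  by under eq_fun do rewrite -addrA; exact: ct_shift.
have cd := ct_comp cs (@ct_density R n k Q); have cp := ccont_comp cs (@ccont_phase R n k P Q p).
rewrite -mulrA -ravgZ ?ltr01//; apply: ler_cmod_avg; first exact: ltr01.
- by apply: ccontM => //; apply: ccontM => //; exact: ccont_real.
- by apply: ctM => //; exact: ct_cst.
move=> x _; rewrite cmodM [cmod (_%:C * _)]cmodM cmod_real ger0_norm ?density_ge0//.
have d0 : 0 <= density k Q (x - mid - L r) by exact: density_ge0.
apply: ler_pM; [exact: cmod_ge0|by rewrite mulr_ge0 ?cmod_ge0|exact: hM|].
by rewrite ler_piMr// cmod_phase.
Qed.

(** The Fourier series of f converges uniformly and the theta functions are bounded on the compact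
    fundamental domain, so that it may be integrated termwise, over the fiber and then over the
    base. *)
Lemma toeplitz_coef_sum (f : E -> R[i]) (C : R) b c : ccont f -> angle_periodic f ->
  0 <= C -> (forall p x, cmod (fiber_coef f p x) <= C * wt R p) ->
  has_sum (fun p => theta_pairing P Q b c p (fiber_coef f p)) (ip_X (Th b) (fun z => f z * Th c z)).
Proof.
move=> cf af C0 fC.
have cK : compact (fdomain 1 `*` fdomain (2 * pi) : set E).
  by apply: compact_setX; exact: compact_fdomain.
have [Mb Mb0 hMb] := continuous_bounded_on cK (ccont_cmod (cT b)).
have [Mc Mc0 hMc] := continuous_bounded_on cK (ccont_cmod (cT c)).
have cfc p : ccont (fun z : E => fiber_coef f p z.1).
  exact: (ccont_comp (@ct_fst V V) (ccont_fiber_coef p cf)).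
pose F p (z : E) := (Th b z)^* * (fiber_coef f p z.1 * echar p z.2 * Th c z).
have cF p : ccont (F p).
  apply: ccontM; first exact: ccontJ.
  by apply: ccontM => //; apply: ccontM => //; exact: ccont_echar2.
pose G z := (Th b z)^* * (f z * Th c z).
have cG : ccont G by apply: ccontM; [exact: ccontJ|exact: ccontM].
have D0 : 0 <= C * (Mb * Mc) by rewrite !mulr_ge0.
have Fw p x t : fdomain 1 x -> fdomain (2 * pi) t -> cmod (F p (x, t)) <= C * (Mb * Mc) * wt R p.
  move=> Dx Dt; have hb := hMb (x, t) (conj Dx Dt); have hc := hMc (x, t) (conj Dx Dt).
  rewrite ger0_norm ?cmod_ge0// in hb; rewrite ger0_norm ?cmod_ge0// in hc.
  rewrite /F cmodM cmodJ [cmod (_ * Th c _)]cmodM [cmod (fiber_coef _ _ _ * _)]cmodM cmod_echar mulr1.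
  rewrite (_ : C * (Mb * Mc) * wt R p = Mb * (C * wt R p * Mc)); last by ring.
  apply: ler_pM; [exact: cmod_ge0|by rewrite mulr_ge0 ?cmod_ge0|exact: hb|].
  by apply: ler_pM; [exact: cmod_ge0|exact: cmod_ge0|exact: fC|exact: hc].
rewrite /ip_X integral_XE//.
suff h : has_sum (fun p => avg 1 (fun x => avg (2 * pi) (fun t => F p (x, t))))
    (avg 1 (fun x => avg (2 * pi) (fun t => G (x, t)))).
  apply: eq_has_sum (has_sumZ _ h) => p.
  by rewrite -(integral_XE (cF p)).
apply: (@has_sum_avg R n 1 ltr01 _ _ _ _ _ (sum_bounded_wtZ (mulr_ge0 (ler0n R 2) D0))).
- by move=> p; exact: (ccont_avg_param pi2_gt0 (cF p)).
- exact: (ccont_avg_param pi2_gt0 cG).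
- move=> x Dx p; rewrite -mulrA; apply: ler_cmod_avg_cst; first exact: pi2_gt0.
    exact: (ccont_slice x (cF p)).
  by move=> t Dt; exact: Fw.
move=> x Dx; apply: (@has_sum_avg R n (2 * pi) pi2_gt0 _ _ _ _ _ (sum_bounded_wtZ D0)).
- by move=> p; exact: (ccont_slice x (cF p)).
- exact: (ccont_slice x cG).
- by move=> t Dt p; exact: Fw.
move=> t Dt; have := has_sumZ ((Th b (x, t))^* * Th c (x, t)) (fiber_coef_inversion x t cf af fC).
rewrite (_ : _ * f (x, t) = G (x, t)); last by rewrite /G; ring.
by apply: eq_has_sum => p; rewrite /F /=; ring.
Qed.

End ToeplitzMatrix.

Section FiberwiseSections.
Context {R : realType} {n : nat} (k : nat).
Hypothesis k0 : (0 < k)%N.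
Local Notation V := 'rV[R]_n.
Local Notation E := (V * V)%type.
Implicit Types (b c : Bk n k) (s : E -> R[i]).

Let rcA (h : V -> R) : (ravg (2 * pi) h)%:C = avg (2 * pi) (fun x => (h x)%:C).
Proof. by rewrite avg_real// pi2_gt0. Qed.

(** The mean square of g minus its projection onto the character is nonnegative, and expands to the
    difference of the two sides. *)
Lemma cmod_fourier_coef_sqr (g : V -> R[i]) l : ccont g ->
  cmod (fourier_coef g l) ^+ 2 <= ravg (2 * pi) (fun t => cmod (g t) ^+ 2).
Proof.
move=> cg; set a := fourier_coef g l.
have cG : continuous (fun t => cmod (g t) ^+ 2).
  rewrite (_ : (fun t => _) = fun t => cmod (g t) * cmod (g t)); last by apply/funext => t; rewrite expr2.
  by apply: ctM; exact: ccont_cmod.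
have cge : ccont (fun t => echar (- l) t * g t) by apply: ccontM => //; exact: ccont_echar.
have cd : ccont (fun t => g t - a * echar l t).
  by apply: ccontB => //; apply: ccontZ; exact: ccont_echar.
have cD : continuous (fun t => cmod (g t - a * echar l t) ^+ 2).
  rewrite (_ : (fun t => _) = fun t => cmod (g t - a * echar l t) * cmod (g t - a * echar l t)).
    by apply: ctM; exact: ccont_cmod.
  by apply/funext => t; rewrite expr2.
have h0 : 0 <= ravg (2 * pi) (fun t => cmod (g t - a * echar l t) ^+ 2).
  rewrite -[X in X <= _](@ravg_cst R n (2 * pi) pi2_gt0 0); apply: ler_ravg => //; first exact: pi2_gt0.
  - exact: ct_cst.
  - by move=> t _; exact: sqr_ge0.
suff e : (ravg (2 * pi) (fun t => cmod (g t - a * echar l t) ^+ 2))%:C =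
    (ravg (2 * pi) (fun t => cmod (g t) ^+ 2) - cmod a ^+ 2)%:C.
  by move: e h0 => /(congr1 (@complex.Re R)) /= ->; rewrite subr_ge0.
have ce1 : ccont (fun t => - a^* * (echar (- l) t * g t)) by exact: ccontZ.
have ce2 : ccont (fun t => - a * (echar (- l) t * g t)^*) by apply: ccontZ; exact: ccontJ.
have cG' : ccont (fun t => (cmod (g t) ^+ 2)%:C) by exact: ccont_real.
rewrite rcA (_ : (fun t => _) = fun t => (cmod (g t) ^+ 2)%:C + (- a^* * (echar (- l) t * g t) +
   (- a * (echar (- l) t * g t)^* + (cmod a ^+ 2)%:C))); last first.
  apply/funext => t; rewrite -!mulJc !conjE.
  have e1 : (echar l t)^* * echar l t = 1 by rewrite mulJc cmod_echar expr1n.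
  have -> : (g t - a * echar l t)^* = (g t)^* - a^* * (echar l t)^*.
    by rewrite rmorphB rmorphM.
  have -> : (echar (- l) t * g t)^* = echar l t * (g t)^* by rewrite conjcM !conjE -echarN opprK.
  rewrite echarN !conjE.
  rewrite [LHS](_ : _ = (g t)^* * g t + (- a^* * ((echar l t)^* * g t) +
     (- a * (echar l t * (g t)^*) + a^* * a * ((echar l t)^* * echar l t)))); last by ring.
  by rewrite e1 mulr1.
rewrite avgD ?pi2_gt0//; last by apply: ccontD => //; apply: ccontD => //; exact: ccont_cst.
rewrite avgD ?pi2_gt0//; last by apply: ccontD => //; exact: ccont_cst.
rewrite avgD ?pi2_gt0//; last exact: ccont_cst.
rewrite avg_cst ?pi2_gt0// avgZ ?pi2_gt0// avgZ ?pi2_gt0//; last exact: ccontJ.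
rewrite avgJ ?pi2_gt0// -/(fourier_coef g l) -/a -rcA rcB -!mulJc !conjE.
ring.
Qed.

Lemma vartheta_bs b c (theta : V) :
  vartheta b (bs_lift R c, theta) = if b == c then echar (rep b) theta else 0.
Proof.
rewrite /vartheta /=; have [->|bc] := eqVneq b c.
  by rewrite asboolT// bs_liftE psi_scaled.
by rewrite asboolF// => /(bs_point_inj k0) e; rewrite e eqxx in bc.
Qed.

Lemma ip_vartheta b (t : E -> R[i]) : ip_Hk k (vartheta b) t = fourier_coef (fun theta => t (bs_lift R b, theta)) (rep b).
Proof.
rewrite /ip_Hk (bigD1 b)//= [X in _ + X]big1 ?addr0; last first.
  move=> c cb; rewrite integral_TE -[RHS](@avg_cst R n (2 * pi) pi2_gt0 0); congr avg.
  by apply/funext => th; rewrite vartheta_bs eq_sym (negPf cb) conjE conjc_zero mul0r.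
rewrite integral_TE /fourier_coef; congr avg; apply/funext => th.
by rewrite vartheta_bs eqxx conjE -echarN.
Qed.

Lemma Hk_slice s b : Hk k s -> ccont (fun theta => s (bs_lift R b, theta)).
Proof.
by move=> [_ _ /(_ b (bs_lift R b) erefl)[sm _]]; exact: smooth_ccont.
Qed.

(** Bessel's inequality with a single character on each fiber, summed over B_k. *)
Lemma Hk_bessel s : Hk k s -> norm_Hk k s <= 1 ->
  \sum_(c : Bk n k) cmod (ip_Hk k (vartheta c) s) ^+ 2 <= 1.
Proof.
move=> Hs ns; pose N : R := \sum_(c : Bk n k) ravg (2 * pi) (fun t => cmod (s (bs_lift R c, t)) ^+ 2).
have NE : ip_Hk k s s = N%:C.
  rewrite /ip_Hk rc_sum; apply: eq_bigr => c _; rewrite integral_TE rcA; congr avg.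
  by apply/funext => t; rewrite mulJc.
have bN : \sum_(c : Bk n k) cmod (ip_Hk k (vartheta c) s) ^+ 2 <= N.
  by apply: ler_sum => c _; rewrite ip_vartheta; apply: cmod_fourier_coef_sqr; exact: Hk_slice.
apply: (le_trans bN); have N0 : 0 <= N by apply: le_trans bN; apply: sumr_ge0 => c _; exact: sqr_ge0.
move: ns; rewrite /norm_Hk NE /= => h.
by rewrite -(sqr_sqrtr N0) -(expr1n R 2) lerXn2r// nnegrE ?sqrtr_ge0.
Qed.

(** Makes the set in [opnorm_diff] nonempty, so that its supremum is at least 0 instead of minus
    infinity. *)
Lemma zero_Hk : Hk k (fun _ : E => 0) /\ norm_Hk k (fun _ : E => 0) <= 1.
Proof.
split; last first.
  rewrite /norm_Hk (_ : ip_Hk _ _ _ = 0) ?sqrtr0//; apply: big1 => b _.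
  rewrite integral_TE -[RHS](@avg_cst R n (2 * pi) pi2_gt0 0); congr avg.
  by apply/funext => t; rewrite mulr0.
split=> //; first by split=> *; rewrite ?mulr0.
move=> b x _; split; first by apply/smoothP => m; exact: cCm_cst.
by move=> j theta; rewrite /nabla (is_cder_cderive (is_cder_cst 0 _ _)) mulr0 subr0.
Qed.

Variables (P Q : 'M[R]_n) (C : set (set (base R n))) (f : E -> R[i]).

Definition phi_mat b c : R[i] :=
  if `[< close_in C (bs_point R b) (bs_point R c) >] then phi_coef P C f b c else 0.

Lemma identification_phi s : identification k P Q (phi_op k P C f s) =
  fun p => \sum_(b : Bk n k) (\sum_(c : Bk n k) ip_Hk k (vartheta c) s * phi_mat b c) * Theta P Q b p.
Proof.
apply/funext => p; apply: eq_bigr => b _; congr (_ * _).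
rewrite ip_vartheta (_ : (fun theta => _) = fun theta =>
  (\sum_(c : Bk n k) ip_Hk k (vartheta c) s * phi_mat b c) * echar (rep b) theta).
  by rewrite fourier_coefZ; [rewrite fourier_coef_echar eqxx mulr1|exact: ccont_echar].
apply/funext => th; rewrite /phi_op mulr_suml; apply: eq_bigr => c _.
rewrite -mulrA; congr (_ * _); rewrite /phi_mat.
under eq_bigr => b' _ do rewrite vartheta_bs.
case: ifPn => [bc|nbc].
  rewrite (bigD1 b)//= eqxx big1 ?addr0// => b' /andP[_ b'b].
  by rewrite (negPf b'b) mulr0.
rewrite mul0r big1// => b' b'c; case: eqP => [e|_]; rewrite ?mulr0//.
by rewrite -e b'c in nbc.
Qed.

End FiberwiseSections.

(** * Schur's test *)

Section Schur.
Context {R : realType}.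

(** Twice the difference of the two sides is the double sum of w_i w_j (x_i - x_j)^2. *)
Lemma cauchy_weighted (I : finType) (w x : I -> R) : (forall i, 0 <= w i) ->
  (\sum_i w i * x i) ^+ 2 <= (\sum_i w i) * \sum_i w i * x i ^+ 2.
Proof.
move=> w0; rewrite -(ler_pM2l (ltr0n R 2)) expr2 mulr_suml.
have -> : 2 * ((\sum_i w i) * \sum_i w i * x i ^+ 2) =
    \sum_i \sum_j (w i * w j * x i ^+ 2 + w i * w j * x j ^+ 2).
  rewrite [RHS](eq_bigr (fun i => \sum_j w i * w j * x i ^+ 2 + \sum_j w i * w j * x j ^+ 2)); last first.
    by move=> i _; rewrite big_split.
  rewrite big_split /= [X in _ = X + _]exchange_big /= mulr_natl mulr2n; congr (_ + _).
    rewrite mulr_suml; apply: eq_bigr => i _; rewrite mulr_sumr.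
    by apply: eq_bigr => j _; rewrite mulrA [w i * w j]mulrC.
  rewrite mulr_suml; apply: eq_bigr => i _; rewrite mulr_sumr.
  by apply: eq_bigr => j _; rewrite mulrA.
rewrite mulr_sumr; apply: ler_sum => i _; rewrite mulr_sumr mulr_sumr; apply: ler_sum => j _.
have := mulr_ge0 (mulr_ge0 (w0 i) (w0 j)) (sqr_ge0 (x i - x j)).
by move: (w i) (w j) (x i) (x j) => u v y z; nra.
Qed.

(** Cauchy's inequality with weights |D i j| brings in the row sums; exchanging the two sums brings
    in the column sums. *)
Lemma schur_test (I : finType) (D : I -> I -> R[i]) (a : I -> R[i]) (W : R) : 0 <= W ->
  (forall i, \sum_j cmod (D i j) <= W) -> (forall j, \sum_i cmod (D i j) <= W) ->
  \sum_i cmod (\sum_j a j * D i j) ^+ 2 <= W ^+ 2 * \sum_j cmod (a j) ^+ 2.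
Proof.
move=> W0 rW cW.
apply: (@le_trans _ _ (\sum_i W * \sum_j cmod (D i j) * cmod (a j) ^+ 2)).
  apply: ler_sum => i _.
  apply: (@le_trans _ _ ((\sum_j cmod (D i j) * cmod (a j)) ^+ 2)).
    rewrite lerXn2r ?nnegrE ?cmod_ge0//.
      by apply: sumr_ge0 => j _; rewrite mulr_ge0 ?cmod_ge0.
    apply: (le_trans (ler_cmod_sum _ _ _)); apply: ler_sum => j _.
    by rewrite cmodM mulrC.
  apply: (le_trans (cauchy_weighted _ _)); first by move=> j; exact: cmod_ge0.
  rewrite ler_wpM2r//; apply: sumr_ge0 => j _.
  by rewrite mulr_ge0 ?cmod_ge0 ?sqr_ge0.
rewrite -mulr_sumr exchange_big /= expr2 -mulrA ler_wpM2l// mulr_sumr; apply: ler_sum => j _.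
by rewrite -mulr_suml ler_wpM2r ?sqr_ge0.
Qed.

End Schur.

Lemma eventually_all (I : eqType) (s : seq I) (Pr : I -> nat -> Prop) :
  (forall i, exists N, forall k, (N <= k)%N -> Pr i k) ->
  exists N, forall k, (N <= k)%N -> forall i, i \in s -> Pr i k.
Proof.
move=> hP; elim: s => [|i s [N hN]]; first by exists 0%N.
have [M hM] := hP i; exists (maxn N M) => k; rewrite geq_max => /andP[Nk Mk] j.
by rewrite inE => /predU1P[->|js]; [exact: hM|exact: hN].
Qed.

(** The first hypothesis says, in the form in which it is used, that each j is selected by exactly
    one i. The majorants of the D i therefore add up to the sum of w, however large I is. *)
Lemma selected_sum {R : realType} (I : finType) (J : choiceType) (sel : I -> J -> bool)
    (w : J -> R) (W : R) (D : I -> R[i]) (t : I -> J -> R[i]) :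
  (forall j (x : R), \sum_i (if sel i j then x else 0) = x) ->
  (forall j, 0 <= w j) -> sum_bounded w W -> (forall i, has_sum (t i) (D i)) ->
  (forall i j, cmod (t i j) <= if sel i j then w j else 0) ->
  \sum_i cmod (D i) <= W.
Proof.
move=> selE w0 wW tD tw.
have : forall i, exists S : R, has_sum (fun j => (if sel i j then w j else 0)%:C) S%:C.
  move=> i; apply: (@has_sum_ge0 R J (fun j => if sel i j then w j else 0) W).
    by move=> j; case: ifP.
  by move=> A; apply: le_trans (wW A); apply: ler_sum => j _; case: ifP.
move=> /choice[S hS].
have h1 : \sum_i cmod (D i) <= \sum_i S i.
  by apply: ler_sum => i _; exact: has_sum_le (tD i) (hS i) (tw i).
apply: (le_trans h1).
have h2 := has_sum_sum (index_enum I) hS.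
have h3 : has_sum (fun j => (w j)%:C) (\sum_i (S i)%:C).
  by apply: eq_has_sum h2 => j; rewrite -rc_sum selE.
have := has_sum_bounded_le h3 (M := W).
rewrite -rc_sum cmod_real => h4; apply: (le_trans (ler_norm _)); apply: h4.
by move=> A; apply: le_trans (wW A); apply: ler_sum => j _; rewrite cmod_real ger0_norm.
Qed.

Section Comparison.
Context {R : realType} {n : nat} (P Q : 'M[R]_n).
Hypothesis P_sym : P^T = P.
Hypothesis Q_sym : Q^T = Q.
Hypothesis Q_pos : pos_def Q.
Variable C : set (set (base R n)).
Hypothesis C_cover : open_covering C.
Hypothesis U1 : condU1 C.
Hypothesis U2 : condU2 C.
Local Notation V := 'rV[R]_n.
Local Notation E := (V * V)%type.
Local Notation lattice := 'rV[int]_n.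
Local Notation L := (of_lattice R).
Local Notation Th := (Theta P Q).
Implicit Types (p l : lattice) (k : nat).

Lemma inclass_sum k (k0 : (0 < k)%N) l (x : R) :
  \sum_(b : Bk n k) (if @inclass R n k b l then x else 0) = x.
Proof.
have [b bl] := @inclass_ex R n k k0 l.
rewrite (bigD1 b)//= bl big1 ?addr0// => c cb; case: ifP => // cl.
by rewrite (inclass_inj k0 cl bl) eqxx in cb.
Qed.

(** Lets the condition be read with b fixed and c varying, for the row sums. *)
Lemma inclass_swap k (k0 : (0 < k)%N) (b c : Bk n k) p :
  @inclass R n k b (rep c + p) = @inclass R n k c (rep b - p).
Proof.
apply/idP/idP => /(inclassP k0)[r e]; apply/(inclassP k0); exists (- r).
  by rewrite scalerN; apply/eqP; rewrite subr_eq addrAC e addrK.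
by move/eqP: e; rewrite subr_eq => /eqP ->; rewrite scalerN addrAC addrK.
Qed.

Lemma short_scaled p (d : R) : 0 < d -> exists N, forall k, (N <= k)%N -> (0 < k)%N ->
  `|scaled k p : V| < d.
Proof.
move=> d0; exists (Num.bound (`|L p| / d)) => k Nk k0.
have kR : 0 < k%:R :> R by rewrite ltr0n.
rewrite /scaled normrZ gtr0_norm ?invr_gt0// mulrC ltr_pdivrMr// mulrC -ltr_pdivrMr//.
apply: (@lt_le_trans _ _ (Num.bound (`|L p| / d))%:R); last by rewrite ler_nat.
by apply: archi_boundP; rewrite divr_ge0// ltW.
Qed.

Variable f : E -> R[i].
Hypothesis sf : smooth f.
Hypothesis af : angle_periodic f.
Hypothesis bf : base_periodic f.

Let cf : ccont f. Proof. exact: smooth_ccont. Qed.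

Definition defect k (b c : Bk n k) : R[i] :=
  phi_mat P C f b c - ip_X (Th b) (fun z => f z * Th c z).

(** The terms are indexed by p and dominated by one weight for all pairs. On a finite set [F] the
    limit of the Toeplitz entries applies, for k so large that p / k is the only displacement of the
    pair; off [F] the bound is 3 M wt p, namely M from the entry of phi and 2 M from that of T. *)
Lemma defect_bound (e : R) : 0 < e -> exists N, forall k, (N <= k)%N -> (0 < k)%N ->
  exists (w : lattice -> R) (t : Bk n k -> Bk n k -> lattice -> R[i]),
  [/\ forall p, 0 <= w p, sum_bounded w e, forall b c, has_sum (t b c) (defect b c) &
    forall b c p, cmod (t b c p) <= if @inclass R n k b (rep c + p) then w p else 0].
Proof.
move=> e0; have [M M0 hM] := fiber_coef_decay sf af bf.
have [d d0 hd] := short_segment_inside C_cover.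
have e20 : 0 < e / 2 by rewrite divr_gt0.
have M30 : 0 <= 3 * M by rewrite mulr_ge0.
have [F hF] := sum_bounded_tail (fun p => mulr_ge0 M30 (wt_ge0 p)) (sum_bounded_wtZ M30) e20.
(* The half of e not spent on the tail is shared among the modes of [F]; the [+ 1] covers an empty
   [F]. *)
pose e1 := e / 2 / (#|` F|%fset%:R + 1).
have F1 : 0 < #|` F|%fset%:R + 1 :> R by rewrite ltr_wpDl.
have e10 : 0 < e1 by rewrite divr_gt0.
have [|N hN] := @eventually_all _ (enum_fset F) (fun p k => (0 < k)%N ->
    `|scaled k p : V| < d /\ forall b c : Bk n k, @inclass R n k b (rep c + p) ->
    cmod (theta_pairing P Q b c p (fiber_coef f p) - fiber_coef f p (midpt k (rep c) p)) <= e1).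
  move=> p; have [N1 h1] := short_scaled p d0.
  have [N2 h2] := theta_pairing_limit P_sym Q_sym Q_pos p (ccont_fiber_coef p cf) (fiber_coef_base_periodic bf p) e10.
  exists (maxn N1 N2) => k; rewrite geq_max => /andP[Nk1 Nk2] k0.
  by split; [exact: h1|exact: h2].
exists N => k Nk k0.
pose w p := if p \in F then e1 else 3 * M * wt R p.
have w0 p : 0 <= w p by rewrite /w; case: ifP => _; [exact: ltW|rewrite mulr_ge0 ?wt_ge0].
have wW : sum_bounded w e.
  move=> A; rewrite (big_fsetID _ (fun p => p \in F) A) /= [e]splitr; apply: lerD.
    apply: (@le_trans _ _ (\sum_(p <- F) e1)).
      rewrite (eq_big_seq (fun=> e1)); last first.
        by move=> p; rewrite !inE /= => /andP[_ pF]; rewrite /w pF.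
      apply: ler_sum_fsub => [p|]; first exact: ltW.
      by apply/fsubsetP => p; rewrite !inE /= => /andP[].
    rewrite big_const_seq count_predT iter_addr_0.
    apply: (@le_trans _ _ (e1 * (#|` F|%fset%:R + 1))).
      by rewrite -[leLHS]mulr_natr ler_wpM2l ?(ltW e10)// lerDl.
    by rewrite /e1 divfK// gt_eqF.
  rewrite (eq_big_seq (fun p => 3 * M * wt R p)); last first.
    by move=> p; rewrite !inE /= => /andP[_ pF]; rewrite /w (negPf pF).
  apply: hF; apply/fdisjointP => p pF; rewrite !inE /= pF andbF.
  by [].
have : forall bc : Bk n k * Bk n k, exists u : lattice -> R[i], has_sum u (defect bc.1 bc.2) /\
    forall p, cmod (u p) <= if @inclass R n k bc.1 (rep bc.2 + p) then w p else 0.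
  move=> [b c] /=.
  have hT := toeplitz_coef_sum P_sym Q_sym Q_pos k0 b c cf af M0 hM.
  have tb p := theta_pairing_bound P_sym Q_sym Q_pos k0 b c p (ccont_fiber_coef p cf) (fun x => hM p x).
  have t0 p : ~~ @inclass R n k b (rep c + p) -> theta_pairing P Q b c p (fiber_coef f p) = 0.
    by move=> nb; apply: theta_pairing0 => //; exact: ccont_fiber_coef.
  have short p : p \in F -> @inclass R n k b (rep c + p) ->
      [/\ close_in C (bs_point R b) (bs_point R c), displacement C b c p &
     forall p', displacement C b c p' -> p' = p] /\
     cmod (theta_pairing P Q b c p (fiber_coef f p) - fiber_coef f p (midpt k (rep c) p)) <= e1.
    move=> pF bp; have [sp lp] := hN k Nk p pF k0; split; last exact: lp.
    exact: (short_displacement k0 C_cover U1 U2 hd bp sp).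
  have [g [gs gw]] : exists g : lattice -> R[i], has_sum g (phi_mat P C f b c) /\
      forall p, cmod (g p - theta_pairing P Q b c p (fiber_coef f p)) <=
        if @inclass R n k b (rep c + p) then w p else 0.
    (* For the pairs that are not close or have no displacement: then no mode of [F] lies in their
       residue class, as a short segment would realize it, and only Toeplitz terms off [F]
       remain. *)
    have zero : (forall p, p \in F -> ~~ @inclass R n k b (rep c + p)) ->
        forall p, cmod (0 - theta_pairing P Q b c p (fiber_coef f p)) <=
          if @inclass R n k b (rep c + p) then w p else 0.
      move=> nF p; rewrite sub0r cmodN; case: ifPn => bp; last by rewrite t0// cmod0.
      rewrite /w ifN; last by apply: contraL bp => /nF.
      by apply: (le_trans (tb p)); rewrite mulrA ler_wpM2r ?wt_ge0// ler_wpM2r// ler_nat.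
    have hs0 : has_sum (fun _ : lattice => 0 : R[i]) 0.
      have := @has_sum_fin R lattice (fun=> 0) fset0 (fun _ _ => erefl).
      by rewrite big_seq_fset0.
    rewrite /phi_mat; case: asboolP => [cl|ncl]; last first.
      exists (fun=> 0); split=> //; apply: zero => p pF; apply/negP => bp.
      by have [[]] := short p pF bp.
    have [[-> nod]|[p0 dp0 ->]] := phi_coef_cases P cf af bf k0 b c C_cover.
      exists (fun=> 0); split=> //; apply: zero => p pF; apply/negP => bp.
      by have [[_ dp _] _] := short p pF bp; exact: nod dp.
    (* The entry of phi is a single number; as a series over p it is placed entirely at the
       displacement p0. *)
    exists (fun p => if p == p0 then fiber_coef f p0 (midpt k (rep c) p0) else 0); split.
      have := @has_sum_fin R lattice (fun p => if p == p0 then fiber_coef f p0 (midpt k (rep c) p0) else 0) [fset p0]%fset.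
      by rewrite big_seq_fset1 eqxx; apply => p; rewrite inE => /negPf ->.
    move=> p; have [bp|bp] := boolP (@inclass R n k b (rep c + p)); last first.
      rewrite t0// subr0; case: eqP => [pp0|_]; last by rewrite cmod0.
      by rewrite pp0 (displacement_class k0 dp0) in bp.
    rewrite /w; have [pF|pF] := boolP (p \in F).
      have [[_ _ uq] lim] := short p pF bp.
      by rewrite (uq p0 dp0) eqxx cmodBC.
    apply: (le_trans (ler_cmodB _ _)).
    rewrite (_ : 3 * M * wt R p = M * wt R p + 2 * (M * wt R p)); last by ring.
    apply: lerD; last exact: tb.
    by case: eqP => [->|_]; [exact: hM|rewrite cmod0 mulr_ge0 ?wt_ge0].
  exists (fun p => g p - theta_pairing P Q b c p (fiber_coef f p)); split; last exact: gw.
  have := has_sumD gs (has_sumZ (-1) hT); rewrite mulN1r.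
  by apply: eq_has_sum => p; rewrite mulN1r.
move=> /choice[u hu].
exists w, (fun b c => u (b, c)); split=> //.
  by move=> b c; have [] := hu (b, c).
by move=> b c p; have [_] := hu (b, c); apply.
Qed.

Lemma defect_norm (e : R) : 0 < e -> exists N, forall k, (N <= k)%N -> (0 < k)%N ->
  forall s, Hk k s -> norm_Hk k s <= 1 ->
  norm_X (fun p : E => identification k P Q (phi_op k P C f s) p
      - toeplitz k (Omega P Q) f (identification k P Q s) p) <= e.
Proof.
move=> e0; have [N hN] := defect_bound e0; exists N => k Nk k0 s Hs ns.
have [w [t [w0 we ht tw]]] := hN k Nk k0.
pose a (c : Bk n k) := ip_Hk k (vartheta c) s.
have -> : (fun p : E => identification k P Q (phi_op k P C f s) p
      - toeplitz k (Omega P Q) f (identification k P Q s) p) =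
   fun p : E => \sum_(b : Bk n k) (\sum_(c : Bk n k) a c * defect b c) * Th b p.
  apply/funext => p; rewrite identification_phi//.
  rewrite -[identification k P Q s]/(fun p : E => \sum_(b : Bk n k) a b * Th b p).
  rewrite toeplitz_comb// -sumrB; apply: eq_bigr => b _.
  rewrite -mulrBl -sumrB; congr (_ * _); apply: eq_bigr => c _.
  by rewrite /defect mulrBr.
rewrite norm_comb//.
have rows (b : Bk n k) : \sum_c cmod (defect b c) <= e.
  apply: (selected_sum (sel := fun c p => @inclass R n k c (rep b - p)) _ w0 we (ht b)).
    by move=> p x; exact: inclass_sum.
  by move=> c p; rewrite -inclass_swap//.
have cols (c : Bk n k) : \sum_b cmod (defect b c) <= e.
  apply: (selected_sum (sel := fun b p => @inclass R n k b (rep c + p)) _ w0 we (fun b => ht b c)).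
    by move=> p x; exact: inclass_sum.
  by move=> b p; exact: tw.
have := schur_test a (ltW e0) rows cols => sch.
have bes : \sum_c cmod (a c) ^+ 2 <= 1 by exact: Hk_bessel.
rewrite -(ger0_norm (ltW e0)) -sqrtr_sqr ler_sqrt ?exprn_gt0//; last exact: sqr_ge0.
by apply: (le_trans sch); rewrite ler_piMr ?sqr_ge0.
Qed.

Theorem opnorm_diff_cvg : opnorm_diff k P Q C f @[k --> \oo] --> (0 : \bar R)%E.
Proof.
have small (e : R) : 0 < e -> exists N, forall k, (N <= k)%N ->
    (0 <= opnorm_diff k P Q C f <= e%:E)%E.
  (* The successor excludes [k = 0], for which the entries have not been computed. *)
  move=> e0; have [N hN] := defect_norm e0; exists N.+1 => k Nk.
  have k0 : (0 < k)%N by exact: leq_ltn_trans Nk.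
  apply/andP; split.
    apply: (@le_trans _ _ (norm_X (fun p : E => identification k P Q (phi_op k P C f (fun=> 0)) p
      - toeplitz k (Omega P Q) f (identification k P Q (fun=> 0)) p))%:E).
      by rewrite lee_fin sqrtr_ge0.
    by apply: ereal_sup_ubound; exists (fun=> 0) => //; exact: zero_Hk.
  apply: ge_ereal_sup => _ [s [Hs ns] <-]; rewrite lee_fin.
  by apply: hN => //; exact: ltnW.
apply/fine_cvgP; split.
  have [N hN] := small 1 ltr01; exists N => // k /= Nk.
  have /andP[h0 h1] := hN k Nk.
  by rewrite ge0_fin_numE//; exact: le_lt_trans h1 (ltry _).
apply/cvgrPdist_le => e e0; have [N hN] := small e e0; exists N => // k /= Nk.
have /andP[h0 h1] := hN k Nk; rewrite sub0r normrN.
case: (opnorm_diff k P Q C f) h0 h1 => [r| |] //=.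
by rewrite !lee_fin => r0 re; rewrite ger0_norm.
Qed.

End Comparison.

Theorem theorem13 (R : realType) (n : nat) (P Q : 'M[R]_n)
    (P_sym : P^T = P) (Q_sym : Q^T = Q) (Q_pos : pos_def Q)
    (C : set (set (base R n))) (C_cover : open_covering C)
    (U1 : condU1 C) (U2 : condU2 C) (U3 : condU3 C)
    (f : 'rV[R]_n * 'rV[R]_n -> R[i]) (hf : Cc_infty_X f) :
  opnorm_diff k P Q C f @[k --> \oo] --> (0 : \bar R)%E.
Proof.
have [sf bf af] := hf; apply: opnorm_diff_cvg => //.
- by move=> x m t; exact: af.
- by move=> t m x; rewrite scale1r; exact: bf.
Qed.
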